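(* Let $n\ge 2$ and let $\lambda,\mu\in\mathbb R$ satisfy $\mu>0$ and $\lambda+2\mu>0$. There is a constant $C$, depending only on $n,\lambda,\mu$, such that for every $f\in L^1(\mathbb R^n;\mathbb C^n)$ whose Fourier transform $\widehat f$ is supported in the annulus $\{\xi\in\mathbb R^n: 1/2\le|\xi|\le 2\}$ and every $t\in\mathbb R\setminus\{0\}$, $$\|e^{it\sqrt{-\Delta^\ast}}f\|_{L^\infty(\mathbb R^n)}\le C\,|t|^{-\frac{n-1}{2}}\|f\|_{L^1(\mathbb R^n)}.$$
   Context: The Lam\'e operator acts on vector fields $u:\mathbb R^n\to\mathbb C^n$ by $\Delta^\ast u=\mu\Delta u+(\lambda+\mu)\nabla\,\mathrm{div}\,u$, where $\Delta$ acts componentwise. The operator $-\Delta^\ast$ is the Fourier multiplier operator with matrix symbol $L(\xi)=\mu|\xi|^2I_n+(\lambda+\mu)\xi\xi^t$ (with $\xi$ a column vector), which is real symmetric and positive definite for $\xi\ne0$. The operators $\sqrt{-\Delta^\ast}$ and $e^{it\sqrt{-\Delta^\ast}}$ are the Fourier multiplier operators with symbols $\sqrt{L(\xi)}$ (the positive semidefinite square root) and $e^{it\sqrt{L(\xi)}}$ (matrix exponential). Norms of vector fields $f=(f_1,\dots,f_n)$: $\|f\|_{L^r}=\big(\sum_j\|f_j\|_{L^r}^r\big)^{1/r}$ for $1\le r<\infty$ and $\|f\|_{L^\infty}=\max_j\|f_j\|_{L^\infty}$. *)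

(* Defs.v *)
From HB Require Import structures.
From mathcomp Require Import all_boot all_order all_algebra.
From mathcomp Require Import complex.
From mathcomp Require Import all_classical all_reals all_analysis.

Set Implicit Arguments.
Unset Strict Implicit.
Unset Printing Implicit Defensive.
Import Order.TTheory GRing.Theory Num.Theory.
Import numFieldNormedType.Exports.
Local Open Scope classical_set_scope.
Local Open Scope ring_scope.
Local Open Scope complex_scope.

Definition measure_cV_display : measure_display -> measure_display.
Proof. exact. Qed.

(* The sigma-algebra on column vectors generated by the coordinates, as the
   library does for tuples: for T := R it is the Borel sigma-algebra of R^n. *)
Section measurable_cV.
Context {d} {T : sigmaRingType d}.
Variable n : nat.

Let coors : 'I_n -> 'cV[T]_n -> T := fun i x => x i 0.

Let cV_set0 : g_sigma_preimage coors set0.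
Proof. exact: sigma_algebra0. Qed.

Let cV_setC A : g_sigma_preimage coors A -> g_sigma_preimage coors (~` A).
Proof. exact: sigma_algebraC. Qed.

Let cV_bigcup (F : (set 'cV[T]_n)^nat) :
  (forall i, g_sigma_preimage coors (F i)) ->
  g_sigma_preimage coors (\bigcup_i (F i)).
Proof. exact: sigma_algebra_bigcup. Qed.

HB.instance Definition _ := @isMeasurable.Build (measure_cV_display d)
  'cV[T]_n (g_sigma_preimage coors) cV_set0 cV_setC cV_bigcup.

End measurable_cV.

Lemma measurable_fun_cVP d1 d2 (T1 : measurableType d1) (T2 : measurableType d2)
    n (f : T1 -> 'cV[T2]_n) :
  measurable_fun [set: T1] f <->
  forall i, measurable_fun [set: T1] (fun x => f x i 0).
Proof.
pose coor (i : 'I_n) (x : 'cV[T2]_n) := x i 0.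
apply: (@iff_trans _ (g_sigma_preimage (fun i => coor i \o f) `<=` measurable)).
  rewrite g_sigma_preimage_comp; split=> [mf A [/= C preC <-]|prefS].
    exact: mf.
  by move=> _ A mA; apply: prefS; exists A.
split=> [coorfS i|mf].
- move=> _ A mA.
  apply: coorfS; apply: sub_sigma_algebra.
  case: n i => [[] []//|n i] in f coor *.
  rewrite -bigcup_mkord_ord.
  exists i; first exact: ltn_ord.
  by exists A => //; rewrite inord_val.
- apply: smallest_sub; first exact: sigma_algebra_measurable.
  case: n => [|n] in f coor mf *; first by rewrite big_ord0.
  rewrite -bigcup_mkord_ord; apply: bigcup_sub => i Ii.
  by move=> A [B mB <-]; exact: mf.
Qed.

Section lebesgue_cV.
Context {R : realType}.

Definition cVcons n (p : measurableTypeR R * 'cV[R]_n) : 'cV[R]_n.+1 :=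
  col_mx (p.1)%:M p.2.

Lemma cVcons0 n p : @cVcons n p 0 0 = p.1.
Proof.
have -> : (0 : 'I_n.+1) = lshift n (0 : 'I_1) by exact: val_inj.
by rewrite /cVcons (@col_mxEu _ 1 n) mxE.
Qed.

Lemma cVconsS n p i : @cVcons n p (lift ord0 i) 0 = p.2 i 0.
Proof.
by rewrite -rshift1 /cVcons (@col_mxEd _ 1 n).
Qed.

Lemma measurable_cVcons n : measurable_fun setT (@cVcons n).
Proof.
apply/measurable_fun_cVP => i.
case: (unliftP ord0 i) => [j|] ->.
  under eq_fun do rewrite cVconsS.
  by have /measurable_fun_cVP :=
    @measurable_snd _ _ (measurableTypeR R) 'cV[R]_n; exact.
under eq_fun do rewrite cVcons0.
exact: measurable_fst.
Qed.

Section step.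
Context {n : nat} (m : {sigma_finite_measure set 'cV[R]_n -> \bar R}).

Definition lebesgue_cVS : set 'cV[R]_n.+1 -> \bar R :=
  pushforward (@lebesgue_measure R \x m)%E (@cVcons n).

HB.instance Definition _ := Measure.copy lebesgue_cVS
  (measure_function_pushforward__canonical__measure_function_Measure
    (@lebesgue_measure R \x m)%E (@measurable_cVcons n)).

Let lebesgue_cVS_sigma_finite : sigma_finite setT lebesgue_cVS.
Proof.
have /sigma_finiteP[F [TF ndF Foo]] := sigma_finiteT (@lebesgue_measure R).
have /sigma_finiteP[G [TG ndG Goo]] := sigma_finiteT m.
pose uncons (x : 'cV[R]_n.+1) : measurableTypeR R * 'cV[R]_n :=
  (x 0 0, \col_i x (lift ord0 i) 0).
have coorm (i : 'I_n.+1) : measurable_fun setT (fun x : 'cV[R]_n.+1 => x i 0).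
  by have /measurable_fun_cVP := @measurable_id _ 'cV[R]_n.+1 setT; exact.
have mu : measurable_fun setT uncons.
  apply/measurable_fun_pairP; split => /=.
    exact: coorm.
  apply/measurable_fun_cVP => i /=.
  rewrite (_ : (fun _ => _) = fun x : 'cV[R]_n.+1 => x (lift ord0 i) 0).
    exact: coorm.
  by apply/funext => x; rewrite mxE.
have consK : cancel (@cVcons n) uncons.
  move=> -[a b]; congr pair; first exact: cVcons0.
  by apply/matrixP => i j; rewrite mxE cVconsS (ord1 j).
exists (fun k => uncons @^-1` (F k `*` G k)).
  rewrite -preimage_bigcup (_ : \bigcup_i _ = setT) ?preimage_setT//.
  apply/seteqP; split => // -[x y] _.
  have [i _ Fix] : (\bigcup_i F i) x by rewrite -TF.
  have [j _ Gjy] : (\bigcup_i G i) y by rewrite -TG.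
  exists (maxn i j) => //; split => /=.
    by move: x Fix; exact/subsetPset/ndF/leq_maxl.
  by move: y Gjy; exact/subsetPset/ndG/leq_maxr.
move=> k; have [mF Fk] := Foo k; have [mG Gk] := Goo k.
have mFG : measurable (F k `*` G k) by exact: measurableX.
split; first by rewrite -[X in measurable X]setTI; exact: mu.
rewrite /lebesgue_cVS /pushforward -comp_preimage.
rewrite (_ : _ \o _ = id); last by apply/funext => x; exact: consK.
by rewrite preimage_id product_measure1E// lte_mul_pinfty// ge0_fin_numE.
Qed.

HB.instance Definition _ := Measure_isSigmaFinite.Build _ _ _ lebesgue_cVS
  lebesgue_cVS_sigma_finite.

End step.

(* Lebesgue measure on R^n (on Borel sets), as an iterated product measure;
   see lebesgue_cV_box. *)
Fixpoint lebesgue_cV (n : nat) : {sigma_finite_measure set 'cV[R]_n -> \bar R} :=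
  if n is n'.+1 then lebesgue_cVS (lebesgue_cV n') else \d_(0 : 'cV[R]_0).

Lemma lebesgue_cV_box n (A : 'I_n -> set R) :
  (forall i, measurable (A i)) ->
  lebesgue_cV n [set x | forall i, A i (x i 0)] =
  (\prod_(i < n) lebesgue_measure (A i))%E.
Proof.
elim: n A => [|n IH] A mA.
  rewrite big_ord0 /= diracE mem_set//. by move => [].
have coorm (i : 'I_n) : measurable_fun setT (fun x : 'cV[R]_n => x i 0).
  by have /measurable_fun_cVP := @measurable_id _ 'cV[R]_n setT; exact.
rewrite big_ord_recl /= -IH; last by [].
rewrite /lebesgue_cVS /pushforward.
have E : @cVcons n @^-1` [set x : 'cV[R]_n.+1 | forall i, A i (x i 0)] =
    (A ord0 `*` [set x : 'cV[R]_n | forall i : 'I_n, A (lift ord0 i) (x i 0)]).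
  apply/seteqP; split => -[x v] /=.
    move=> H; split; first by have := H ord0; rewrite cVcons0.
    by move=> i; have := H (lift ord0 i); rewrite cVconsS.
  move=> [H1 H2] i.
  by case: (unliftP ord0 i) => [j|] ->; rewrite ?cVcons0 ?cVconsS.
rewrite {}E product_measure1E//; first exact: mA.
rewrite (_ : [set _ | _] = \bigcap_(i in [set: 'I_n])
    ((fun x : 'cV[R]_n => x i 0) @^-1` (A (lift ord0 i)))).
  apply: fin_bigcap_measurable => // i _.
  by rewrite -[X in measurable X]setTI; exact: coorm.
by apply/seteqP; split => x /=; [move=> H i _; exact: H|move=> H i; exact: H].
Qed.

End lebesgue_cV.
Arguments lebesgue_cV : clear implicits.

Section complex_analysis.
Context {R : realType}.
Implicit Types n : nat.

Definition expi (a : R) : R[i] := cos a +i* sin a.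

Definition cmeasurable n (g : 'cV[R]_n -> R[i]) :=
  measurable_fun setT (fun x => complex.Re (g x)) /\
  measurable_fun setT (fun x => complex.Im (g x)).

Definition cintegral n (g : 'cV[R]_n -> R[i]) : R[i] :=
  (\int[lebesgue_cV R n]_x complex.Re (g x))%R +i*
  (\int[lebesgue_cV R n]_x complex.Im (g x))%R.

Definition dotv n (x y : 'cV[R]_n) : R := \sum_(i < n) x i 0 * y i 0.

(* The norm that the library puts on 'cV[R]_n is the sup norm. *)
Definition enorm n (x : 'cV[R]_n) : R := Num.sqrt (dotv x x).

(* ||f||_{L^p} for a vector field f : R^n -> C^n and 1 <= p <= +oo. *)
Definition vLnorm n (p : \bar R) (f : 'cV[R]_n -> 'cV[R[i]]_n) : \bar R :=
  let N (j : 'I_n) := Lnorm (lebesgue_cV R n) p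
    (fun x => (ComplexField.Normc.normc (f x j 0))%:E) in
  match p with
  | r%:E => ((\sum_(j < n) N j `^ r) `^ r^-1)%E
  | _ => (\big[maxe/0]_(j < n) N j)%E
  end.

Definition inL1 n (f : 'cV[R]_n -> 'cV[R[i]]_n) :=
  (forall j, cmeasurable (fun x => f x j 0)) /\ (vLnorm 1 f < +oo)%E.

(* hat f(xi) = \int e^{-i x.xi} f(x) dx: the factor 2 pi is in the inverse, so
   that -Delta has symbol |xi|^2. *)
Definition fourier n (f : 'cV[R]_n -> 'cV[R[i]]_n) (xi : 'cV[R]_n) :
    'cV[R[i]]_n :=
  \col_j cintegral (fun x => expi (- dotv x xi) * f x j 0).

Definition inv_fourier n (g : 'cV[R]_n -> 'cV[R[i]]_n) (x : 'cV[R]_n) :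
    'cV[R[i]]_n :=
  \col_j (((2 * pi) ^- n)%:C *
          cintegral (fun xi => expi (dotv x xi) * g xi j 0)).

(* m(D) f = F^{-1} (m hat f), given pointwise by the inversion integral; this is
   meant for f and m such that m hat f is integrable. In particular it applies
   when f is in L^1, hat f is compactly supported and m is continuous. *)
Definition fourier_multiplier n (m : 'cV[R]_n -> 'M[R[i]]_n)
    (f : 'cV[R]_n -> 'cV[R[i]]_n) : 'cV[R]_n -> 'cV[R[i]]_n :=
  inv_fourier (fun xi => m xi *m fourier f xi).

Definition supp n (g : 'cV[R]_n -> 'cV[R[i]]_n) : set 'cV[R]_n :=
  closure [set xi | g xi != 0].

Definition psdmx n (S : 'M[R]_n) :=
  S^T = S /\ forall x : 'cV[R]_n, 0 <= (x^T *m S *m x) 0 0.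

(* A positive semidefinite A has exactly one positive semidefinite square root;
   0 is only the default value outside of that case. *)
Definition sqrtmx n (A : 'M[R]_n) : 'M[R]_n :=
  xget 0 [set S | psdmx S /\ S *m S = A].

(* R[i]^o is R[i] with the topology given by the modulus. *)
Definition expmx n (A : 'M[R[i]]_n) : 'M[R[i]]_n :=
  limn (series (fun k => (k`!%:R)^-1 *: A ^+ k : 'M[R[i]^o]_n)).

Definition lame_symbol n (lambda mu : R) (xi : 'cV[R]_n) : 'M[R]_n :=
  (mu * enorm xi ^+ 2)%:M + (lambda + mu) *: (xi *m xi^T).

(* The half-wave propagator of the Lame operator; t *i is the complex number
   i t. *)
Definition lame_wave n (lambda mu t : R) :
    ('cV[R]_n -> 'cV[R[i]]_n) -> 'cV[R]_n -> 'cV[R[i]]_n :=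
  fourier_multiplier (fun xi =>
    expmx ((t *i) *: map_mx (real_complex R) (sqrtmx (lame_symbol lambda mu xi)))).

End complex_analysis.

(* Main.v *)
Require Import Defs.
From HB Require Import structures.
From mathcomp Require Import all_boot all_order all_algebra.
From mathcomp Require Import complex ring lra.
From mathcomp Require Import all_classical all_reals all_analysis.
From mathcomp Require Import measurable_realfun ess_sup_inf.
Import Order.TTheory GRing.Theory Num.Theory.
Import numFieldNormedType.Exports.
Local Open Scope classical_set_scope.
Local Open Scope ring_scope.

(* For xi <> 0, with P the orthogonal projection onto the line of xi, the square
   root of the symbol is sqrt(mu) |xi| (1 - P) + sqrt(lambda + 2 mu) |xi| P, so
   the propagator is a sum of two scalar half-wave propagators with speeds
   sqrt(mu) and sqrt(lambda + 2 mu), cut off by amplitudes built from 1 and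
   xi_k xi_l / |xi|^2. By Fubini it suffices to bound the kernels
   \int e^{i x.xi} e^{i t |xi|} b(xi) dxi by C |t|^{-(n-1)/2} uniformly in x.

   Instead of stationary phase on the sphere, |xi| is traded for |xi|^2. The
   integrals \int e^{i t y} y^k (r^2 - y^2)_+ dy, k = 0, 1, are elementary in
   sin(t r) and cos(t r); solving for these two and expanding u_+ e^{-u}
   (at u = r^2 - y^2) by Fourier inversion writes e^{i t r} as a superposition
   over sg of Schroedinger phases e^{i sg r^2}, with the weights
   ramp_hat(sg) * \int e^{i t y - i sg y^2} y^k e^{-y^2} dy. With T = |t|, this
   Gaussian integral decays like exp(- T^2 / (4 (1 + sg^2))), which confines the
   superposition to |sg| >~ T. The phase x.xi + sg |xi|^2 splits over the
   coordinates, so van der Corput's lemma in each of them gives the kernel bound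
   (1 + sg^2)^{-n/4}, and integrating this against the weights yields
   T^{-(n+3)/2}; the coefficients of the inversion cost a factor T^2.

   To have product amplitudes, the annulus is cut into the cells where j is the
   first coordinate with |xi_j| >= d; powers of 1/|xi| are written as Gaussian
   averages \int e^{-q^2 |xi|^2} dq, which again split over the coordinates. *)

Set Implicit Arguments.
Unset Strict Implicit.
Unset Printing Implicit Defensive.
Local Open Scope complex_scope.
Local Notation normc := ComplexField.Normc.normc.

(** * Complex-valued integrals and Fubini *)

Section complex_facts.
Context {R : realType}.
Implicit Types (z w : R[i]) (a b r : R).

(** The two exponentials are matched to each other. The ramp u_+ is damped by e^{-u} to be
    integrable, and its continuity at 0 makes the transform O(1 / (1 + sg^2)), hence integrable,
    where a profile with a jump would only give 1 / |sg|. At u = r^2 - y^2 the damping is e^{-r^2}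
    e^{y^2}: the growth in y is cancelled exactly by the weight e^{-y^2} that localizes the
    superposition, and the rest is undone by a factor e^{|xi|^2} in the amplitude. Kernel bounds are
    therefore needed for amplitudes weighted by e^{- be |xi|^2} with be = -1; the Gaussian averages
    for 1 / |xi| add q^2 to be, which is why everything is uniform over be >= -1.

    Two moments occur because k = 0 alone gives a single combination of sin(t r) and cos(t r).
    Solving the system costs powers of 1 / r up to r^{-3}, hence amplitudes that stay away from the
    origin.

    Sharp edges of the cells are harmless: van der Corput's lemma is applied on intervals and sees
    the amplitude only through its size and variation there. *)

Lemma ReD z w : complex.Re (z + w) = complex.Re z + complex.Re w.
Proof. by case: z => ? ?; case: w. Qed.

Lemma ImD z w : complex.Im (z + w) = complex.Im z + complex.Im w.
Proof. by case: z => ? ?; case: w. Qed.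

Lemma ReM z w : complex.Re (z * w) =
  complex.Re z * complex.Re w - complex.Im z * complex.Im w.
Proof. by case: z => ? ?; case: w. Qed.

Lemma ImM z w : complex.Im (z * w) =
  complex.Re z * complex.Im w + complex.Im z * complex.Re w.
Proof. by case: z => ? ?; case: w. Qed.

Lemma normc_ge0 z : 0 <= normc z.
Proof. by case: z => ? ?; exact: sqrtr_ge0. Qed.

Lemma sqr_normc_ReIm z : normc z ^+ 2 = complex.Re z ^+ 2 + complex.Im z ^+ 2.
Proof. by case: z => a b; rewrite /= sqr_sqrtr// addr_ge0// sqr_ge0. Qed.

Lemma normc_real r : normc r%:C = `|r|.
Proof. by rewrite /= expr0n addr0 sqrtr_sqr. Qed.

Lemma normr_Re_le z : `|complex.Re z| <= normc z.
Proof.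
by rewrite -ler_sqr ?nnegrE ?normc_ge0// real_normK ?num_real//
  sqr_normc_ReIm lerDl sqr_ge0.
Qed.

Lemma normr_Im_le z : `|complex.Im z| <= normc z.
Proof.
by rewrite -ler_sqr ?nnegrE ?normc_ge0// real_normK ?num_real//
  sqr_normc_ReIm lerDr sqr_ge0.
Qed.

Lemma normc_expi a : normc (expi a) = 1.
Proof. by rewrite /= cos2Dsin2 sqrtr1. Qed.

Lemma expiD a b : expi (a + b) = expi a * expi b.
Proof. by apply/eqP; rewrite eq_complex/= cosD sinD eqxx /= addrC. Qed.

Lemma expi0 : expi 0 = 1 :> R[i].
Proof. by rewrite /expi cos0 sin0. Qed.

Lemma cos_sin_surj a b : a ^+ 2 + b ^+ 2 = 1 -> exists th, cos th = a /\ sin th = b.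
Proof.
move=> ab1; have a1 : -1 <= a <= 1.
  by apply/andP; split; nra.
have sb : Num.sqrt (1 - a ^+ 2) = `|b|.
  by rewrite -ab1 addrC addKr sqrtr_sqr.
have [b0|b0] := leP 0 b.
  by exists (acos a); rewrite acosK// sin_acos// sb ger0_norm.
by exists (- acos a); rewrite cosN acosK// sinN sin_acos// sb ltr0_norm// opprK.
Qed.

(* Duality: the modulus is the supremum of the rotated real parts. *)
Lemma normc_le_rot z b :
  (forall th, complex.Re (expi th * z) <= b) -> normc z <= b.
Proof.
have [z0|z0] := eqVneq (normc z) 0.
  by move=> /(_ 0); rewrite z0 (ComplexField.Normc.eq0_normc z0) mulr0.
have zp : 0 < normc z by rewrite lt_def z0 normc_ge0.
have : (complex.Re z / normc z) ^+ 2 + (- complex.Im z / normc z) ^+ 2 = 1.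
  by rewrite !expr_div_n sqrrN -mulrDl -sqr_normc_ReIm divff// expf_neq0.
move=> /cos_sin_surj[th [c s]] /(_ th); apply: le_trans.
rewrite ReM /= c s le_eqVlt; apply/orP; left; apply/eqP.
rewrite (_ : _ - _ = (complex.Re z ^+ 2 + complex.Im z ^+ 2) / normc z); last by field.
by rewrite -sqr_normc_ReIm; field.
Qed.

End complex_facts.

Section complex_integral.
Context d (T : measurableType d) (R : realType).
Variable mu : {measure set T -> \bar R}.
Implicit Types (f g : T -> R[i]) (h : T -> R).

Definition cmfun f := measurable_fun setT (fun x => complex.Re (f x)) /\
  measurable_fun setT (fun x => complex.Im (f x)).

Definition cint f : R[i] :=
  (\int[mu]_x complex.Re (f x))%R +i* (\int[mu]_x complex.Im (f x))%R.

Definition cintegrable f :=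
  mu.-integrable setT (EFin \o (fun x => complex.Re (f x))) /\
  mu.-integrable setT (EFin \o (fun x => complex.Im (f x))).

Lemma cmfunM f g : cmfun f -> cmfun g -> cmfun (fun x => f x * g x).
Proof.
move=> [f1 f2] [g1 g2]; split.
  under eq_fun do rewrite ReM.
  by apply: measurable_funB; apply: measurable_funM.
under eq_fun do rewrite ImM.
by apply: measurable_funD; apply: measurable_funM.
Qed.

Lemma cmfunD f g : cmfun f -> cmfun g -> cmfun (fun x => f x + g x).
Proof.
move=> [f1 f2] [g1 g2]; split.
  by under eq_fun do rewrite ReD; apply: measurable_funD.
by under eq_fun do rewrite ImD; apply: measurable_funD.
Qed.

Lemma cmfun_real h : measurable_fun setT h -> cmfun (fun x => (h x)%:C).
Proof. by move=> mh; split => //=; exact: measurable_cst. Qed.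

Lemma cmfun_cst (z : R[i]) : cmfun (fun=> z).
Proof. by split; exact: measurable_cst. Qed.

Lemma cmfun_expi h : measurable_fun setT h -> cmfun (fun x => expi (h x)).
Proof.
move=> mh; split => /=; apply: measurableT_comp => //;
  apply: continuous_measurable_fun.
  exact: continuous_cos.
exact: continuous_sin.
Qed.

Lemma measurable_normc f : cmfun f -> measurable_fun setT (fun x => normc (f x)).
Proof.
move=> [f1 f2].
rewrite (_ : (fun _ => _) =
   fun x => Num.sqrt (complex.Re (f x) ^+ 2 + complex.Im (f x) ^+ 2)); last first.
  by apply/funext => x; case: (f x).
apply: measurableT_comp; first by apply: continuous_measurable_fun; exact: sqrt_continuous.
by apply: measurable_funD; apply: measurable_funX.
Qed.

Lemma cintegrable_le f h : cmfun f -> mu.-integrable setT (EFin \o h) ->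
  (forall x, normc (f x) <= h x) -> cintegrable f.
Proof.
move=> [f1 f2] ih fh; split; apply: le_integrable ih => //.
- exact/measurable_EFinP.
- move=> x _ /=; rewrite lee_fin (le_trans _ (ler_norm _))//.
  exact: le_trans (normr_Re_le _) _.
- exact/measurable_EFinP.
- move=> x _ /=; rewrite lee_fin (le_trans _ (ler_norm _))//.
  exact: le_trans (normr_Im_le _) _.
Qed.

Lemma cintegrable_cmfun f : cintegrable f -> cmfun f.
Proof. by move=> [/measurable_int/measurable_EFinP ? /measurable_int/measurable_EFinP]. Qed.

Lemma cintegrable_normc f : cintegrable f ->
  mu.-integrable setT (EFin \o (fun x => normc (f x))).
Proof.
move=> fi; have mf := cintegrable_cmfun fi.
have [f1 f2] := fi.
have i1 := integrable_norm f1; have i2 := integrable_norm f2.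
apply: le_integrable (integrableD _ i1 i2) => //.
  exact/measurable_EFinP/measurable_normc.
move=> x _ /=; rewrite lee_fin.
rewrite ger0_norm ?normc_ge0// ger0_norm ?addr_ge0//.
rewrite -ler_sqr ?nnegrE ?normc_ge0 ?addr_ge0//.
rewrite sqr_normc_ReIm sqrrD !real_normK ?num_real//.
have := mulr_ge0 (normr_ge0 (complex.Re (f x))) (normr_ge0 (complex.Im (f x))).
lra.
Qed.

Lemma cintZl (z : R[i]) f : cintegrable f ->
  cint (fun x => z * f x) = z * cint f.
Proof.
move=> [f1 f2]; apply/eqP; rewrite eq_complex ReM ImM /=.
have fZ1 (c : R) : mu.-integrable setT (EFin \o (fun x => c * complex.Re (f x))).
  by have := integrableZl measurableT c f1.
have fZ2 (c : R) : mu.-integrable setT (EFin \o (fun x => c * complex.Im (f x))).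
  by have := integrableZl measurableT c f2.
under eq_Rintegral do rewrite ReM.
rewrite RintegralB// !RintegralZl// eqxx /=.
under eq_Rintegral do rewrite ImM.
by rewrite RintegralD// !RintegralZl// eqxx.
Qed.

Lemma cintegrableZl (z : R[i]) f : cintegrable f -> cintegrable (fun x => z * f x).
Proof.
move=> fi; have ni := cintegrable_normc fi.
apply: (@cintegrable_le _ (fun x => normc z * normc (f x))).
- by apply: cmfunM; [exact: cmfun_cst|exact: cintegrable_cmfun].
- by have := integrableZl measurableT (normc z) ni.
- by move=> x; rewrite ComplexField.Normc.normcM.
Qed.

Lemma cintegrableD f g : cintegrable f -> cintegrable g ->
  cintegrable (fun x => f x + g x).
Proof.
move=> fi gi; have fn := cintegrable_normc fi; have gn := cintegrable_normc gi.
apply: (@cintegrable_le _ (fun x => normc (f x) + normc (g x))).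
- by apply: cmfunD; exact: cintegrable_cmfun.
- by have := integrableD measurableT fn gn.
- by move=> x; exact: le_normcD.
Qed.

Lemma cintD f g : cintegrable f -> cintegrable g ->
  cint (fun x => f x + g x) = cint f + cint g.
Proof.
move=> [f1 f2] [g1 g2]; apply/eqP; rewrite eq_complex ReD ImD /=.
under eq_Rintegral do rewrite ReD.
rewrite RintegralD// eqxx /=.
under eq_Rintegral do rewrite ImD.
by rewrite RintegralD.
Qed.

Lemma eq_cint f g : (forall x, f x = g x) -> cint f = cint g.
Proof. by move=> /funext ->. Qed.

Lemma cint0 : cint (fun=> 0) = 0.
Proof. by rewrite /cint /= Rintegral_cst// mul0r. Qed.

Lemma cintegrable0 : cintegrable (fun=> 0).
Proof. by split; exact: integrable0. Qed.

Lemma normc_cint_le f h : cintegrable f -> mu.-integrable setT (EFin \o h) ->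
  (forall x, normc (f x) <= h x) -> normc (cint f) <= \int[mu]_x h x.
Proof.
move=> fi hi fh; apply: normc_le_rot => th.
rewrite -cintZl// /=; apply: le_Rintegral => //.
  by have [] := cintegrableZl (expi th) fi.
move=> x _; apply: (le_trans (ler_norm _)); apply: (le_trans (normr_Re_le _)).
by rewrite ComplexField.Normc.normcM normc_expi mul1r.
Qed.

End complex_integral.

(** * Fubini under domination by a product *)

Section product_domination.
Context d1 d2 (T1 : measurableType d1) (T2 : measurableType d2) (R : realType).
Variables (m1 : {sigma_finite_measure set T1 -> \bar R})
          (m2 : {sigma_finite_measure set T2 -> \bar R}).
Variables (g : T1 -> R) (h : T2 -> R).
Hypotheses (ig : m1.-integrable setT (EFin \o g))
           (ih : m2.-integrable setT (EFin \o h)).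

Lemma integrable_prodM : (m1 \x m2)%E.-integrable setT
  (EFin \o (fun z : T1 * T2 => g z.1 * h z.2)).
Proof.
have mg : measurable_fun setT g by exact/measurable_EFinP/(measurable_int m1).
have mh : measurable_fun setT h by exact/measurable_EFinP/(measurable_int m2).
apply/integrable12ltyP.
  apply/measurable_EFinP; apply: measurable_funM.
    exact: measurableT_comp mg measurable_fst.
  exact: measurableT_comp mh measurable_snd.
have ih' := integrable_abse ih.
rewrite (eq_integral (fun x => (\int[m2]_y `|(h y)%:E|) * `|(g x)%:E|)%E); last first.
  move=> x _ /=; rewrite -ge0_integralZr//; last first.
    exact: measurable_int ih'.
  by apply: eq_integral => y _ /=; rewrite normrM EFinM muleC.
rewrite ge0_integralZl//.
- apply: lte_mul_pinfty => //; [exact: integral_ge0|exact: integrable_fin_num|].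
  by move/integrableP : ig => [].
- by apply: measurableT_comp => //; exact/measurable_EFinP.
- exact: integral_ge0.
Qed.

Section real_valued.
Variable f : T1 * T2 -> R.
Hypotheses (mf : measurable_fun setT f) (fgh : forall x y, `|f (x, y)| <= g x * h y).

Let fi : (m1 \x m2)%E.-integrable setT (EFin \o f).
Proof.
apply: le_integrable integrable_prodM => //; first exact/measurable_EFinP.
by move=> [x y] _ /=; rewrite lee_fin (le_trans (fgh x y))// ler_norm.
Qed.

Lemma integrable_section1 x : m2.-integrable setT (EFin \o (fun y => f (x, y))).
Proof.
apply: le_integrable (integrableZl measurableT (g x) ih) => //.
  apply/measurable_EFinP; apply: measurableT_comp mf _.
  exact: measurable_pair1.
by move=> y _ /=; rewrite lee_fin (le_trans (fgh x y))// ler_norm.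
Qed.

Lemma integrable_section2 y : m1.-integrable setT (EFin \o (fun x => f (x, y))).
Proof.
apply: le_integrable (integrableZl measurableT (h y) ig) => //.
  apply/measurable_EFinP; apply: measurableT_comp mf _.
  exact: measurable_pair2.
by move=> x _ /=; rewrite lee_fin (le_trans (fgh x y))// mulrC ler_norm.
Qed.

(** Domination at every point, not just almost everywhere, makes every section integrable, so that
    [fine] never meets an infinite inner integral and the real-valued Fubini follows from the
    extended one. *)
Let F1E x : (\int[m2]_y f (x, y))%:E = fubini_F m2 (EFin \o f) x.
Proof. by rewrite /Rintegral fineK//; exact: integrable_fin_num (integrable_section1 x). Qed.

Let F2E y : (\int[m1]_x f (x, y))%:E = fubini_G m1 (EFin \o f) y.
Proof. by rewrite /Rintegral fineK//; exact: integrable_fin_num (integrable_section2 y). Qed.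

Lemma integrable_Rintegral1 :
  m1.-integrable setT (EFin \o (fun x => \int[m2]_y f (x, y))).
Proof.
by apply: eq_integrable (integrable_fubini_F fi) => // x _ /=; rewrite F1E.
Qed.

Lemma integrable_Rintegral2 :
  m2.-integrable setT (EFin \o (fun y => \int[m1]_x f (x, y))).
Proof.
have mF2 : measurable_fun setT (fun y => \int[m1]_x f (x, y)).
  apply/measurable_EFinP; apply: (eq_measurable_fun (fubini_G m1 (EFin \o f))).
    by move=> y _; exact/esym/F2E.
  have := measurable_fubini_G fi.
  by [].
apply: le_integrable (integrableZl measurableT (\int[m1]_x g x) ih) => //.
  exact/measurable_EFinP.
move=> y _ /=; rewrite lee_fin; apply: (le_trans _ (ler_norm _)).
apply: (le_trans (le_normr_Rintegral measurableT (integrable_section2 y))).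
rewrite -RintegralZr//; apply: le_Rintegral => //.
- exact: integrable_norm (integrable_section2 y).
- by have := integrableZr measurableT (h y) ig.
Qed.

Lemma Rintegral_prod1 :
  \int[m1]_x (\int[m2]_y f (x, y)) = \int[(m1 \x m2)%E]_z f z.
Proof.
rewrite [in RHS]/Rintegral -integral12_prod_meas1//.
by congr fine; apply: eq_integral => x _; rewrite F1E.
Qed.

Lemma Rintegral_prod2 :
  \int[m2]_y (\int[m1]_x f (x, y)) = \int[(m1 \x m2)%E]_z f z.
Proof.
rewrite [in RHS]/Rintegral -integral21_prod_meas1//.
by congr fine; apply: eq_integral => x _; rewrite F2E.
Qed.

End real_valued.

Variable f : T1 * T2 -> R[i].
Hypotheses (mf : cmfun f) (fgh : forall x y, normc (f (x, y)) <= g x * h y).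

Let Rfgh x y : `|complex.Re (f (x, y))| <= g x * h y.
Proof. exact: le_trans (normr_Re_le _) _. Qed.

Let Ifgh x y : `|complex.Im (f (x, y))| <= g x * h y.
Proof. exact: le_trans (normr_Im_le _) _. Qed.

Lemma cintegrable_cint1 : cintegrable m1 (fun x => cint m2 (fun y => f (x, y))).
Proof.
by have [f1 f2] := mf; split; [have := integrable_Rintegral1 f1 Rfgh|
  have := integrable_Rintegral1 f2 Ifgh].
Qed.

Lemma cintegrable_cint2 : cintegrable m2 (fun y => cint m1 (fun x => f (x, y))).
Proof.
by have [f1 f2] := mf; split; [have := integrable_Rintegral2 f1 Rfgh|
  have := integrable_Rintegral2 f2 Ifgh].
Qed.

Lemma cint_prod1 :
  cint m1 (fun x => cint m2 (fun y => f (x, y))) = cint (m1 \x m2)%E f.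
Proof.
have [f1 f2] := mf; rewrite /cint /=.
by rewrite (Rintegral_prod1 f1 Rfgh) (Rintegral_prod1 f2 Ifgh).
Qed.

Lemma cint_fubini : cint m1 (fun x => cint m2 (fun y => f (x, y))) =
  cint m2 (fun y => cint m1 (fun x => f (x, y))).
Proof.
rewrite cint_prod1; have [f1 f2] := mf; rewrite /cint /=.
by rewrite (Rintegral_prod2 f1 Rfgh) (Rintegral_prod2 f2 Ifgh).
Qed.

End product_domination.

(** * Integration over column vectors, one coordinate at a time *)

Section column_vectors.
Context {R : realType}.
Implicit Types n : nat.

Lemma cintegralE n (g : 'cV[R]_n -> R[i]) : cintegral g = cint (lebesgue_cV R n) g.
Proof. by []. Qed.

Lemma measurable_coord n (i : 'I_n) :
  measurable_fun setT (fun x : 'cV[R]_n => x i 0).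
Proof.
by have /measurable_fun_cVP := @measurable_id _ 'cV[R]_n setT; exact.
Qed.

Lemma cintegrable_prodM d1 d2 (T1 : measurableType d1) (T2 : measurableType d2)
  (m1 : {sigma_finite_measure set T1 -> \bar R})
  (m2 : {sigma_finite_measure set T2 -> \bar R}) f g :
  cintegrable m1 f -> cintegrable m2 g ->
  cintegrable (m1 \x m2)%E (fun z : T1 * T2 => f z.1 * g z.2).
Proof.
move=> fi gi.
apply: cintegrable_le (integrable_prodM (cintegrable_normc fi) (cintegrable_normc gi)) _.
  have [mf1 mf2] := cintegrable_cmfun fi; have [mg1 mg2] := cintegrable_cmfun gi.
  apply: cmfunM; split.
  - exact: measurableT_comp mf1 measurable_fst.
  - exact: measurableT_comp mf2 measurable_fst.
  - exact: measurableT_comp mg1 measurable_snd.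
  - exact: measurableT_comp mg2 measurable_snd.
by move=> z; rewrite ComplexField.Normc.normcM.
Qed.

Lemma cint_prodM d1 d2 (T1 : measurableType d1) (T2 : measurableType d2)
  (m1 : {sigma_finite_measure set T1 -> \bar R})
  (m2 : {sigma_finite_measure set T2 -> \bar R}) f g :
  cintegrable m1 f -> cintegrable m2 g ->
  cint (m1 \x m2)%E (fun z : T1 * T2 => f z.1 * g z.2) = cint m1 f * cint m2 g.
Proof.
move=> fi gi.
rewrite -(cint_prod1 (cintegrable_normc fi) (cintegrable_normc gi)); last 2 first.
- exact: cintegrable_cmfun (cintegrable_prodM fi gi).
- by move=> x y; rewrite ComplexField.Normc.normcM.
transitivity (cint m1 (fun x => cint m2 g * f x)); last by rewrite cintZl// mulrC.
by apply: eq_cint => x; rewrite mulrC /=; exact: cintZl.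
Qed.

Lemma cintegrable_cVS n (f : 'cV[R]_n.+1 -> R[i]) : cmfun f ->
  cintegrable (@lebesgue_measure R \x lebesgue_cV R n)%E (f \o @cVcons R n) ->
  cintegrable (lebesgue_cV R n.+1) f.
Proof.
move=> [f1 f2] [i1 i2]; have mc := @measurable_cVcons R n.
split.
  apply: (integrable_pushforward mc _ _ measurableT); first exact/measurable_EFinP.
  by rewrite preimage_setT.
apply: (integrable_pushforward mc _ _ measurableT); first exact/measurable_EFinP.
by rewrite preimage_setT.
Qed.

Lemma cint_cVS n (f : 'cV[R]_n.+1 -> R[i]) : cmfun f ->
  cintegrable (@lebesgue_measure R \x lebesgue_cV R n)%E (f \o @cVcons R n) ->
  cint (lebesgue_cV R n.+1) f =
  cint (@lebesgue_measure R \x lebesgue_cV R n)%E (f \o @cVcons R n).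
Proof.
move=> [f1 f2] [i1 i2]; have mc := @measurable_cVcons R n.
rewrite /cint /Rintegral /= /lebesgue_cVS.
rewrite !(@integral_pushforward _ _ _ _ _ _ mc)//; try exact/measurable_EFinP;
  by rewrite ?preimage_setT//.
Qed.

Lemma cmfun_coord n (i : 'I_n) (psi : R -> R[i]) : cmfun psi ->
  cmfun (fun x : 'cV[R]_n => psi (x i 0)).
Proof.
by move=> [p1 p2]; split; [exact: measurableT_comp p1 (measurable_coord i)|
  exact: measurableT_comp p2 (measurable_coord i)].
Qed.

Lemma cmfun_prod d (T : measurableType d) (I : Type) (s : seq I) (P : pred I)
   (F : I -> T -> R[i]) :
  (forall i, P i -> cmfun (F i)) -> cmfun (fun x => \prod_(i <- s | P i) F i x).
Proof.
move=> mF; elim: s => [|i s ih].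
  by under eq_fun do rewrite big_nil; exact: cmfun_cst.
under eq_fun do rewrite big_cons.
by case Pi : (P i) => //; apply: cmfunM => //; exact: mF.
Qed.

(** [lebesgue_cV] is by construction the push-forward of a product under [cVcons], so the first
    coordinate splits off by induction; in dimension 0 the measure is a unit mass and both sides are
    1. This reduces the kernels on R^n to integrals on the line. *)
Lemma cint_cV_prod n (psi : 'I_n -> R -> R[i]) :
  (forall i, cintegrable (@lebesgue_measure R) (psi i)) ->
  cintegrable (lebesgue_cV R n) (fun x => \prod_(i < n) psi i (x i 0)) /\
  cint (lebesgue_cV R n) (fun x => \prod_(i < n) psi i (x i 0)) =
  \prod_(i < n) cint (@lebesgue_measure R) (psi i).
Proof.
elim: n psi => [|n ih] psi ipsi.
  rewrite big_ord0; under eq_fun do rewrite big_ord0; split.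
    split => /=.
      exact: finite_measure_integrable_cst.
    exact: finite_measure_integrable_cst.
  have D : lebesgue_cV R 0 setT = 1%E by exact: (@diracT _ 'cV[R]_0 R 0).
  by rewrite /cint !Rintegral_cst//; rewrite [X in fine X]D /= mul1r mul0r.
have [ihi ihE] := ih (fun i => psi (lift ord0 i)) (fun i => ipsi _).
have mp : cmfun (fun x : 'cV[R]_n.+1 => \prod_(i < n.+1) psi i (x i 0)).
  by apply: cmfun_prod => i _; apply: cmfun_coord; exact: cintegrable_cmfun (ipsi i).
have E : (fun x : 'cV[R]_n.+1 => \prod_(i < n.+1) psi i (x i 0)) \o @cVcons R n =
    (fun z => psi ord0 z.1 * \prod_(i < n) psi (lift ord0 i) (z.2 i 0)).
  apply/funext => z /=; rewrite big_ord_recl cVcons0; congr *%R.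
  by apply: eq_bigr => i _; rewrite cVconsS.
have Ei := cintegrable_prodM (ipsi ord0) ihi.
rewrite -E in Ei; split; first exact: cintegrable_cVS.
by rewrite cint_cVS// E (cint_prodM (ipsi ord0) ihi) ihE big_ord_recl.
Qed.

End column_vectors.

(** * Oscillatory integrals over intervals and cells *)

Section derivatives.
Context {R : realType}.
Implicit Types (f g : R -> R) (x a b c : R).

Lemma is_derive_cstE x c : is_derive x 1 (fun=> c) 0.
Proof. exact: is_derive_cst. Qed.

Lemma is_derive_idE x : is_derive x 1 (fun y => y) 1.
Proof. exact: is_derive_id. Qed.

Lemma is_derive_addE f g x a b : is_derive x 1 f a -> is_derive x 1 g b ->
  is_derive x 1 (fun y => f y + g y) (a + b).
Proof. by move=> df dg; exact: is_deriveD. Qed.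

Lemma is_derive_oppE f x a : is_derive x 1 f a -> is_derive x 1 (fun y => - f y) (- a).
Proof. by move=> df; exact: is_deriveN. Qed.

Lemma is_derive_mulE f g x a b : is_derive x 1 f a -> is_derive x 1 g b ->
  is_derive x 1 (fun y => f y * g y) (f x * b + g x * a).
Proof. by move=> df dg; exact: is_deriveM. Qed.

Lemma is_derive_expnE f n x a : is_derive x 1 f a ->
  is_derive x 1 (fun y => f y ^+ n.+1) (n.+1%:R * f x ^+ n * a).
Proof.
move=> df; rewrite (_ : (fun y => _) = f ^+ n.+1); last first.
  by apply/funext => y; rewrite exprfctE.
exact: is_deriveX. Qed.

Lemma is_derive_invE f x a : f x != 0 -> is_derive x 1 f a ->
  is_derive x 1 (fun y => (f y)^-1) (- f x ^- 2 * a).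
Proof.
by move=> f0 df; apply: (DeriveDef (derivableV f0 ex_derive)); rewrite deriveV// derive_val.
Qed.

Lemma is_derive_sinE f x a : is_derive x 1 f a ->
  is_derive x 1 (fun y => sin (f y)) (cos (f x) * a).
Proof. by move=> df; exact: (@is_derive1_comp _ sin). Qed.

Lemma is_derive_cosE f x a : is_derive x 1 f a ->
  is_derive x 1 (fun y => cos (f y)) (- sin (f x) * a).
Proof. by move=> df; exact: (@is_derive1_comp _ cos). Qed.

Lemma is_derive_expRE f x a : is_derive x 1 f a ->
  is_derive x 1 (fun y => expR (f y)) (expR (f x) * a).
Proof. by move=> df; exact: (@is_derive1_comp _ expR). Qed.

Lemma is_derive_atanE f x a : is_derive x 1 f a ->
  is_derive x 1 (fun y => atan (f y)) ((1 + f x ^+ 2)^-1 * a).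
Proof. by move=> df; exact: (@is_derive1_comp _ atan). Qed.

Lemma is_derive_continuous f (d : R -> R) : (forall x, is_derive x 1 f (d x)) ->
  continuous f.
Proof.
move=> df x; apply: differentiable_continuous; apply/derivable1_diffP.
by have [] := df x.
Qed.

End derivatives.

(** Differentiation by recursion on the shape of the function. [derto] leaves the comparison with
    the claimed derivative as an equation, and [contder] gets continuity from differentiability. *)
Ltac der := repeat first
  [ match goal with H : forall _, is_derive _ _ _ _ |- _ => exact: H end
  | apply: is_derive_cstE | apply: is_derive_idE
  | eapply is_derive_sinE | eapply is_derive_cosE | eapply is_derive_expRE
  | eapply is_derive_atanE | eapply is_derive_expnE
  | eapply is_derive_invE | eapply is_derive_oppE | eapply is_derive_addE
  | eapply is_derive_mulE ].

Ltac dred := cbv beta delta [idfun]; cbv beta.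

Ltac derto := notypeclasses refine (is_derive_eq _ _).

Ltac contder := refine (@is_derive_continuous _ _ _ (fun x => _)); cbv beta.

Section interval_integrals.
Context {R : realType}.
Notation mu := (@lebesgue_measure R).
Implicit Types (f F g : R -> R) (x a b : R).

Lemma continuous_integrable_itv f a b : continuous f ->
  mu.-integrable `[a, b] (EFin \o f).
Proof.
move=> cf; apply: continuous_compact_integrable; first exact: segment_compact.
exact: continuous_subspaceT.
Qed.

Lemma Rintegral_FTC2 F f a b : a <= b -> (forall x, is_derive x 1 F (f x)) ->
  continuous f -> \int[mu]_(x in `[a, b]) f x = F b - F a.
Proof.
rewrite le_eqVlt => /predU1P[->|ab] dF cf.
  by rewrite set_itv1 Rintegral_set1 subrr.
have cF := is_derive_continuous dF.
rewrite /Rintegral (@continuous_FTC2 _ f F)//.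
- exact: continuous_subspaceT.
- split.
  + by move=> x _; have [] := dF x.
  + by apply: cvg_at_right_filter; exact: cF.
  + by apply: cvg_at_left_filter; exact: cF.
- by move=> x _; rewrite derive1E; have [] := dF x.
Qed.

End interval_integrals.

(** * Van der Corput's lemma for a quadratic phase *)

Section van_der_corput.
Context {R : realType}.
Notation mu := (@lebesgue_measure R).
Variables (x sg th : R).
Hypothesis sg0 : sg != 0.

Let ph (y : R) := x * y + sg * (y * y) + th.
Let ka (y : R) := x + 2 * sg * y.
Let De (y : R) := ka y ^+ 2 + 4 * `|sg|.
Let h (y : R) := ka y * (De y)^-1.
Let h' (y : R) := 2 * sg * (4 * `|sg| - ka y ^+ 2) / De y ^+ 2.

Let sgp : 0 < `|sg|. Proof. by rewrite normr_gt0. Qed.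

Let De_gt0 y : 0 < De y.
Proof. by rewrite ltr_wpDl ?sqr_ge0// mulr_gt0. Qed.

Let dph (y : R) : is_derive y 1 ph (ka y).
Proof. by rewrite /ph; derto; [der|rewrite /ka; dred; ring]. Qed.

Let dka (y : R) : is_derive y 1 ka (2 * sg).
Proof. by rewrite /ka; derto; [der|dred; ring]. Qed.

Let dh (y : R) : is_derive y 1 h (h' y).
Proof.
have D0 := lt0r_neq0 (De_gt0 y).
rewrite /h /De; derto; [der; exact: D0|dred].
by rewrite -/(De y) /h' /=; move: D0; rewrite /De => D0; field.
Qed.

(* Integrating by parts with [h = ka / (ka^2 + 4 |sg|)] instead of [1 / ka], where
   [ka = ph'], avoids splitting the interval around the stationary point. *)
Lemma van_der_corput_quadratic (a b M V : R) (psi psi' : R -> R) : a <= b ->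
  (forall y : R, is_derive y 1 psi (psi' y)) -> continuous psi' ->
  (forall y, a <= y <= b -> `|psi y| <= M) ->
  \int[mu]_(y in `[a, b]) `|psi' y| <= V ->
  `|\int[mu]_(y in `[a, b]) (cos (ph y) * psi y)| <=
    (M * (2 * pi) + V) / Num.sqrt `|sg|.
Proof.
move=> ab dpsi cpsi' psiM psi'V.
pose q y := sin (ph y) * h y.
pose q' y := cos (ph y) * ka y * h y + sin (ph y) * h' y.
have dq (y : R) : is_derive y 1 q (q' y).
  by rewrite /q; derto; [der|rewrite /q'; dred; ring].
(* Since [ka * h = 1 - 4 |sg| / De], the derivative [q'] is [cos (ph)] up to this remainder, which
   is at most [6 |sg| / De] and so integrable over the whole line: the stationary point costs a
   fixed mass whatever the interval. *)
pose r y := cos (ph y) - q' y.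
have ck : continuous ka by contder; exact: dka.
have cph : continuous ph by contder; exact: dph.
have ch : continuous h by contder; exact: dh.
have cpsi : continuous psi by contder; exact: dpsi.
have csph : continuous (fun y => sin (ph y)).
  by move=> y; apply: continuous_comp; [exact: cph|exact: continuous_sin].
have ccph : continuous (fun y => cos (ph y)).
  by move=> y; apply: continuous_comp; [exact: cph|exact: continuous_cos].
have cDeV : continuous (fun y => (De y)^-1).
  contder; rewrite /De; der; exact: (lt0r_neq0 (De_gt0 _)).
have ch' : continuous h'.
  move=> y; apply: cvgM.
    apply: cvgM; first exact: cvg_cst.
    by apply: cvgB; [exact: cvg_cst|apply: cvgM; exact: ck].
  under eq_fun do rewrite -exprVn.
  rewrite -exprVn; apply: cvgM; exact: cDeV.
have cq' : continuous q'.
  move=> y; apply: cvgD; apply: cvgM; [|exact: ch|exact: csph|exact: ch'].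
  by apply: cvgM; [exact: ccph|exact: ck].
have cr : continuous r.
  by move=> y; apply: cvgB; [exact: ccph|exact: cq'].
set S := Num.sqrt `|sg|.
have S0 : 0 < S by rewrite sqrtr_gt0.
have S2 : S ^+ 2 = `|sg| by rewrite sqr_sqrtr// ltW.
have hS y : `|h y| <= (4 * S)^-1.
  rewrite /h normrM normfV (gtr0_norm (De_gt0 y)).
  rewrite ler_pdivrMr ?De_gt0// mulrC ler_pdivlMr ?mulr_gt0//.
  rewrite /De -S2 -(real_normK (num_real (ka y))).
  have := sqr_ge0 (`|ka y| - 2 * S); nra.
have rS y : `|r y| <= 6 * `|sg| / De y.
  have -> : r y = cos (ph y) * (4 * `|sg| / De y) - sin (ph y) * h' y.
    rewrite /r /q' /h; have := lt0r_neq0 (De_gt0 y); rewrite /De => D0.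
    by field.
  apply: (le_trans (ler_normB _ _)).
  rewrite (_ : 6 * `|sg| / De y = 1 * (4 * `|sg| / De y) + 1 * (2 * `|sg| / De y)); last by ring.
  rewrite !normrM [`|(De y)^-1|]ger0_norm ?invr_ge0 ?(ltW (De_gt0 y))//.
  apply: lerD.
    apply: ler_pM; [by []|by rewrite !mulr_ge0// invr_ge0 ltW| |].
      exact: cos_max.
    by rewrite ger0_norm// normr_id ler_pM2r// invr_gt0.
  apply: ler_pM; [by []|by []|exact: sin_max|].
  rewrite ?/h' ?normrM normfV normrX (gtr0_norm (De_gt0 y)) [`|2|]ger0_norm//.
  rewrite [De y ^+ 2]expr2 invfM mulrA ler_pM2r ?invr_gt0//.
  rewrite -mulrA ler_piMr ?mulr_ge0// ler_pdivrMr// mul1r.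
  rewrite ler_norml /De; have := sqr_ge0 (ka y); have := sgp => ? ?; lra.
pose G (y : R) := q y * psi' y + psi y * q' y.
have cG : continuous G.
  move=> y; apply: cvgD; apply: cvgM; [|exact: cpsi'|exact: cpsi|exact: cq'].
  by apply: cvgM; [exact: csph|exact: ch].
have FTC : \int[mu]_(y in `[a, b]) G y = q b * psi b - q a * psi a.
  exact: (@Rintegral_FTC2 _ (fun y => q y * psi y) G a b ab
    (fun y => is_derive_mulE (dq y) (dpsi y)) cG).
pose E (y : R) := r y * psi y - q y * psi' y.
have cE : continuous E.
  move=> y; apply: cvgB; apply: cvgM; [exact: cr|exact: cpsi| |exact: cpsi'].
  by apply: cvgM; [exact: csph|exact: ch].
have -> : \int[mu]_(y in `[a, b]) (cos (ph y) * psi y) =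
    q b * psi b - q a * psi a + \int[mu]_(y in `[a, b]) E y.
  rewrite -FTC -RintegralD//; [|exact: continuous_integrable_itv..].
  by apply: eq_Rintegral => y _; rewrite /G /E /r; ring.
(* Primitive of the majorant [6 |sg| / De]; the sign [|sg| / sg] is there because [ka] decreases
   when [sg < 0]. As |atan| <= pi / 2, the mass of the majorant is at most 3 pi / (2 S). *)
pose A (y : R) := 3 / 2 * (`|sg| / sg) / S * atan (ka y / (2 * S)).
pose a' (y : R) := 6 * `|sg| / De y.
have S0' := lt0r_neq0 S0.
have dA (y : R) : is_derive y 1 A (a' y).
  rewrite /A; derto; [der|dred].
  have D0 := lt0r_neq0 (De_gt0 y); move: D0; rewrite /a' /De -S2 => D0.
  have D1 : (ka y * (2 * S)^-1) ^+ 2 + 1 != 0.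
    by rewrite lt0r_neq0// ltr_wpDl ?sqr_ge0.
  rewrite addrC in D1.
  have -> : (1 + (ka y / (2 * S)) ^+ 2)^-1 = 4 * S ^+ 2 / (ka y ^+ 2 + 4 * S ^+ 2).
    rewrite -[RHS]invrK; congr GRing.inv; field.
    by rewrite D0.
  field.
  by rewrite D0 S0' sg0.
have qS c : `|q c| <= (4 * S)^-1.
  by apply: le_trans (hS c); rewrite /q (normrM (sin _)) ler_piMl//; exact: sin_max.
have ca' : continuous a'.
  by move=> y; apply: cvgM; [exact: cvg_cst|exact: cDeV].
have M0 : 0 <= M by apply: le_trans (psiM a _); rewrite ?normr_ge0// lexx.
have iE : `|\int[mu]_(y in `[a, b]) E y| <= M * (A b - A a) + (4 * S)^-1 * V.
  apply: (le_trans (le_normr_Rintegral _ _)) => //.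
    exact: continuous_integrable_itv.
  rewrite -(Rintegral_FTC2 ab dA ca').
  have cn : continuous (fun y => `|psi' y|).
    by move=> y; apply: continuous_comp; [exact: cpsi'|exact: norm_continuous].
  apply: (@le_trans _ _ (M * \int[mu]_(y in `[a, b]) a' y +
     (4 * S)^-1 * \int[mu]_(y in `[a, b]) `|psi' y|)); last first.
    by rewrite lerD2l ler_pM2l// invr_gt0 mulr_gt0.
  rewrite -!RintegralZl//; [|exact: continuous_integrable_itv..].
  have cMa : continuous (fun y => M * a' y).
    by move=> y; apply: cvgM; [exact: cvg_cst|exact: ca'].
  have cSn : continuous (fun y => (4 * S)^-1 * `|psi' y|).
    by move=> y; apply: cvgM; [exact: cvg_cst|exact: cn].
  rewrite -RintegralD//; [|exact: continuous_integrable_itv..].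
  apply: le_Rintegral => //.
  - apply: continuous_integrable_itv => y; apply: continuous_comp.
      exact: cE.
    exact: norm_continuous.
  - apply: continuous_integrable_itv => y; apply: cvgD; [exact: cMa|exact: cSn].
  move=> y; rewrite /= in_itv/= => aby; apply: (le_trans (ler_normB _ _)).
  rewrite (normrM (r y)) (normrM (q y)); apply: lerD.
    by rewrite mulrC; apply: ler_pM => //; exact: psiM.
  exact: ler_pM.
have Ab c : `|A c| <= 3 / 2 * (pi / 2) / S.
  have -> : A c = 3 / 2 / S * (`|sg| / sg) * atan (ka c / (2 * S)) by rewrite /A; ring.
  rewrite (normrM _ (atan _)) (normrM _ (`|sg| / sg)) (normrM `|sg|) normfV normr_id.
  rewrite divff ?gt_eqF// mulr1 ger0_norm ?divr_ge0 ?(ltW S0)//.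
  rewrite [leRHS](_ : _ = 3 / 2 / S * (pi / 2)); last by ring.
  rewrite ler_pM2l ?divr_gt0// ler_norml (ltW (atan_gtNpi2 _)) (ltW (atan_ltpi2 _)).
  by [].
apply: (le_trans (ler_normD _ _)).
have qab : `|q b * psi b - q a * psi a| <= 2 * ((4 * S)^-1 * M).
  rewrite mulr_natl mulr2n; apply: (le_trans (ler_normB _ _)).
  rewrite (normrM (q b)) (normrM (q a)).
  by apply: lerD; apply: ler_pM => //; apply: psiM; rewrite lexx ab.
have V0 : 0 <= V by apply: le_trans psi'V; exact: Rintegral_ge0.
apply: (le_trans (lerD qab iE)).
have pi2 : 2 <= pi :> R by exact: pi_ge2.
rewrite [leRHS](_ : _ = M * (2 * pi) / S + V / S); last by ring.
have -> : (4 * S)^-1 = 4^-1 / S by rewrite invfM.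
have := Ab b; have := Ab a; rewrite !ler_norml => /andP[a1 a2] /andP[b1 b2].
have Si : 0 < S^-1 by rewrite invr_gt0.
have AA : A b - A a <= 3 / 2 * pi * S^-1 by lra.
have h1 := ler_wpM2l M0 AA.
have h2 : 0 <= V / S by rewrite divr_ge0// ltW.
have h3 : M / S * 2 <= M / S * pi by rewrite ler_wpM2l// divr_ge0// ltW.
have h4 : 0 <= M / S by rewrite divr_ge0// ltW.
move: h1 h2 h3 h4; set T := S^-1; set a1' := A b; set a2' := A a => h1 h2 h3 h4.
clear -h1 h2 h3 h4.
nra.
Qed.

End van_der_corput.

Section japanese_bracket.
Context {R : realType}.

(** (1 + sg^2)^(1/4): the gain of one coordinate in the kernel bound is [1 / jap sg], of the size of
    |sg|^(-1/2) for large |sg| and of 1 for bounded sg. *)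
Definition jap (sg : R) : R := Num.sqrt (Num.sqrt (1 + sg ^+ 2)).

Lemma jap_exp4 sg : jap sg ^+ 4 = 1 + sg ^+ 2.
Proof.
by rewrite (exprM _ 2 2) !sqr_sqrtr// ?sqrtr_ge0// addr_ge0// sqr_ge0.
Qed.

Lemma jap_ge1 sg : 1 <= jap sg.
Proof.
rewrite -[leLHS]sqrtr1 ler_wsqrtr// -[leLHS]sqrtr1 ler_wsqrtr//.
by rewrite lerDl sqr_ge0.
Qed.

Lemma jap_gt0 sg : 0 < jap sg.
Proof. exact: lt_le_trans (jap_ge1 sg). Qed.

Lemma jap_le_small sg : `|sg| <= 1 -> jap sg <= 2.
Proof.
move=> s1; rewrite -(@ler_pXn2r _ 4)// ?nnegrE ?ltW ?jap_gt0// jap_exp4.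
rewrite -real_normK ?num_real//; have := normr_ge0 sg; nra.
Qed.

Lemma jap_le_large sg : 1 <= `|sg| -> jap sg <= 2 * Num.sqrt `|sg|.
Proof.
move=> s1; rewrite -(@ler_pXn2r _ 4)// ?nnegrE ?ltW ?jap_gt0//; last first.
  by rewrite mulr_gt0// sqrtr_gt0 (lt_le_trans _ s1).
rewrite jap_exp4 exprMn (exprM (Num.sqrt _) 2 2) sqr_sqrtr//.
rewrite -[sg ^+ 2]real_normK ?num_real//; nra.
Qed.

End japanese_bracket.

Section oscillatory_intervals.
Context {R : realType}.
Notation mu := (@lebesgue_measure R).
Implicit Types (P : R -> R).

Lemma continuous_normr_fun (f : R -> R) : continuous f -> continuous (fun y => `|f y|).
Proof. by move=> cf y; apply: continuous_comp; [exact: cf|exact: norm_continuous]. Qed.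

Lemma fine_lebesgue_itv (a b : R) : a <= b -> fine (mu `[a, b]%classic) = b - a.
Proof.
move=> ab; have := lebesgue_measure_itv `[a, b]; rewrite /= lte_fin => ->.
by move: ab; rewrite le_eqVlt => /predU1P[->|->//]; rewrite ltxx subrr.
Qed.

Lemma Rintegral_itv_split (f : R -> R) (a b c : R) : continuous f -> a <= c <= b ->
  \int[mu]_(y in `[a, b]) f y = \int[mu]_(y in `[a, c]) f y + \int[mu]_(y in `[c, b]) f y.
Proof.
move=> cf /andP[ac cb].
have := @Rintegral_itvB _ f (BLeft a) (BRight b) c (continuous_integrable_itv a b cf).
rewrite !bnd_simp => /(_ ac cb) h.
rewrite -(Rintegral_itv_obnd_cbnd (r := c)) -?h; first by rewrite addrC subrK.
apply: integrableS (continuous_integrable_itv a b cf) => //.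
apply: subset_itvr; by rewrite bnd_simp.
Qed.

Variables (P P' : R -> R) (be x sg th a c d : R).
Hypotheses (dP : forall y : R, is_derive y 1 P (P' y)) (cP' : continuous P').
Hypotheses (P4 : forall y, -2 <= y <= 2 -> `|P y| <= 4)
           (P'4 : forall y, -2 <= y <= 2 -> `|P' y| <= 4).
Hypothesis be1 : -1 <= be.
Hypotheses (c2 : -2 <= c) (cd : c <= d) (d2 : d <= 2) (a0 : 0 <= a).
Hypothesis acd : forall y, c <= y <= d -> a <= `|y|.
Hypothesis cd0 : (0 <= c) || (d <= 0).

(** For be >= -1 and a <= |y| <= 2, the inequality (be + 1)(y^2 - a^2) >= 0 gives - be y^2 <= - be
    a^2 + 4. The factor e^{- be a^2} is kept, rather than bounded, since it is what converges when
    be is averaged later. *)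
Let E := expR 4 * expR (- be * a ^+ 2).

Let E0 : 0 < E. Proof. by rewrite mulr_gt0// expR_gt0. Qed.

Let gE y : c <= y <= d -> expR (- be * y ^+ 2) <= E.
Proof.
move=> ycd; rewrite /E -expRD ler_expR.
have ay := acd ycd.
have y2 : y ^+ 2 <= 4.
  have : -2 <= y <= 2 by move: ycd c2 d2 => /andP[? ?] ? ?; apply/andP; split; lra.
  by move=> /andP[? ?]; nra.
have ay2 : a ^+ 2 <= y ^+ 2 by rewrite -[leRHS]real_normK ?num_real// ler_sqr ?nnegrE.
have h1 : 0 <= (be + 1) * (y ^+ 2 - a ^+ 2).
  by rewrite mulr_ge0 ?subr_ge0// -lerBlDr sub0r.
have := sqr_ge0 a; lra.
Qed.

Let psi y := P y * expR (- be * y ^+ 2).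
Let psi' y := P' y * expR (- be * y ^+ 2) - 2 * be * y * psi y.

Let dpsi (y : R) : is_derive y 1 psi (psi' y).
Proof. rewrite /psi; derto; [der|dred; rewrite /psi' /psi; ring]. Qed.

Let cg : continuous (fun y : R => expR (- be * y ^+ 2)).
Proof. contder; der. Qed.

Let cpsi : continuous psi. Proof. exact: is_derive_continuous dpsi. Qed.

Let cpsi' : continuous psi'.
Proof.
move=> y; apply: cvgB; apply: cvgM; [exact: cP'|exact: cg| |exact: cpsi].
by apply: cvgM; [exact: cvg_cst|exact: cvg_id].
Qed.

Let in2 y : c <= y <= d -> -2 <= y <= 2.
Proof. by move: c2 d2 => ? ? /andP[? ?]; apply/andP; split; lra. Qed.

Let psiM y : c <= y <= d -> `|psi y| <= 4 * E.
Proof.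
move=> ycd; rewrite /psi normrM (ger0_norm (expR_ge0 _)).
by apply: ler_pM => //; [exact/P4/in2|exact: gE].
Qed.

Let gp y := 2 * be * y * expR (- be * y ^+ 2).

Let cgp : continuous gp.
Proof.
by move=> y; apply: cvgM; [apply: cvgM; [exact: cvg_cst|exact: cvg_id]|exact: cg].
Qed.

(** On an interval that does not cross 0 the weight e^{- be y^2} is monotone, so its variation is a
    difference of two values in [0, E]. Bounding the derivative pointwise would lose a factor
    |be|. *)
Let int_gp : \int[mu]_(y in `[c, d]) `|gp y| <= E.
Proof.
have I : \int[mu]_(y in `[c, d]) gp y = - expR (- be * d ^+ 2) - - expR (- be * c ^+ 2).
  apply: (@Rintegral_FTC2 _ (fun y => - expR (- be * y ^+ 2)) gp c d cd _ cgp) => y.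
  by derto; [der|dred; rewrite /gp; ring].
have ce : expR (- be * c ^+ 2) <= E by apply: gE; rewrite lexx.
have de : expR (- be * d ^+ 2) <= E by apply: gE; rewrite lexx cd.
have ce0 := expR_ge0 (- be * c ^+ 2); have de0 := expR_ge0 (- be * d ^+ 2).
have [s0|s0] := boolP ((0 <= be) == (0 <= c)).
  rewrite (@eq_Rintegral _ _ _ mu _ gp); first by rewrite I; lra.
  move=> y; rewrite inE/= in_itv/= => /andP[cy yd]; rewrite ger0_norm//.
  rewrite /gp mulr_ge0 ?expR_ge0// -mulrA mulr_ge0//.
  move: s0; case: (leP 0 c) => [c0 /eqP be0|c0 /eqP/negbT].
    by rewrite mulr_ge0// (le_trans c0).
  rewrite -ltNge => be0; move: cd0; rewrite leNgt c0/= => d0.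
  by rewrite mulr_le0 ?(ltW be0)// (le_trans yd).
rewrite (@eq_Rintegral _ _ _ mu _ (fun y => - 1 * gp y)).
  rewrite RintegralZl ?I//; first by lra.
  exact: continuous_integrable_itv.
move=> y; rewrite inE/= in_itv/= => /andP[cy yd]; rewrite mulN1r ler0_norm//.
rewrite /gp mulr_le0_ge0 ?expR_ge0// -mulrA mulr_ge0_le0//.
move: s0; case: (leP 0 c) => [c0|c0].
  by rewrite eqb_id -ltNge => be0; rewrite mulr_le0_ge0 ?(ltW be0)// (le_trans c0).
rewrite eqbF_neg negbK => be0; move: cd0; rewrite leNgt c0/= => d0.
by rewrite mulr_ge0_le0// (le_trans yd).
Qed.

(** |psi'| <= 4 E + 4 |gp|: the first term contributes 16 E on an interval of length at most 4, the
    second 4 E. *)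
Let psi'V : \int[mu]_(y in `[c, d]) `|psi' y| <= 20 * E.
Proof.
have cngp : continuous (fun y => `|gp y|).
  by move=> y; apply: continuous_comp; [exact: cgp|exact: norm_continuous].
apply: (@le_trans _ _ (\int[mu]_(y in `[c, d]) (4 * E + 4 * `|gp y|))).
  apply: le_Rintegral => //.
  - apply: continuous_integrable_itv => y; apply: continuous_comp; first exact: cpsi'.
    exact: norm_continuous.
  - apply: continuous_integrable_itv => y; apply: cvgD; first exact: cvg_cst.
    by apply: cvgM; [exact: cvg_cst|exact: cngp].
  move=> y; rewrite /= in_itv/= => ycd.
  apply: (le_trans (ler_normB _ _)); apply: lerD.
    rewrite normrM (ger0_norm (expR_ge0 _)).
    by apply: ler_pM => //; [exact/P'4/in2|exact: gE].
  rewrite [X in `|X|](_ : _ = P y * gp y); last by rewrite /psi /gp; ring.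
  by rewrite normrM ler_wpM2r//; exact/P4/in2.
rewrite RintegralD//; last 2 first.
- by apply: continuous_integrable_itv => ?; exact: cvg_cst.
- apply: continuous_integrable_itv => y.
  by apply: cvgM; [exact: cvg_cst|exact: cngp].
rewrite Rintegral_cst// RintegralZl//; last exact: continuous_integrable_itv.
rewrite fine_lebesgue_itv//.
have := int_gp; have := E0; move: c2 d2 => ? ? ? ?; nra.
Qed.

(** With M = 4 E, V = 20 E and pi <= 4, van der Corput's lemma gives 52 E / sqrt |sg| for |sg| >= 1,
    and passing to [jap] doubles the constant to 104. For |sg| < 1 the trivial bound 16 E is enough,
    since [jap sg <= 2]. *)
Lemma oscillatory_itv :
  `|\int[mu]_(y in `[c, d]) (cos (x * y + sg * (y * y) + th) * (P y * expR (- be * y ^+ 2)))|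
    <= 104 * expR 4 * expR (- be * a ^+ 2) / jap sg.
Proof.
rewrite -[104 * _ * _]mulrA -/E ler_pdivlMr ?jap_gt0//.
set I := `| _ |.
have I0 : 0 <= I by exact: normr_ge0.
have [s1|s1] := leP 1 `|sg|.
  have sg0 : sg != 0 by rewrite -normr_gt0 (lt_le_trans _ s1).
  have := van_der_corput_quadratic x th sg0 cd dpsi cpsi' psiM psi'V.
  rewrite -/I ler_pdivlMr ?sqrtr_gt0 ?normr_gt0// => h.
  have pi4 : pi <= 4 :> R by have := @pihalf_lt2 R; lra.
  have := ler_wpM2l I0 (jap_le_large s1).
  have := E0; nra.
have IE : I <= 16 * E.
  have cc : continuous (fun y => cos (x * y + sg * (y * y) + th) * psi y).
    by move=> y; apply: cvgM; [move: y; contder; der|exact: cpsi].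
  apply: (le_trans (le_normr_Rintegral _ _)) => //.
    exact: continuous_integrable_itv.
  apply: (@le_trans _ _ (\int[mu]_(y in `[c, d]) (4 * E))).
    apply: le_Rintegral => //.
    - by have := continuous_integrable_itv c d (continuous_normr_fun cc).
    - by apply: continuous_integrable_itv => ?; exact: cvg_cst.
    move=> y; rewrite /= in_itv/= => ycd.
    by rewrite normrM -[leRHS]mul1r; apply: ler_pM => //; [exact: cos_max|exact: psiM].
  rewrite Rintegral_cst// fine_lebesgue_itv//.
  have := E0; move: c2 d2 => ? ? ?; nra.
have := ler_wpM2l I0 (jap_le_small (ltW s1)); have := E0; nra.
Qed.

End oscillatory_intervals.

Section one_dimensional_cells.
Context {R : realType}.
Notation mu := (@lebesgue_measure R).
Implicit Types (I : set R) (m : nat) (be x sg xi : R).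

Definition cell_osc I m be x sg xi : R[i] :=
  expi (x * xi + sg * (xi * xi)) * (\1_I xi * (xi ^+ m * expR (- be * xi ^+ 2)))%:C.

Let gam m be xi := xi ^+ m * expR (- be * xi ^+ 2).

Let cgam m be : continuous (gam m be).
Proof.
move=> y; apply: cvgM; first exact: exprn_continuous.
by move: y; contder; der.
Qed.

Lemma integrable_indicM I (f : R -> R) a b :
  measurable (I : set (measurableTypeR R)) -> I `<=` `[a, b] ->
  continuous f -> mu.-integrable setT (EFin \o (fun y => \1_I y * f y)).
Proof.
move=> mI Iab cf.
have i1 : mu.-integrable I (EFin \o f).
  by apply: integrableS (continuous_integrable_itv a b cf).
have {}i1 := (integrable_mkcond _ mI).1 i1.
apply: eq_integrable i1 => // y _ /=.
by rewrite patchE indicE /=; case: ifPn => yI; rewrite ?mul1r ?mul0r.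
Qed.

Lemma Rintegral_indicM I (f : R -> R) : \int[mu]_y (\1_I y * f y) = \int[mu]_(y in I) f y.
Proof.
rewrite [RHS]Rintegral_mkcond; apply: eq_Rintegral => y _.
by rewrite patchE indicE; case: ifPn => yI; rewrite ?mul1r ?mul0r.
Qed.

Let cph m be x sg th :
  continuous (fun y => cos (x * y + sg * (y * y) + th) * gam m be y).
Proof.
move=> y; apply: cvgM; last exact: cgam.
by move: y; contder; der.
Qed.

Lemma cintegrable_cell I m be x sg : measurable (I : set (measurableTypeR R)) -> I `<=` `[(-2), 2] ->
  cintegrable mu (cell_osc I m be x sg).
Proof.
move=> mI I2; have ig := integrable_norm (integrable_indicM mI I2 (@cgam m be)).
apply: (cintegrable_le _ ig).
  apply: cmfunM.
    apply: cmfun_expi; apply: continuous_measurable_fun; contder; der.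
  apply: cmfun_real; apply: measurable_funM; first exact: measurable_indic.
  by apply: continuous_measurable_fun; exact: cgam.
by move=> y; rewrite ComplexField.Normc.normcM normc_expi mul1r normc_real.
Qed.

(** The rotation by e^{i th} only shifts the phase, so [normc_le_rot] reduces the modulus to the
    real integrals of [cell_piece], whose bound does not depend on th. *)
Lemma Re_cell I m be x sg th : measurable (I : set (measurableTypeR R)) -> I `<=` `[(-2), 2] ->
  complex.Re (expi th * cint mu (cell_osc I m be x sg)) =
  \int[mu]_(y in I) (cos (x * y + sg * (y * y) + th) * gam m be y).
Proof.
move=> mI I2; rewrite -cintZl; last exact: cintegrable_cell.
rewrite -(Rintegral_indicM I) /=; apply: eq_Rintegral => y _.
by rewrite [cos (_ + th)]cosD /gam; ring.
Qed.

Lemma cell_piece m be x sg th a c d : (m <= 2)%N -> -1 <= be ->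
  -2 <= c -> c <= d -> d <= 2 -> 0 <= a ->
  (forall y, c <= y <= d -> a <= `|y|) -> (0 <= c) || (d <= 0) ->
  `|\int[mu]_(y in `[c, d]) (cos (x * y + sg * (y * y) + th) * gam m be y)|
    <= 104 * expR 4 * expR (- be * a ^+ 2) / jap sg.
Proof.
move=> m2 be1 c2 cd d2 a0 acd cd0.
apply: (@oscillatory_itv _ (fun y => y ^+ m)
  (fun y => match m with 0%N => 0 | m'.+1 => m'.+1%:R * y ^+ m' end)) => //.
- case: m {m2} => [|m] y.
    exact: is_derive_cstE.
  by derto; [der|dred; rewrite mulr1].
- case: m {m2} => [|m] y; first exact: cvg_cst.
  by apply: cvgM; [exact: cvg_cst|exact: exprn_continuous].
- move=> y /andP[y1 y2]; case: m m2 => [|[|[|]]]// _.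
  + by rewrite expr0 normr1; lra.
  + by rewrite expr1 ler_norml; apply/andP; split; lra.
  + by rewrite ger0_norm ?sqr_ge0//; nra.
- move=> y /andP[y1 y2]; case: m m2 => [|[|[|]]]// _.
  + by rewrite normr0; lra.
  + by rewrite expr0 mulr1 normr1; lra.
  + by rewrite expr1 ler_norml; apply/andP; split; lra.
Qed.

(** The interval is cut at 0 because [cell_piece] needs y^2 to be monotone. Both halves touch the
    origin, so a = 0 there and the weight e^{- be y^2} yields no decay in be. *)
Lemma cell_sym_bound (b1 b2 : bool) b m be x sg : (m <= 2)%N -> -1 <= be ->
  0 < b <= 2 ->
  normc (cint mu (cell_osc [set` Interval (BSide b1 (- b)) (BSide b2 b)] m be x sg))
  <= 208 * expR 4 / jap sg.
Proof.
move=> m2 be1 /andP[b0 bb]; apply: normc_le_rot => th.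
rewrite Re_cell//; last first.
  by apply: subset_itv; rewrite bnd_simp; case: b1 b2 => -[]; lra.
have cf := @cph m be x sg th.
have -> : \int[mu]_(y in [set` Interval (BSide b1 (- b)) (BSide b2 b)])
     (cos (x * y + sg * (y * y) + th) * gam m be y) =
   \int[mu]_(y in `[(- b), b]) (cos (x * y + sg * (y * y) + th) * gam m be y).
  have ii (u v : bool) : mu.-integrable [set` Interval (BSide u (- b)) (BSide v b)]
     (EFin \o (fun y => cos (x * y + sg * (y * y) + th) * gam m be y)).
    apply: integrableS (continuous_integrable_itv (- b) b cf) => //.
    by apply: subset_itv; rewrite bnd_simp; case: u v => -[].
  have -> : \int[mu]_(y in [set` Interval (BSide b1 (- b)) (BSide b2 b)])
     (cos (x * y + sg * (y * y) + th) * gam m be y) =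
   \int[mu]_(y in [set` Interval (BSide b1 (- b)) (BRight b)])
     (cos (x * y + sg * (y * y) + th) * gam m be y).
    by case: b2 => //; exact: Rintegral_itv_bndo_bndc (ii b1 true).
  by case: b1 => //; exact: Rintegral_itv_obnd_cbnd (ii false false).
rewrite (Rintegral_itv_split (c := 0))//; last by apply/andP; split; lra.
apply: (le_trans (ler_norm _)); apply: (le_trans (ler_normD _ _)).
have e0 : expR (- be * 0 ^+ 2) = 1 by rewrite expr0n mulr0 expR0.
rewrite (_ : 208 * expR 4 / jap sg = 104 * expR 4 * expR (- be * 0 ^+ 2) / jap sg +
  104 * expR 4 * expR (- be * 0 ^+ 2) / jap sg); last by rewrite e0; ring.
by apply: lerD; apply: cell_piece => //; rewrite ?lexx ?orbT//; lra.
Qed.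

(** Here |y| >= a on both pieces and the factor e^{- be a^2} survives; a cell gets all its decay in
    be from its one side of this kind. *)
Lemma cell_annulus_bound a m be x sg : (m <= 2)%N -> -1 <= be ->
  0 < a <= 2 ->
  normc (cint mu (cell_osc (`[(-2), (- a)] `|` `[a, 2]) m be x sg))
  <= 208 * expR 4 / jap sg * expR (- be * a ^+ 2).
Proof.
move=> m2 be1 /andP[a0 a2]; apply: normc_le_rot => th.
have mU : measurable (`[(-2), (- a)] `|` `[a, 2] : set (measurableTypeR R)) by exact: measurableU.
have U2 : `[(-2), (- a)] `|` `[a, 2] `<=` `[(-2), 2 : R].
  by move=> y /= []; rewrite !in_itv/= => /andP[? ?]; apply/andP; split; lra.
rewrite Re_cell// Rintegral_setU//.
- apply: (le_trans (ler_norm _)); apply: (le_trans (ler_normD _ _)).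
  rewrite (_ : 208 * expR 4 / jap sg * _ = 104 * expR 4 * expR (- be * a ^+ 2) / jap sg +
    104 * expR 4 * expR (- be * a ^+ 2) / jap sg); last by ring.
  apply: lerD; (apply: cell_piece => //; try lra).
  + by move=> y /andP[? ?]; rewrite ler0_norm; lra.
  + by move=> y /andP[? ?]; rewrite ger0_norm; lra.
- apply: integrableS (continuous_integrable_itv (-2) 2 (@cph m be x sg th)) => //.
- apply/disj_setPS => y /= []; rewrite !in_itv/= => /andP[? ?] /andP[? ?].
  exfalso; lra.
Qed.

End one_dimensional_cells.

Section affine_substitution.
Context {R : realType}.
Notation mu := (@lebesgue_measure R).

Lemma ge0_integral_affine (G : R -> R) (a b : R) : 0 < a -> continuous G ->
  (forall y, 0 <= G y) ->
  (\int[mu]_y (G y)%:E = \int[mu]_y (a * G (a * y + b))%:E)%E.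
Proof.
move=> a0 cG G0; pose F (y : R) := a * y + b.
have dF (y : R) : is_derive y 1 F a.
  by rewrite /F; derto; [der|dred; ring].
have F'E : F^`()%classic = cst a.
  by apply/funext => y; rewrite derive1E; have [_ ->] := dF y.
rewrite (@increasing_ge0_integration_by_substitutionT R F G)//.
- by apply: eq_integral => y _ /=; rewrite F'E mulrC.
- by move=> y z yz; rewrite /F ltrD2r ltr_pM2l.
- by rewrite F'E => y; exact: cvg_cst.
- by rewrite F'E; exact: is_cvg_cst.
- by rewrite F'E; exact: is_cvg_cst.
- apply/cvgrNyPle => A; exists ((A - b) / a); split; first exact: num_real.
  by move=> y; rewrite ltr_pdivlMr// /F /= => h; nra.
- apply/cvgryPge => A; exists ((A - b) / a); split; first exact: num_real.
  by move=> y; rewrite ltr_pdivrMr// /F /= => h; nra.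
Qed.

Lemma integral_gauss_scale (r : R) : 0 < r ->
  mu.-integrable setT (EFin \o (fun q => expR (- (r ^+ 2 * q ^+ 2)))) /\
  \int[mu]_q expR (- (r ^+ 2 * q ^+ 2)) = Num.sqrt pi / r.
Proof.
move=> r0.
have E : (\int[mu]_q (r * expR (- (r ^+ 2 * q ^+ 2)))%:E = (Num.sqrt pi)%:E)%E.
  have := ge0_integral_affine 0 r0 (@continuous_gauss_fun R) (@gauss_fun_ge0 R).
  rewrite integralT_gauss => ->.
  by apply: eq_integral => q _; rewrite addr0 /gauss_fun exprMn.
have mf : measurable_fun setT (fun q : R => expR (- (r ^+ 2 * q ^+ 2))).
  by apply: continuous_measurable_fun; contder; der.
have i : mu.-integrable setT (EFin \o (fun q => expR (- (r ^+ 2 * q ^+ 2)))).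
  have : mu.-integrable setT (EFin \o (fun q => r * expR (- (r ^+ 2 * q ^+ 2)))).
    apply/integrableP; split.
      by apply/measurable_EFinP; exact: measurable_funM.
    under eq_integral do rewrite /= ger0_norm ?mulr_ge0 ?expR_ge0 ?(ltW r0)//.
    by rewrite E ltry.
  move=> /(integrableZl measurableT r^-1); apply: eq_integrable => // q _ /=.
  by rewrite -EFinM mulrA mulVf ?gt_eqF// mul1r.
split => //; apply: (mulfI (lt0r_neq0 r0)); rewrite -RintegralZl//.
by rewrite /Rintegral E /=; field; exact: lt0r_neq0.
Qed.

End affine_substitution.

(** * A class of amplitudes stable under division by |xi| *)

Section amplitudes.
Context {R : realType} {n : nat}.
Notation mu := (@lebesgue_measure R).
Notation nu := (lebesgue_cV R n).
Implicit Types (x xi : 'cV[R]_n) (b : 'cV[R]_n -> R).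

Lemma dotv_ge0 xi : 0 <= dotv xi xi.
Proof. by apply: sumr_ge0 => i _; rewrite -expr2 sqr_ge0. Qed.

Lemma sqr_enorm xi : enorm xi ^+ 2 = dotv xi xi.
Proof. by rewrite sqr_sqrtr// dotv_ge0. Qed.

Lemma measurable_dotv x : measurable_fun setT (fun xi => dotv x xi).
Proof.
apply: measurable_sum => i; apply: measurable_funM => //; exact: measurable_coord.
Qed.

Lemma measurable_dotvv : measurable_fun setT (fun xi : 'cV[R]_n => dotv xi xi).
Proof.
by apply: measurable_sum => i; apply: measurable_funM; exact: measurable_coord.
Qed.

Lemma measurable_enorm : measurable_fun setT (@enorm R n).
Proof.
apply: measurableT_comp; last exact: measurable_dotvv.
by apply: continuous_measurable_fun; exact: sqrt_continuous.
Qed.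

Lemma measurable_enormV : measurable_fun setT (fun xi : 'cV[R]_n => (enorm xi)^-1).
Proof.
rewrite (_ : (fun _ => _) = fun xi : 'cV[R]_n => enorm xi `^ (- 1)); last first.
  by apply/funext => xi; rewrite powR_inv1// sqrtr_ge0.
exact: measurableT_comp (@measurable_powR R (-1)) measurable_enorm.
Qed.

Definition box_fun xi : R := \prod_(i < n) \1_(`[(-2), 2]%classic) (xi i 0).

Lemma box_fun_ge0 xi : 0 <= box_fun xi.
Proof. by apply: prodr_ge0 => i _; rewrite indicE. Qed.

Lemma box_fun_eq0 xi : box_fun xi != 0 -> forall i, -2 <= xi i 0 <= 2.
Proof.
move=> /prodf_neq0 h i; have := h i isT; rewrite indicE.
by case: (boolP (xi i 0 \in _)) => [|_]; rewrite ?eqxx// inE/= in_itv.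
Qed.

Lemma real_prod (I : Type) (s : seq I) (F : I -> R) :
  (\prod_(i <- s) F i)%:C = \prod_(i <- s) (F i)%:C :> R[i].
Proof. exact: rmorph_prod. Qed.

Lemma integrable_box_fun : nu.-integrable setT (EFin \o box_fun).
Proof.
have i1 (i : 'I_n) : cintegrable mu (fun y => (\1_(`[(-2), 2]%classic) y)%:C : R[i]).
  split => /=; last exact: integrable0.
  by apply: integrable_indic_itv.
have [[h _] _] := cint_cV_prod i1.
by apply: eq_integrable h => // xi _ /=; rewrite -real_prod.
Qed.

Definition osc_amp (be : R) x (sg : R) b xi : R[i] :=
  expi (dotv x xi + sg * dotv xi xi) * (expR (- be * dotv xi xi) * b xi)%:C.

(* The constraint [d ^+ 2 <= |xi|^2] on the support and the uniformity in [be]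
   are what makes the class stable under division by [enorm]. *)
Definition good_amp (d B : R) b :=
  [/\ measurable_fun setT b,
      exists M, forall xi, `|b xi| <= M * box_fun xi,
      forall xi, b xi != 0 -> d ^+ 2 <= dotv xi xi &
      forall be x sg, -1 <= be ->
        normc (cint nu (osc_amp be x sg b)) <= B * expR (- be * d ^+ 2) / jap sg ^+ n].

Lemma box_dotv_le xi : box_fun xi != 0 -> dotv xi xi <= 4 * n%:R.
Proof.
move=> /box_fun_eq0 h; rewrite /dotv mulr_natr -[n in leRHS](card_ord n) -sumr_const.
by apply: ler_sum => i _; have /andP[? ?] := h i; nra.
Qed.

(** On the box |xi|^2 <= 4 n, so for be >= -1 the weight is at most e^{4 n}. This supplies the
    majorants in xi for the exchanges of integrals. *)
Lemma good_amp_box d B b : good_amp d B b ->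
  exists2 M, 0 <= M & forall be xi, -1 <= be ->
    `|expR (- be * dotv xi xi) * b xi| <= M * box_fun xi.
Proof.
case=> _ [M bM] _ _; exists (expR (4 * n%:R) * `|M|); first by rewrite mulr_ge0 ?expR_ge0.
move=> be xi be1; have [x0|x0] := eqVneq (box_fun xi) 0.
  by have := bM xi; rewrite x0 !mulr0 normr_le0 => /eqP ->; rewrite mulr0 normr0.
rewrite normrM ger0_norm ?expR_ge0// -mulrA; apply: ler_pM => //.
- rewrite ler_expR; have := box_dotv_le x0; have := dotv_ge0 xi; nra.
- by apply: (le_trans (bM xi)); rewrite ler_wpM2r ?box_fun_ge0// ler_norm.
Qed.

Lemma cmfun_osc_amp be x sg b : measurable_fun setT b -> cmfun (osc_amp be x sg b).
Proof.
move=> mb; apply: cmfunM.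
  apply: cmfun_expi; apply: measurable_funD; first exact: measurable_dotv.
  by apply: measurable_funM => //; exact: measurable_dotvv.
apply: cmfun_real; apply: measurable_funM => //.
apply: measurableT_comp => //.
by apply: measurable_funM => //; exact: measurable_dotvv.
Qed.

(** Inserting 1 / |xi| = pi^{-1/2} \int e^{- q^2 |xi|^2} dq replaces be by be + q^2, still >= -1, so
    the kernel bound applies for each q. It carries e^{- q^2 d^2}, whose integral sqrt(pi) / d is
    the loss of 1 / d in the constant. *)
Lemma good_amp_div_enorm d B b : 0 < d -> good_amp d B b ->
  good_amp d (B / d) (fun xi => b xi / enorm xi).
Proof.
move=> d0 gb; have [mb [M bM] bd bB] := gb.
have bnz xi : b xi != 0 -> d <= enorm xi.
  move=> b0; rewrite -ler_sqr ?nnegrE ?(ltW d0) ?sqrtr_ge0// sqr_enorm.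
  exact: bd.
split.
- by apply: measurable_funM => //; exact: measurable_enormV.
- exists (M / d) => xi; have [b0|b0] := eqVneq (b xi) 0.
    rewrite b0 mul0r normr0 mulrAC divr_ge0 ?(ltW d0)//.
    by have := bM xi; rewrite b0 normr0.
  rewrite normrM normfV [`|enorm _|]ger0_norm ?sqrtr_ge0// mulrAC.
  apply: ler_pM => //; first by rewrite invr_ge0 sqrtr_ge0.
  rewrite lef_pV2 ?posrE//; first exact: bnz.
  exact: lt_le_trans (bnz _ b0).
- by move=> xi; rewrite mulf_eq0 negb_or => /andP[/bd].
move=> be x sg be1.
have [M1 M10 bM1] := good_amp_box gb.
have [ig Eg] := integral_gauss_scale d0.
pose F (z : R * 'cV[R]_n) : R[i] := osc_amp (be + z.1 ^+ 2) x sg b z.2.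
have mF : cmfun F.
  have m2 := @measurable_snd _ _ (measurableTypeR R) 'cV[R]_n.
  have m1 := @measurable_fst _ _ (measurableTypeR R) 'cV[R]_n.
  have mD := measurableT_comp measurable_dotvv m2.
  apply: cmfunM.
    apply: cmfun_expi; apply: measurable_funD.
      exact: measurableT_comp (measurable_dotv x) m2.
    exact: measurable_funM.
  apply: cmfun_real; apply: measurable_funM; last exact: measurableT_comp mb m2.
  apply: measurableT_comp => //.
  apply: measurable_funM => //; apply: measurable_funN.
  by apply: measurable_funD => //; apply: measurable_funX.
have FB q xi : normc (F (q, xi)) <= expR (- (d ^+ 2 * q ^+ 2)) * (M1 * box_fun xi).
  have -> : F (q, xi) = osc_amp (be + q ^+ 2) x sg b xi by [].
  rewrite /osc_amp ComplexField.Normc.normcM normc_expi mul1r normc_real.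
  have [->|b0] := eqVneq (b xi) 0.
    by rewrite mulr0 normr0 !mulr_ge0 ?expR_ge0 ?box_fun_ge0.
  rewrite opprD mulrDl expRD mulrAC normrM mulrC; apply: ler_pM => //.
    rewrite ger0_norm ?expR_ge0// ler_expR mulNr lerN2 mulrC.
    by rewrite ler_wpM2l ?sqr_ge0//; exact: bd.
  exact: bM1.
have iM : nu.-integrable setT (EFin \o (fun xi => M1 * box_fun xi)).
  by have := integrableZl measurableT M1 integrable_box_fun.
have -> : cint nu (osc_amp be x sg (fun xi => b xi / enorm xi)) =
    ((Num.sqrt pi)^-1)%:C * cint nu (fun xi => cint mu (fun q => F (q, xi))).
  rewrite -cintZl; last exact: (cintegrable_cint2 ig iM mF FB).
  apply: eq_cint => xi; rewrite /F /osc_amp [X in cint mu X](_ : _ = fun q =>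
    expi (dotv x xi + sg * dotv xi xi) * (expR (- (be + q ^+ 2) * dotv xi xi) * b xi)%:C)//.
  have [->|b0] := eqVneq (b xi) 0.
    rewrite mul0r mulr0 rmorph0 mulr0 (_ : (fun q => _) = fun=> 0) ?cint0 ?mulr0//.
    by apply/funext => q; rewrite mulr0 rmorph0 mulr0.
  have e0 : 0 < enorm xi by exact: lt_le_trans (bnz _ b0).
  have [ie Ee] := integral_gauss_scale e0.
  pose K : R[i] := expi (dotv x xi + sg * dotv xi xi) * (expR (- be * dotv xi xi) * b xi)%:C.
  have -> : cint mu (fun q => expi (dotv x xi + sg * dotv xi xi) *
        (expR (- (be + q ^+ 2) * dotv xi xi) * b xi)%:C) =
      cint mu (fun q => K * (expR (- (enorm xi ^+ 2 * q ^+ 2)))%:C).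
    apply: eq_cint => q; rewrite /K -mulrA -rmorphM.
    have -> // : expR (- (be + q ^+ 2) * dotv xi xi) * b xi =
       expR (- be * dotv xi xi) * b xi * expR (- (enorm xi ^+ 2 * q ^+ 2)).
    by rewrite mulrAC -expRD; congr (expR _ * _); rewrite sqr_enorm; ring.
  rewrite cintZl; last by split => //=; exact: integrable0.
  rewrite /cint /= Ee Rintegral_cst// mul0r complexr0 /K.
  have -> : expR (- be * dotv xi xi) * (b xi / enorm xi) =
     (Num.sqrt pi)^-1 * (expR (- be * dotv xi xi) * b xi * (Num.sqrt pi / enorm xi)).
    have : Num.sqrt pi != 0 :> R by rewrite gt_eqF// sqrtr_gt0 pi_gt0.
    by move=> ?; field; rewrite gt_eqF.
  by rewrite !(rmorphM (real_complex R)) /= -!mulrA mulrCA.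
rewrite -(cint_fubini ig iM mF FB) ComplexField.Normc.normcM normc_real.
rewrite ger0_norm ?invr_ge0 ?sqrtr_ge0//.
have iB : mu.-integrable setT (EFin \o (fun q => B * expR (- be * d ^+ 2) / jap sg ^+ n *
    expR (- (d ^+ 2 * q ^+ 2)))).
  by have := integrableZl measurableT (B * expR (- be * d ^+ 2) / jap sg ^+ n) ig.
have Fq q : normc (cint nu (fun xi => F (q, xi))) <=
    B * expR (- be * d ^+ 2) / jap sg ^+ n * expR (- (d ^+ 2 * q ^+ 2)).
  have -> : (fun xi => F (q, xi)) = osc_amp (be + q ^+ 2) x sg b by [].
  have beq : -1 <= be + q ^+ 2 by have := sqr_ge0 q; lra.
  apply: (le_trans (bB _ x sg beq)).
  rewrite (_ : - (be + q ^+ 2) * d ^+ 2 = - be * d ^+ 2 - d ^+ 2 * q ^+ 2); last by ring.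
  rewrite expRD le_eqVlt; apply/orP; left; apply/eqP; ring.
have h := normc_cint_le (cintegrable_cint1 ig iM mF FB) iB Fq.
rewrite RintegralZl// Eg in h.
apply: (@le_trans _ _ ((Num.sqrt pi)^-1 *
   (B * expR (- be * d ^+ 2) / jap sg ^+ n * (Num.sqrt pi / d)))).
  by rewrite ler_wpM2l ?invr_ge0 ?sqrtr_ge0.
have : Num.sqrt pi != 0 :> R by rewrite gt_eqF// sqrtr_gt0 pi_gt0.
move=> p0; rewrite le_eqVlt; apply/orP; left; apply/eqP; field.
by rewrite p0 (lt0r_neq0 d0) expf_neq0// lt0r_neq0// jap_gt0.
Qed.

End amplitudes.

Section cells.
Context {R : realType} {n : nat}.
Notation mu := (@lebesgue_measure R).
Notation nu := (lebesgue_cV R n).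
Implicit Types (x xi : 'cV[R]_n).

(* The cells [cell d j], [j < n], partition the part of the box [-2, 2]^n where
   some coordinate is at least [d] in absolute value: [j] is the first such
   coordinate. *)
Definition cell_side (d : R) (j i : 'I_n) : set R :=
  if (i < j)%N then `](- d), d[%classic
  else if i == j then `[(-2), (- d)] `|` `[d, 2] else `[(-2), 2]%classic.

Definition cell_amp (d : R) (j : 'I_n) (m : 'I_n -> nat) xi : R :=
  \prod_(i < n) (\1_(cell_side d j i) (xi i 0) * xi i 0 ^+ m i).

Lemma cell_side_measurable d j i : 0 < d <= 2 ->
  measurable (cell_side d j i : set (measurableTypeR R)).
Proof.
move=> _; rewrite /cell_side; case: ifP => // _; case: ifP => // _.
exact: measurableU.
Qed.

Lemma cell_side_box d j i : 0 < d <= 2 -> cell_side d j i `<=` `[(-2), 2].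
Proof.
move=> /andP[d0 d2] y; rewrite /cell_side; case: ifP => _.
  by rewrite /= !in_itv/= => /andP[? ?]; apply/andP; split; lra.
case: ifP => // _ [] /=; rewrite !in_itv/= => /andP[? ?]; apply/andP; split; lra.
Qed.

Lemma osc_amp_cell be x sg d j m xi : osc_amp be x sg (cell_amp d j m) xi =
  \prod_(i < n) cell_osc (cell_side d j i) (m i) be (x i 0) sg (xi i 0).
Proof.
rewrite /osc_amp /cell_amp /cell_osc [RHS]big_split /=; congr (_ * _).
  rewrite /dotv mulr_sumr -big_split /=.
  exact: (big_morph (@expi R) (@expiD R) (@expi0 R)).
rewrite -real_prod; congr (real_complex R _).
rewrite /dotv mulr_sumr expR_sum -big_split /=; apply: eq_bigr => i _.
by rewrite -expr2 mulrA [_ * expR _]mulrC [RHS]mulrCA mulrA; ring.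
Qed.

Lemma normc_prod (I : Type) (s : seq I) (F : I -> R[i]) :
  normc (\prod_(i <- s) F i) = \prod_(i <- s) normc (F i).
Proof.
elim/big_ind2: _ => [|a a' b b' <- <-|//]; first by rewrite ComplexField.Normc.normc1.
by rewrite ComplexField.Normc.normcM.
Qed.

(** The kernel is a product over the coordinates, each giving [208 e^4 / jap sg]. The annular side i
    = j supplies in addition the factor e^{- be d^2} and the lower bound d^2 <= |xi|^2. Exponents up
    to 2 make room for xi_k xi_l with k = l. *)
Lemma good_cell_amp d j m : 0 < d <= 2 -> (forall i, (m i <= 2)%N) ->
  good_amp d ((208 * expR 4) ^+ n) (cell_amp d j m).
Proof.
move=> dd m2; have /andP[d0 d2] := dd.
have ms i := cell_side_measurable j i dd; have sb i := @cell_side_box d j i dd.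
split.
- apply: measurable_prod => i _; apply: measurable_funM.
    exact: measurableT_comp (measurable_indic (ms i)) (measurable_coord i).
  by apply: measurable_funX; exact: measurable_coord.
- exists (4 ^+ n) => xi; rewrite normr_prod /box_fun -[n in 4 ^+ n](card_ord n) -prodr_const.
  rewrite -big_split /=; apply: ler_prod => i _; apply/andP; split; first exact: normr_ge0.
  rewrite !indicE; have [xs|xs] := boolP (xi i 0 \in cell_side d j i); last first.
    by rewrite mul0r normr0 mulr_ge0.
  have /= := sb _ _ (set_mem xs); move=> b.
  rewrite mem_set//= mul1r mulr1 normrX; move: b; rewrite in_itv/= => /andP[? ?].
  have : `|xi i 0| <= 2 by rewrite ler_norml; apply/andP; split; lra.
  move: (normr_ge0 (xi i 0)) (m2 i); set y := `| _ |.
  by case: (m i) => [|[|[|]]]//; rewrite ?expr0 ?expr1; nra.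
- move=> xi /prodf_neq0 /(_ j isT); rewrite mulf_eq0 negb_or indicE => /andP[+ _].
  rewrite /cell_side ltnn eqxx; case: (boolP (_ \in _)); rewrite ?eqxx// => /set_mem h _.
  rewrite /dotv (bigD1 j)//= -[leLHS]addr0; apply: lerD; last first.
    by apply: sumr_ge0 => i _; rewrite -expr2 sqr_ge0.
  by case: h; rewrite /= in_itv/= => /andP[? ?]; nra.
move=> be x sg be1.
rewrite (_ : osc_amp be x sg (cell_amp d j m) = fun xi => \prod_(i < n)
   cell_osc (cell_side d j i) (m i) be (x i 0) sg (xi i 0)); last first.
  by apply/funext => xi; rewrite osc_amp_cell.
have ic i : cintegrable mu (cell_osc (cell_side d j i) (m i) be (x i 0) sg).
  exact: cintegrable_cell.
rewrite (cint_cV_prod ic).2 normc_prod.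
apply: (@le_trans _ _ (\prod_(i < n) (208 * expR 4 / jap sg *
   (if i == j then expR (- be * d ^+ 2) else 1)))).
  apply: ler_prod => i _; rewrite normc_ge0 /=.
  rewrite /cell_side; case: ifPn => [ij|_].
    by rewrite ifN ?mulr1 ?cell_sym_bound// -val_eqE /= ltn_eqF.
  case: ifPn => _; first exact: cell_annulus_bound.
  rewrite mulr1; have := @cell_sym_bound R true false 2 (m i) be (x i 0) sg.
  by apply => //; apply/andP; split.
rewrite big_split /= -big_mkcond /= big_pred1_eq prodr_const card_ord.
rewrite expr_div_n mulrAC; exact: lexx.
Qed.

End cells.

(** * Gaussian integrals and Fourier inversion on the line *)

Section truncation.
Context {R : realType}.
Notation mu := (@lebesgue_measure R).

Lemma cvg_Rintegral_trunc (f : R -> R) : mu.-integrable setT (EFin \o f) ->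
  (fun k : nat => \int[mu]_(y in `[(- k%:R), k%:R]) f y) @ \oo --> \int[mu]_y f y.
Proof.
move=> fi.
have /measurable_int/measurable_EFinP mf := fi.
pose fk (k : nat) (y : R) : \bar R := (\1_(`[(- k%:R), k%:R]%classic) y * f y)%:E.
have fkf y : fk ^~ y @ \oo --> (f y)%:E.
  apply: cvg_near_cst; exists (Num.truncn `|y|).+1 => //= k /= yk.
  rewrite /fk indicE mem_set ?mul1r//= in_itv/= -ler_norml ltW//.
  by apply: (lt_le_trans (truncnS_gt _)); rewrite ler_nat.
have := @dominated_cvg _ _ _ mu setT measurableT fk (EFin \o f) (EFin \o (fun y => `|f y|)).
move=> /(_ _ _ _ _ _)h.
have {}h : (\int[mu]_y fk k y)%E @[k --> \oo] --> (\int[mu]_y (f y)%:E)%E.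
  apply: h.
  - by move=> k; apply/measurable_EFinP; exact: measurable_funM.
  - by move=> y _; exact: fkf.
  - by [].
  - exact: integrable_norm.
  - move=> k y _; rewrite /= lee_fin normrM ler_piMl// indicE.
    by case: (_ \in _); rewrite ?normr1 ?normr0.
have fin : (\int[mu]_y (f y)%:E)%E \is a fin_num by exact: integrable_fin_num.
rewrite -(fineK fin) in h.
have {}h := fine_cvg h.
rewrite (_ : (fun k : nat => _) = (fun k => fine (\int[mu]_y fk k y)%E)); first exact: h.
by apply/funext => k; rewrite -Rintegral_indicM.
Qed.

Lemma Rintegral_trunc_le (f : R -> R) (B : R) : mu.-integrable setT (EFin \o f) ->
  (forall k : nat, `|\int[mu]_(y in `[(- k%:R), k%:R]) f y| <= B) ->
  `|\int[mu]_y f y| <= B.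
Proof.
move=> fi fB; have /cvg_norm h := cvg_Rintegral_trunc fi.
rewrite -(cvg_lim _ h)//; apply: limr_le; first by apply/cvg_ex; eexists; exact: h.
by near=> k; exact: fB.
Unshelve. all: by end_near. Qed.

Lemma cvg_gauss_nat : (fun k : nat => expR (- (k%:R : R) ^+ 2)) @ \oo --> (0 : R).
Proof.
exact: cvg_comp (@cvgr_idn R) (@cvg_gauss_fun R).
Qed.

End truncation.

(** * Gaussian integrals with an oscillating factor *)

Section gaussian_moments.
Context {R : realType}.
Notation mu := (@lebesgue_measure R).
Notation gauss := (@gauss_fun R).

Lemma mul_gauss_le (y : R) : `|y| * gauss y <= expR (- ((1 / 2) ^+ 2 * y ^+ 2)).
Proof.
have e : 1 + 3 / 4 * y ^+ 2 <= expR (3 / 4 * y ^+ 2) by exact: expR_ge1Dx.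
rewrite (_ : - ((1 / 2) ^+ 2 * y ^+ 2) = 3 / 4 * y ^+ 2 + - y ^+ 2); last by field.
rewrite expRD; apply: ler_wpM2r; first exact: expR_ge0.
apply: le_trans e; rewrite -[y ^+ 2]real_normK ?num_real//.
have := sqr_ge0 (`|y| - 2 / 3); nra.
Qed.

Lemma integrable_mul_gauss_bound :
  mu.-integrable setT (EFin \o (fun y => expR (- ((1 / 2) ^+ 2 * y ^+ 2)))).
Proof.
have p : 0 < 1 / 2 :> R by rewrite divr_gt0.
by have [] := integral_gauss_scale p.
Qed.

Lemma integrable_gaussM (w : R -> R) : measurable_fun setT w ->
  (forall y, `|w y| <= 1) ->
  mu.-integrable setT (EFin \o (fun y => w y * gauss y)).
Proof.
move=> mw w1; apply: le_integrable (@integrableT_gauss R) => //.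
  by apply/measurable_EFinP; apply: measurable_funM => //; exact: measurable_gauss_fun.
by move=> y _; rewrite /= lee_fin normrM ler_piMl.
Qed.

Lemma integrable_gaussXM (w : R -> R) : measurable_fun setT w ->
  (forall y, `|w y| <= 1) ->
  mu.-integrable setT (EFin \o (fun y => y * w y * gauss y)).
Proof.
move=> mw w1; apply: le_integrable integrable_mul_gauss_bound => //.
  apply/measurable_EFinP; apply: measurable_funM; last exact: measurable_gauss_fun.
  exact: measurable_funM.
move=> y _; rewrite /= lee_fin [leRHS]ger0_norm ?expR_ge0//.
apply: le_trans (mul_gauss_le y); rewrite normrM [`|gauss y|]ger0_norm ?expR_ge0//.
by rewrite ler_wpM2r ?expR_ge0// normrM ler_piMr.
Qed.

Section trigonometric.
Variables (h h' : R -> R) (sg : R).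
Hypotheses (dh : forall y : R, is_derive y 1 h (h' y)) (ch' : continuous h').
Hypotheses (h1 : forall y, `|h y| <= 1) (h'1 : forall y, `|h' y| <= 1).

Let ch : continuous h. Proof. exact: is_derive_continuous dh. Qed.

Let ph (t y : R) : R := t * y - sg * (y * y).

Let cph t : continuous (ph t). Proof. by rewrite /ph; contder; der. Qed.

Let mhph t : measurable_fun setT (fun y => h (ph t y)).
Proof.
apply: continuous_measurable_fun => y; apply: continuous_comp; first exact: cph.
exact: ch.
Qed.

Let ch'ph t : continuous (fun y => h' (ph t y)).
Proof. by move=> y; apply: continuous_comp; [exact: cph|exact: ch']. Qed.

Let mh'ph t : measurable_fun setT (fun y => h' (ph t y)).
Proof. by apply: continuous_measurable_fun; exact: ch'ph. Qed.

Lemma is_derive_gauss_osc (t : R) :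
  is_derive t 1 (fun t => \int[mu]_y (h (t * y - sg * (y * y)) * gauss y))
    (\int[mu]_y (y * h' (t * y - sg * (y * y)) * gauss y)).
Proof.
pose f (t y : R) := h (ph t y) * gauss y.
have df (s y : R) : is_derive s 1 (f ^~ y) (y * h' (ph s y) * gauss y).
  have dp : is_derive s 1 (fun s => ph s y) y.
    by rewrite /ph; derto; [der|dred; ring].
  have dhp : is_derive s 1 (fun s => h (ph s y)) (h' (ph s y) * y).
    exact: (@is_derive1_comp _ h).
  by derto; [eapply is_derive_mulE; [exact: dhp|exact: is_derive_cstE]|dred; ring].
have pE s y : partial1of2 f s y = y * h' (ph s y) * gauss y.
  by rewrite partial1of2E; have [_ ->] := df s y.
have It : (`]t - 1, t + 1[%classic : set R) t by rewrite /= in_itv/=; apply/andP; split; lra.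
have intf x : (`]t - 1, t + 1[%classic : set R) x -> mu.-integrable setT (EFin \o f x).
  by move=> _; exact: integrable_gaussM.
have derf x y : (`]t - 1, t + 1[%classic : set R) x -> [set: R] y -> derivable (f ^~ y) x 1.
  by move=> _ _; have [] := df x y.
have Gub x y : (`]t - 1, t + 1[%classic : set R) x -> [set: R] y ->
    `|partial1of2 f x y| <= expR (- ((1 / 2) ^+ 2 * y ^+ 2)).
  move=> _ _; rewrite pE; apply: le_trans (mul_gauss_le y).
  rewrite normrM [`|gauss y|]ger0_norm ?expR_ge0//.
  by rewrite ler_wpM2r ?expR_ge0// normrM ler_piMr.
have D1 := @derivable_under_integral _ _ _ mu f setT measurableT t _ _ It intf derf
  _ (fun y => expR_ge0 _) integrable_mul_gauss_bound Gub.
have D2 := @differentiation_under_integral _ _ _ mu f setT measurableT t _ _ It intf derf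
  _ (fun y => expR_ge0 _) integrable_mul_gauss_bound Gub.
apply: DeriveDef; first exact: D1.
rewrite -derive1E D2; apply: eq_Rintegral => y _; exact: pE.
Qed.

(** The derivative in y of h(t y - sg y^2) e^{- y^2} integrates to 0 over the line: on [-k, k] the
    boundary terms are at most 2 e^{- k^2}. *)
Lemma gauss_osc_by_parts (t : R) :
  t * \int[mu]_y (h' (t * y - sg * (y * y)) * gauss y) =
  2 * sg * \int[mu]_y (y * h' (t * y - sg * (y * y)) * gauss y) +
  2 * \int[mu]_y (y * h (t * y - sg * (y * y)) * gauss y).
Proof.
pose F y := h (ph t y) * gauss y.
pose f y := t * (h' (ph t y) * gauss y) -
  (2 * sg * (y * h' (ph t y) * gauss y) + 2 * (y * h (ph t y) * gauss y)).
have dF (y : R) : is_derive y 1 F (f y).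
  have dp : is_derive y 1 (ph t) (t - 2 * sg * y).
    by rewrite /ph; derto; [der|dred; ring].
  have dhp : is_derive y 1 (fun y => h (ph t y)) (h' (ph t y) * (t - 2 * sg * y)).
    exact: (@is_derive1_comp _ h).
  have dg : is_derive y 1 gauss (- 2 * y * gauss y).
    by rewrite /gauss_fun; derto; [der|dred; ring].
  by derto; [eapply is_derive_mulE; [exact: dhp|exact: dg]|rewrite /f; dred; ring].
have i1 := integrable_gaussM (mh'ph t) (fun y => h'1 _).
have i2 := integrable_gaussXM (mh'ph t) (fun y => h'1 _).
have i3 := integrable_gaussXM (mhph t) (fun y => h1 _).
have j1 : mu.-integrable setT (EFin \o (fun y => t * (h' (ph t y) * gauss y))).
  by have := integrableZl measurableT t i1.
have j2 : mu.-integrable setT (EFin \o (fun y => 2 * sg * (y * h' (ph t y) * gauss y))).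
  by have := integrableZl measurableT (2 * sg) i2.
have j3 : mu.-integrable setT (EFin \o (fun y => 2 * (y * h (ph t y) * gauss y))).
  by have := integrableZl measurableT 2 i3.
have j23 : mu.-integrable setT (EFin \o (fun y => 2 * sg * (y * h' (ph t y) * gauss y) +
    2 * (y * h (ph t y) * gauss y))).
  by have := integrableD measurableT j2 j3.
have fi : mu.-integrable setT (EFin \o f) by have := integrableB measurableT j1 j23.
have cg := @continuous_gauss_fun R.
have chp : continuous (fun y => h (ph t y)).
  by move=> y; apply: continuous_comp; [exact: cph|exact: ch].
have cf : continuous f.
  move=> y; apply: cvgB; [|apply: cvgD]; (apply: cvgM; first exact: cvg_cst);
    (apply: cvgM; last exact: cg).
  - exact: ch'ph.
  - by apply: cvgM; [exact: cvg_id|exact: ch'ph].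
  - by apply: cvgM; [exact: cvg_id|exact: chp].
have E k : \int[mu]_(y in `[(- k%:R), k%:R]) f y = F k%:R - F (- k%:R).
  by apply: Rintegral_FTC2 => //; rewrite ge0_cp.
have lim0 : (fun k : nat => F k%:R - F (- k%:R)) @ \oo --> (0 : R).
  apply/norm_cvg0P.
  apply: (@squeeze_cvgr _ _ _ _ (fun=> 0) (fun k : nat => 2 * expR (- (k%:R : R) ^+ 2))).
  - near=> k; rewrite normr_ge0 /=; apply: (le_trans (ler_normB _ _)).
    rewrite mulr_natl mulr2n; apply: lerD; rewrite normrM /gauss_fun ?sqrrN.
      by rewrite (ger0_norm (expR_ge0 _)) ler_piMl ?expR_ge0.
    by rewrite (ger0_norm (expR_ge0 _)) ler_piMl ?expR_ge0.
  - exact: cvg_cst.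
  - by rewrite -[X in _ --> X](mulr0 2); apply: cvgM; [exact: cvg_cst|exact: cvg_gauss_nat].
have : \int[mu]_y f y = 0.
  have := cvg_Rintegral_trunc fi; under eq_fun do rewrite E.
  by move=> /(cvg_unique _ lim0) -/(_ _) ->.
rewrite /f RintegralB// RintegralD// !RintegralZl//.
by move=> /eqP; rewrite subr_eq0 => /eqP.
Unshelve. all: by end_near. Qed.

End trigonometric.

End gaussian_moments.

Section gaussian_oscillatory_integral.
Context {R : realType}.
Notation mu := (@lebesgue_measure R).
Notation gauss := (@gauss_fun R).
Implicit Types (sg t : R).

Definition gauss_osc (k : nat) sg t : R[i] :=
  cint mu (fun y => expi (t * y - sg * (y * y)) * (y ^+ k * gauss y)%:C).

Let A sg t := \int[mu]_y (cos (t * y - sg * (y * y)) * gauss y).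
Let B sg t := \int[mu]_y (sin (t * y - sg * (y * y)) * gauss y).
Let A1 sg t := \int[mu]_y (y * cos (t * y - sg * (y * y)) * gauss y).
Let B1 sg t := \int[mu]_y (y * sin (t * y - sg * (y * y)) * gauss y).

Lemma gauss_osc0E sg t : gauss_osc 0 sg t =
  (\int[mu]_y (cos (t * y - sg * (y * y)) * gauss y)) +i*
  (\int[mu]_y (sin (t * y - sg * (y * y)) * gauss y)).
Proof.
rewrite /gauss_osc /cint.
by congr Complex; apply: eq_Rintegral => y _ /=; rewrite expr0; ring.
Qed.

Lemma gauss_osc1E sg t : gauss_osc 1 sg t = A1 sg t +i* B1 sg t.
Proof.
rewrite /gauss_osc /cint /A1 /B1.
by congr Complex; apply: eq_Rintegral => y _ /=; rewrite expr1; ring.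
Qed.

Let dsin (y : R) : is_derive y 1 sin (cos y). Proof. exact: is_derive_sin. Qed.
Let dcos (y : R) : is_derive y 1 cos (- sin y). Proof. exact: is_derive_cos. Qed.
Let cNsin : continuous (fun y : R => - sin y).
Proof. by move=> y; apply: cvgN; exact: continuous_sin. Qed.
Let Nsin_max (y : R) : `|- sin y| <= 1. Proof. by rewrite normrN sin_max. Qed.

Let mph sg t : measurable_fun setT (fun y : R => t * y - sg * (y * y)).
Proof. by apply: continuous_measurable_fun; contder; der. Qed.

Let msin sg t : measurable_fun setT (fun y : R => sin (t * y - sg * (y * y))).
Proof.
apply: measurableT_comp; last exact: mph.
by apply: continuous_measurable_fun; exact: continuous_sin.
Qed.

Lemma gauss_osc_derivA sg t : is_derive t 1
  (fun t => \int[mu]_y (cos (t * y - sg * (y * y)) * gauss y))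
  (- \int[mu]_y (y * sin (t * y - sg * (y * y)) * gauss y)).
Proof.
have := is_derive_gauss_osc sg dcos (@cos_max R) Nsin_max t.
congr is_derive; rewrite -mulN1r -RintegralZl//; last first.
  by apply: integrable_gaussXM => // y; exact: sin_max.
by apply: eq_Rintegral => y _; ring.
Qed.

Let dA sg t : is_derive t 1 (A sg) (- B1 sg t).
Proof. exact: gauss_osc_derivA. Qed.

Let dB sg t : is_derive t 1 (B sg) (A1 sg t).
Proof. exact: is_derive_gauss_osc sg dsin (@sin_max R) (@cos_max R) t. Qed.

Lemma gauss_osc_parts1 sg t :
  t * \int[mu]_y (cos (t * y - sg * (y * y)) * gauss y) =
  2 * sg * \int[mu]_y (y * cos (t * y - sg * (y * y)) * gauss y) +
  2 * \int[mu]_y (y * sin (t * y - sg * (y * y)) * gauss y).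
Proof. exact: gauss_osc_by_parts sg dsin (@continuous_cos R) (@sin_max R) (@cos_max R) t. Qed.

Let by_parts1 sg t : t * A sg t = 2 * sg * A1 sg t + 2 * B1 sg t.
Proof. exact: gauss_osc_parts1. Qed.

Let by_parts2 sg t : - (t * B sg t) = - (2 * sg * B1 sg t) + 2 * A1 sg t.
Proof.
have := gauss_osc_by_parts sg dcos cNsin (@cos_max R) Nsin_max t.
have -> : \int[mu]_y (- sin (t * y - sg * (y * y)) * gauss y) = - B sg t.
  rewrite -mulN1r -RintegralZl//; last first.
    by apply: integrable_gaussM => // y; exact: sin_max.
  by apply: eq_Rintegral => y _; ring.
have -> : \int[mu]_y (y * - sin (t * y - sg * (y * y)) * gauss y) = - B1 sg t.
  rewrite -mulN1r -RintegralZl//; last first.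
    by apply: integrable_gaussXM => // y; exact: sin_max.
  by apply: eq_Rintegral => y _; ring.
by rewrite -/(A1 sg t) !mulrN.
Qed.

Let D sg : R := 1 + sg ^+ 2.
Let D0 sg : 0 < D sg. Proof. by rewrite ltr_pwDl// sqr_ge0. Qed.

(** The two integrations by parts are a linear system for (A1, B1) of determinant -4 (1 + sg^2);
    this and [B1E] solve it. *)
Let A1E sg t : A1 sg t = t * (sg * A sg t - B sg t) / (2 * D sg).
Proof.
apply: (mulIf (lt0r_neq0 (D0 sg))).
have h1 := by_parts1 sg t; have h2 := by_parts2 sg t.
rewrite (_ : t * (sg * A sg t - B sg t) / (2 * D sg) * D sg =
   (sg * (t * A sg t) - t * B sg t) / 2); last by have := lt0r_neq0 (D0 sg); move=> ?; field.
by rewrite h1 [- (t * B sg t)]h2 /D; field.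
Qed.

Let B1E sg t : B1 sg t = t * (A sg t + sg * B sg t) / (2 * D sg).
Proof.
apply: (mulIf (lt0r_neq0 (D0 sg))).
have h1 := by_parts1 sg t; have h2 := by_parts2 sg t.
rewrite (_ : t * (A sg t + sg * B sg t) / (2 * D sg) * D sg =
   (t * A sg t - sg * - (t * B sg t)) / 2); last by have := lt0r_neq0 (D0 sg); move=> ?; field.
by rewrite h1 h2 /D; field.
Qed.

Let N sg t := A sg t ^+ 2 + B sg t ^+ 2.

(** With A' = - B1, B' = A1 and the formulas for A1 and B1, the terms in A B cancel and N' = - (t /
    D) N. *)
Let NE sg t : N sg t = N sg 0 * expR (- (t ^+ 2 / (2 * D sg))).
Proof.
pose K t := N sg t * expR (t ^+ 2 / (2 * D sg)).
have dK (s : R) : is_derive s 1 K 0.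
  have dA' := dA sg; have dB' := dB sg.
  rewrite /K /N; derto; [der|dred].
  have := lt0r_neq0 (D0 sg); rewrite A1E B1E => ?; field.
  by [].
have KE : K t = K 0 by exact: is_derive_0_is_cst.
move: KE; rewrite /K expr0n/= mul0r expR0 mulr1 => <-.
by rewrite -mulrA -expRD subrr expR0 mulr1.
Qed.

Let normc0_sqr sg t : normc (gauss_osc 0 sg t) ^+ 2 = N sg t.
Proof. by rewrite gauss_osc0E sqr_normc_ReIm. Qed.

(* Integration by parts turns the [t]-derivative of [gauss_osc 0 sg t] into a
   multiple of the function itself; solving this differential equation stands in
   for the complex Gaussian integral. *)
Lemma normc_gauss_osc0 sg t : normc (gauss_osc 0 sg t) =
  normc (gauss_osc 0 sg 0) * expR (- (t ^+ 2 / (4 * jap sg ^+ 4))).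
Proof.
apply/eqP; rewrite -(eqrXn2 (n := 2))// ?mulr_ge0 ?normc_ge0 ?expR_ge0//.
rewrite exprMn !normc0_sqr NE -expRM_natl jap_exp4 -/(D sg); apply/eqP.
congr (_ * expR _); have := lt0r_neq0 (D0 sg) => ?; by field.
Qed.

(** [A1E] and [B1E] say that [gauss_osc 1] is t (sg + i) / (2 D) times [gauss_osc 0], and |sg + i|^2
    = D = [jap sg ^+ 4]. *)
Lemma normc_gauss_osc1 sg t :
  normc (gauss_osc 1 sg t) = `|t| / (2 * jap sg ^+ 2) * normc (gauss_osc 0 sg t).
Proof.
have E1 : normc (gauss_osc 1 sg t) ^+ 2 =
    t ^+ 2 / (4 * D sg) * normc (gauss_osc 0 sg t) ^+ 2.
  rewrite normc0_sqr gauss_osc1E sqr_normc_ReIm /N.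
  move: (A1E sg t) (B1E sg t); move: (lt0r_neq0 (D0 sg)).
  move: (A sg t) (B sg t) (A1 sg t) (B1 sg t) => a b a1 b1 d0 /= -> ->.
  by move: d0; rewrite /D => d0; field.
move: E1 (normc_ge0 (gauss_osc 0 sg t)) (normc_ge0 (gauss_osc 1 sg t)).
move: (normc _) (normc _) => n1 n0 E1 n00 n10.
have j0 := jap_gt0 sg.
apply/eqP; rewrite -(eqrXn2 (n := 2))//; last first.
  by rewrite mulr_ge0// divr_ge0// mulr_ge0// exprn_ge0// ltW.
rewrite E1 exprMn expr_div_n (real_normK (num_real t)); apply/eqP; congr (_ / _ * _).
by rewrite exprMn -exprM jap_exp4; congr (_ * _); ring.
Qed.

(** Van der Corput's lemma on [-k, k], with constants that do not see k: M = 1, and V = 8 because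
    the variation of the Gaussian is at most 2 \int e^{- y^2 / 4} dy = 4 sqrt(pi). As 2 pi + 8 <=
    16, this gives 16 / sqrt |sg| for |sg| >= 1, and 32 after passing to [jap]. *)
Lemma normc_gauss_osc00_le sg : normc (gauss_osc 0 sg 0) <= 32 / jap sg.
Proof.
have isg : mu.-integrable setT (EFin \o gauss) by exact: integrableT_gauss.
have i0 : cintegrable mu (fun y => expi (0 * y - sg * (y * y)) * (y ^+ 0 * gauss y)%:C).
  apply: (cintegrable_le _ isg).
    apply: cmfunM; first by apply: cmfun_expi; exact: mph.
    apply: cmfun_real; under eq_fun do rewrite expr0 mul1r; exact: measurable_gauss_fun.
  move=> y; rewrite ComplexField.Normc.normcM normc_expi normc_real expr0 !mul1r.
  by rewrite ger0_norm// expR_ge0.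
have Sp : Num.sqrt pi <= 2 :> R.
  have -> : 2 = Num.sqrt (2 ^+ 2) :> R by rewrite sqrtr_sqr ger0_norm.
  by rewrite ler_wsqrtr//; have := @pihalf_lt2 R; lra.
have Ig : \int[mu]_y gauss y <= 2 by rewrite /Rintegral integralT_gauss.
rewrite ler_pdivlMr ?jap_gt0//.
have [s1|s1] := leP 1 `|sg|; last first.
  have h : normc (gauss_osc 0 sg 0) <= 2.
    apply: le_trans Ig; apply: normc_cint_le => // y.
    rewrite ComplexField.Normc.normcM normc_expi normc_real expr0 !mul1r.
    by rewrite ger0_norm// expR_ge0.
  have := jap_le_small (ltW s1); have := jap_gt0 sg; have := normc_ge0 (gauss_osc 0 sg 0).
  nra.
have sg0 : - sg != 0 by rewrite oppr_eq0 -normr_gt0 (lt_le_trans _ s1).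
have S0 : 0 < Num.sqrt `|sg| by rewrite sqrtr_gt0 (lt_le_trans _ s1).
suff h : normc (gauss_osc 0 sg 0) <= 16 / Num.sqrt `|sg|.
  have := jap_le_large s1; rewrite ler_pdivlMr// in h.
  have := normc_ge0 (gauss_osc 0 sg 0); have := jap_gt0 sg; nra.
apply: normc_le_rot => th; rewrite -cintZl//=.
apply: (le_trans (ler_norm _)).
have [ic _] := cintegrableZl (expi th) i0.
apply: Rintegral_trunc_le => // k.
have k0 : - k%:R <= k%:R :> R by rewrite ge0_cp.
have dg (y : R) : is_derive y 1 gauss (- 2 * y * gauss y).
  by rewrite /gauss_fun; derto; [der|dred; ring].
have cdg : continuous (fun y : R => - 2 * y * gauss y).
  move=> y; apply: cvgM; last exact: continuous_gauss_fun.
  by apply: cvgM; [exact: cvg_cst|exact: cvg_id].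
have gM (y : R) : - k%:R <= y <= k%:R -> `|gauss y| <= 1.
  by move=> _; rewrite ger0_norm ?gauss_fun_ge0 ?gauss_fun_le1.
have gV : \int[mu]_(y in `[(- k%:R), k%:R]) `|- 2 * y * gauss y| <= 8.
  have p : 0 < 1 / 2 :> R by rewrite divr_gt0.
  have [ig Eg] := integral_gauss_scale p.
  rewrite -Rintegral_indicM.
  apply: (@le_trans _ _ (\int[mu]_y (2 * expR (- ((1 / 2) ^+ 2 * y ^+ 2))))); last first.
    by rewrite RintegralZl// Eg; lra.
  apply: le_Rintegral => //.
  - apply: (integrable_indicM (a := - k%:R) (b := k%:R)) => //.
    exact: continuous_normr_fun.
  - by have := integrableZl measurableT 2 ig.
  move=> y _; have := mul_gauss_le y => h.
  rewrite !normrM normrN [`|2|]ger0_norm// [`|gauss y|]ger0_norm ?expR_ge0//.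
  rewrite indicE; case: (_ \in _); rewrite ?mul1r ?mul0r; last first.
    by rewrite mulr_ge0 ?expR_ge0.
  by move: h; rewrite mul1r -mulrA ler_pM2l.
have := van_der_corput_quadratic 0 th sg0 k0 dg cdg gM gV.
rewrite normrN => h; apply: le_trans (le_trans h _).
  rewrite le_eqVlt; apply/orP; left; apply/eqP; congr `| _ |.
  by apply: eq_Rintegral => y _; rewrite expr0 [cos (_ + th)]cosD mulNr; ring.
rewrite ler_pM2r ?invr_gt0//; have := @pihalf_lt2 R; lra.
Qed.

End gaussian_oscillatory_integral.

Section integrals_on_the_line.
Context {R : realType}.
Notation mu := (@lebesgue_measure R).
Notation gauss := (@gauss_fun R).

Lemma integrable_affine (f : R -> R) (a b : R) : 0 < a -> continuous f ->
  mu.-integrable setT (EFin \o f) ->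
  mu.-integrable setT (EFin \o (fun y => a * f (a * y + b))) /\
  \int[mu]_y f y = \int[mu]_y (a * f (a * y + b)).
Proof.
move=> a0 cf fi; have cn := continuous_normr_fun cf.
have caf : continuous (fun y => a * y + b) by contder; der.
have cfa : continuous (fun y => a * f (a * y + b)).
  move=> y; apply: cvgM; first exact: cvg_cst.
  by apply: continuous_comp; [exact: caf|exact: cf].
have mfa : measurable_fun setT (fun y => a * f (a * y + b)).
  exact: continuous_measurable_fun.
have E1 := ge0_integral_affine b a0 cn (fun y => normr_ge0 (f y)).
have i1 : mu.-integrable setT (EFin \o (fun y => a * f (a * y + b))).
  apply/integrableP; split; first exact/measurable_EFinP.
  under eq_integral do rewrite /= normrM (gtr0_norm a0).
  by rewrite -E1; have /integrableP[] := fi.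
split => //.
have cg : continuous (fun y => `|f y| + f y) by move=> y; apply: cvgD; [exact: cn|exact: cf].
have g0 y : 0 <= `|f y| + f y by rewrite -lerBlDr sub0r -normrN ler_norm.
have E2 := ge0_integral_affine b a0 cg g0.
have in1 := integrable_norm fi; have in2 := integrable_norm i1.
(* The substitution rule is available for nonnegative functions; |f| + f and |f| are nonnegative and
   still continuous, unlike what a cut at the zeros of f by indicators would give. *)
have L : \int[mu]_y f y = \int[mu]_y (`|f y| + f y) - \int[mu]_y `|f y|.
  by rewrite RintegralD// addrC addKr.
have aE y : a * (`|f (a * y + b)| + f (a * y + b)) =
    `|a * f (a * y + b)| + a * f (a * y + b).
  by rewrite normrM (gtr0_norm a0) mulrDr.
rewrite L /Rintegral E2 E1 -/(Rintegral _ _ _) -/(Rintegral _ _ _).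
under eq_Rintegral do rewrite aE.
rewrite RintegralD// [X in _ - X](_ : _ = \int[mu]_y `|a * f (a * y + b)|).
  by rewrite addrAC subrr add0r.
by apply: eq_Rintegral => y _; rewrite normrM (gtr0_norm a0).
Qed.

Lemma integral_oneDsqrV : mu.-integrable setT (EFin \o (fun y => (1 + y ^+ 2)^-1)) /\
  \int[mu]_y (1 + y ^+ 2)^-1 = pi.
Proof.
have E : (\int[mu]_y ((1 + y ^+ 2)^-1)%:E = pi%:E)%E.
  rewrite ge0_symfun_integralT//.
  - rewrite -set_itvcy.
    have := @integral0y_oneDsqr R; rewrite /oneDsqr => ->.
    by rewrite -EFinM; congr EFin; field.
  - by move=> y; rewrite invr_ge0 addr_ge0// sqr_ge0.
  - exact: continuous_oneDsqrV.
  - by move=> y; rewrite /= sqrrN.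
split; last by rewrite /Rintegral E.
apply/integrableP; split.
  apply/measurable_EFinP; apply: continuous_measurable_fun; exact: continuous_oneDsqrV.
under eq_integral do rewrite /= ger0_norm ?invr_ge0 ?addr_ge0 ?sqr_ge0//.
by rewrite E ltry.
Qed.

Lemma integral_sqrDsqrV (t : R) : 0 < t ->
  mu.-integrable setT (EFin \o (fun y => (t ^+ 2 + y ^+ 2)^-1)) /\
  \int[mu]_y (t ^+ 2 + y ^+ 2)^-1 = pi / t.
Proof.
move=> t0; have [i1 E1] := integral_oneDsqrV.
have tV0 : 0 < t^-1 by rewrite invr_gt0.
have t0' := lt0r_neq0 t0.
have [i2 E2] := integrable_affine 0 tV0 (@continuous_oneDsqrV R) i1.
have aE (y : R) : (t ^+ 2 + y ^+ 2)^-1 = t^-1 * (t^-1 * (1 + (t^-1 * y + 0) ^+ 2)^-1).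
  have D0 : t ^+ 2 + y ^+ 2 != 0 by rewrite lt0r_neq0// ltr_pwDl ?sqr_ge0// exprn_gt0.
  have D1 : 1 + (t^-1 * y + 0) ^+ 2 != 0 by rewrite lt0r_neq0// ltr_pwDl ?sqr_ge0.
  by field; rewrite t0' D0.
split.
  have := integrableZl measurableT t^-1 i2; apply: eq_integrable => // y _.
  by rewrite /= aE.
under eq_Rintegral do rewrite aE.
rewrite RintegralZl//.
by move: E2; rewrite /oneDsqr E1 => <-; rewrite mulrC.
Qed.

(** For sg = 0 the real part satisfies A' = - (t / 2) A, which determines it. It already has the
    modulus found in [normc_gauss_osc0], so the imaginary part must vanish. *)
Lemma gauss_fourier (t : R) :
  gauss_osc 0 0 t = (Num.sqrt pi * expR (- (t ^+ 2 / 4)))%:C.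
Proof.
pose A t := \int[mu]_y (cos (t * y - 0 * (y * y)) * gauss y).
pose B1 t := \int[mu]_y (y * sin (t * y - 0 * (y * y)) * gauss y).
pose B t := \int[mu]_y (sin (t * y - 0 * (y * y)) * gauss y).
have AB s : gauss_osc 0 0 s = A s +i* B s by exact: gauss_osc0E.
have dA (s : R) : is_derive s 1 A (- B1 s) by exact: gauss_osc_derivA.
have P (s : R) : s * A s = 2 * B1 s.
  by have := gauss_osc_parts1 0 s; rewrite mulr0 mul0r add0r.
have A0 : A 0 = Num.sqrt pi.
  rewrite /A; under eq_Rintegral do rewrite !mul0r subrr cos0 mul1r.
  by rewrite /Rintegral integralT_gauss.
have AE s : A s = Num.sqrt pi * expR (- (s ^+ 2 / 4)).
  pose K s := A s * expR (s ^+ 2 / 4).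
  have dK (r : R) : is_derive r 1 K 0.
    rewrite /K; derto; [der|dred].
    have -> : B1 r = r * A r / 2 by rewrite P; field.
    by field.
  have KE : K s = K 0 by exact: is_derive_0_is_cst.
  move: KE; rewrite /K expr0n/= mul0r expR0 mulr1 A0 => <-.
  by rewrite -mulrA -expRD subrr expR0 mulr1.
rewrite AB -AE; congr Complex.
have : B t ^+ 2 = 0.
  have := normc_gauss_osc0 0 t; rewrite jap_exp4 expr0n addr0 mulr1.
  move=> /(congr1 (fun z => z ^+ 2)); rewrite !AB exprMn !sqr_normc_ReIm /=.
  rewrite AE A0 exprMn.
  have -> : B 0 = 0.
    rewrite /B; under eq_Rintegral do rewrite !mul0r subrr sin0 mul0r.
    by rewrite Rintegral_cst// mul0r.
  rewrite expr0n addr0; lra.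
by move=> /eqP; rewrite sqrf_eq0 => /eqP.
Qed.

Lemma cvg_expRN_half : (fun k : nat => expR (- (k%:R / 2 : R))) @ \oo --> (0 : R).
Proof.
apply: (@squeeze_cvgr _ _ _ _ (fun=> 0) (fun k : nat => 2 * (k.+1%:R)^-1)).
- near=> k; rewrite expR_ge0 /= expRN.
  rewrite [leRHS](_ : _ = (k.+1%:R / 2)^-1); last by rewrite invf_div.
  rewrite lef_pV2 ?posrE ?divr_gt0 ?expR_gt0//.
  by apply: le_trans (expR_ge1Dx _); rewrite -natr1; lra.
- exact: cvg_cst.
- rewrite -[X in _ --> X](mulr0 2); apply: cvgM; first exact: cvg_cst.
  exact: cvg_harmonic.
Unshelve. all: by end_near. Qed.

Definition ramp_exp (y : R) : R := Num.max 0 y * expR (- y).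

Lemma ramp_exp_ge0 y : 0 <= ramp_exp y.
Proof. by rewrite mulr_ge0 ?expR_ge0// le_max lexx. Qed.

Lemma continuous_ramp_exp : continuous ramp_exp.
Proof.
move=> y; apply: cvgM.
  by apply: continuous_max; [exact: cvg_cst|exact: cvg_id].
by move: y; contder; der.
Qed.

(** 7 = 1 + 6: for y > 0 the exponential series gives y <= e^y and y^3 <= 6 e^y. *)
Lemma ramp_exp_le y : ramp_exp y <= 7 * (1 + y ^+ 2)^-1.
Proof.
rewrite /ramp_exp; have [y0|y0] := leP y 0.
  by rewrite mul0r mulr_ge0// invr_ge0 addr_ge0// sqr_ge0.
rewrite ler_pdivlMr ?ltr_pwDl ?sqr_ge0// mulrAC expRN ler_pdivrMr ?expR_gt0//.
have := expR_ge1Dxn 2 (ltW y0); have := expR_ge1Dx y.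
rewrite (_ : 3`!%:R = 6)//; nra.
Qed.

Lemma ramp_exp_le1 y : ramp_exp y <= 1.
Proof.
rewrite /ramp_exp; have [y0|y0] := leP y 0; first by rewrite mul0r.
rewrite expRN ler_pdivrMr ?expR_gt0// mul1r; have := expR_ge1Dx y; lra.
Qed.

Lemma integrable_ramp_exp : mu.-integrable setT (EFin \o ramp_exp).
Proof.
have [i1 _] := integral_oneDsqrV.
have i7 : mu.-integrable setT (EFin \o (fun y => 7 * (1 + y ^+ 2)^-1)).
  by have := integrableZl measurableT 7 i1.
apply: le_integrable i7 => //.
  apply/measurable_EFinP; apply: continuous_measurable_fun; exact: continuous_ramp_exp.
move=> y _ /=; rewrite lee_fin (ger0_norm (ramp_exp_ge0 y)).
exact: le_trans (ramp_exp_le y) (ler_norm _).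
Qed.

Definition ramp_hat (sg : R) : R[i] :=
  cint mu (fun y => expi (- (sg * y)) * (ramp_exp y)%:C).

Lemma cintegrable_ramp_hat sg :
  cintegrable mu (fun y => expi (- (sg * y)) * (ramp_exp y)%:C).
Proof.
apply: (cintegrable_le _ integrable_ramp_exp).
  apply: cmfunM.
    by apply: cmfun_expi; apply: continuous_measurable_fun; contder; der.
  by apply: cmfun_real; apply: continuous_measurable_fun; exact: continuous_ramp_exp.
move=> y; rewrite ComplexField.Normc.normcM normc_expi mul1r normc_real.
by rewrite ger0_norm// ramp_exp_ge0.
Qed.

(* [G] is the real part of the primitive [- (y / s + 1 / s^2) e^(- s y)],
   [s = 1 + i sg], rotated by [th]. *)
Lemma normc_ramp_hat sg : normc (ramp_hat sg) <= 2 / (1 + sg ^+ 2).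
Proof.
apply: normc_le_rot => th; rewrite -cintZl; last exact: cintegrable_ramp_hat.
pose D := 1 + sg ^+ 2; have D0 : 0 < D by rewrite ltr_pwDl ?sqr_ge0.
have D0' := lt0r_neq0 D0.
pose f y := cos (th - sg * y) * ramp_exp y.
have fi : mu.-integrable setT (EFin \o f).
  have [+ _] := cintegrableZl (expi th) (cintegrable_ramp_hat sg).
  apply: eq_integrable => // y _ /=; congr EFin; rewrite /f cosD; ring.
have -> : complex.Re (cint mu (fun y => expi th * (expi (- (sg * y)) * (ramp_exp y)%:C))) =
    \int[mu]_y f y.
  rewrite /cint /=; apply: eq_Rintegral => y _; rewrite /f cosD; ring.
have cph : continuous (fun y => cos (th - sg * y)) by contder; der.
have cf : continuous f.
  by move=> y; apply: cvgM; [exact: cph|exact: continuous_ramp_exp].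
pose g (y : R) := cos (th - sg * y) * (y * expR (- y)).
pose G (y : R) := - expR (- y) * ((y / D + (1 - sg ^+ 2) / D ^+ 2) * cos (th - sg * y) +
  (y * sg / D + 2 * sg / D ^+ 2) * sin (th - sg * y)).
have dG (y : R) : is_derive y 1 G (g y).
  rewrite /G; derto; [der|dred].
  by rewrite /g; move: D0'; rewrite /D => D0'; field.
have cg : continuous g.
  move=> y; apply: cvgM; first exact: cph.
  by apply: cvgM; [exact: cvg_id|move: y; contder; der].
have E (k : nat) : \int[mu]_(y in `[(- k%:R), k%:R]) f y = G k%:R - G 0.
  rewrite (@Rintegral_itv_split _ f (- k%:R) k%:R 0)//; last first.
    by rewrite oppr_le0 ler0n.
  rewrite (@eq_Rintegral _ _ _ mu _ (fun=> 0) f); last first.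
    move=> y; rewrite inE/= in_itv/= => /andP[_ y0].
    by rewrite /f /ramp_exp max_l// mul0r mulr0.
  rewrite Rintegral_cst// mul0r add0r (@eq_Rintegral _ _ _ mu _ g f).
    by apply: Rintegral_FTC2 => //; rewrite ler0n.
  move=> y; rewrite inE/= in_itv/= => /andP[y0 _].
  by rewrite /f /ramp_exp max_r.
(* The vector (1 - sg^2, 2 sg) has length D, so each of the two terms of - G 0 is at most 1 / D;
   adding them separately accounts for the 2. *)
have G0 : - G 0 <= 2 / D.
  rewrite /G oppr0 expR0 mulN1r opprK !mul0r !add0r mulr0 subr0.
  rewrite ler_pdivlMr// [leLHS](_ : _ =
    ((1 - sg ^+ 2) * cos th + 2 * sg * sin th) / D); last by field.
  rewrite ler_pdivrMr//; have := cos2Dsin2 th.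
  have := cos_le1 th; have := sin_le1 th; have := cos_geN1 th; have := sin_geN1 th.
  set c := cos th; set s := sin th => s1 s2 c1 c2 cs.
  have h1 : (1 - sg ^+ 2) * c <= D by rewrite /D; have := sqr_ge0 sg; nra.
  have h2 : 2 * sg * s <= D.
    rewrite /D; have := sqr_ge0 (sg - s); have : s ^+ 2 <= 1 by nra.
    nra.
  lra.
have GL : (fun k : nat => G k%:R - G 0) @ \oo --> - G 0.
  rewrite -[X in _ --> X]add0r; apply: cvgB; last exact: cvg_cst.
  apply/norm_cvg0P.
  (* Half of the exponential absorbs the linear growth of the bracket, through y e^{- y / 2} <= 2;
     the other half e^{- y / 2} still tends to 0. *)
  pose c1 := 2 / D + `|(1 - sg ^+ 2) / D ^+ 2| + 2 * `|sg / D| + `|2 * sg / D ^+ 2|.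
  apply: (@squeeze_cvgr _ _ _ _ (fun=> 0) (fun k : nat => c1 * expR (- (k%:R / 2 : R)))).
  - near=> k; rewrite normr_ge0 /=.
    set y : R := k%:R; have y0 : 0 <= y by rewrite ler0n.
    rewrite /G normrM normrN (ger0_norm (expR_ge0 _)).
    have e1 : expR (- y) = expR (- (y / 2)) * expR (- (y / 2)) by rewrite -expRD; congr expR; field.
    have e2 : expR (- (y / 2)) * y <= 2.
      rewrite expRN mulrC ler_pdivrMr ?expR_gt0//; have := expR_ge1Dx (y / 2); lra.
    have e3 : expR (- (y / 2)) <= 1 by rewrite -[leRHS]expR0 ler_expR; lra.
    have e4 := expR_ge0 (- (y / 2)).
    rewrite e1 -[leLHS]mulrA [leRHS]mulrC ler_wpM2l//.
    apply: (@le_trans _ _ (expR (- (y / 2)) * (y / D + `|(1 - sg ^+ 2) / D ^+ 2| +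
      (y * `|sg / D| + `|2 * sg / D ^+ 2|)))).
      rewrite ler_wpM2l//; apply: (le_trans (ler_normD _ _)).
      have yD : `|y / D| = y / D by rewrite ger0_norm// divr_ge0// ltW.
      have yD' : `|y * sg / D| = y * `|sg / D| by rewrite -mulrA normrM (ger0_norm y0).
      apply: lerD; rewrite normrM.
        apply: (le_trans (ler_piMr _ (cos_max _))) => //.
        by apply: (le_trans (ler_normD _ _)); rewrite yD.
      apply: (le_trans (ler_piMr _ (sin_max _))) => //.
      by apply: (le_trans (ler_normD _ _)); rewrite yD'.
    rewrite /c1; move: e2 e3 e4; set e := expR _ => e2 e3 e4.
    have D1 : 0 <= D^-1 by rewrite invr_ge0 ltW.
    have := normr_ge0 ((1 - sg ^+ 2) / D ^+ 2); have := normr_ge0 (sg / D).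
    have := normr_ge0 (2 * sg / D ^+ 2).
    set a := `|_|; set b := `|_|; set c := `|_| => a0 b0 c0.
    have h1 := ler_wpM2r D1 e2; have h2 := ler_wpM2r b0 e2.
    have h3 := ler_wpM2r a0 e3; have h4 := ler_wpM2r c0 e3.
    lra.
  - exact: cvg_cst.
  - by rewrite -[X in _ --> X](mulr0 c1); apply: cvgM; [exact: cvg_cst|exact: cvg_expRN_half].
have L := cvg_Rintegral_trunc fi.
have -> : \int[mu]_y f y = - G 0.
  apply: (cvg_unique _ L) => //.
  by rewrite (_ : (fun k : nat => _) = (fun k : nat => G k%:R - G 0)) //; apply/funext => k; exact: E.
exact: G0.
Unshelve. all: by end_near. Qed.

End integrals_on_the_line.

(** * Fourier inversion for the ramp *)

Section fourier_inversion.
Context {R : realType}.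
Notation mu := (@lebesgue_measure R).
Notation gauss := (@gauss_fun R).
Notation W := (@ramp_exp R).

Lemma Rintegral_dominated_cvg (f_ : nat -> R -> R) (f g : R -> R) :
  (forall k, measurable_fun setT (f_ k)) ->
  (forall y, f_ ^~ y @ \oo --> f y) ->
  mu.-integrable setT (EFin \o g) -> (forall k y, `|f_ k y| <= g y) ->
  (fun k => \int[mu]_y f_ k y) @ \oo --> \int[mu]_y f y.
Proof.
move=> mf ff ig fg.
have fE y : (EFin \o f_ ^~ y) @ \oo --> (f y)%:E.
  by apply/fine_cvgP; split; [exact: nearW|exact: ff].
have h : (\int[mu]_y (f_ k y)%:E)%E @[k --> \oo] --> (\int[mu]_y (f y)%:E)%E.
  apply: (@dominated_cvg _ _ _ mu setT measurableT (fun k => EFin \o f_ k) (EFin \o f)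
    (EFin \o g)).
  - by move=> k; apply/measurable_EFinP; exact: mf.
  - by move=> y _; exact: fE.
  - by [].
  - exact: ig.
  - by move=> k y _; rewrite /= lee_fin.
have mff : measurable_fun setT f by apply: (measurable_fun_cvg mf) => y _; exact: ff.
have fi : mu.-integrable setT (EFin \o f).
  apply: le_integrable ig => //.
    by apply/measurable_EFinP; exact: mff.
  move=> y _ /=; rewrite lee_fin; apply: le_trans (ler_norm _).
  have hn : (fun k => `|f_ k y|) @ \oo --> `|f y| by apply: cvg_norm; exact: ff.
  rewrite -(cvg_lim _ hn)//; apply: limr_le; first by apply/cvg_ex; eexists; exact: hn.
  by near=> k; exact: fg.
have fin : (\int[mu]_y (f y)%:E)%E \is a fin_num by exact: integrable_fin_num.
by rewrite -(fineK fin) in h; exact: (fine_cvg h).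
Unshelve. all: by end_near. Qed.

(** Measurability in the parameter is read off from Fubini, which needs an integrable majorant in
    both variables. Multiplying by 1 / (1 + sg^2) creates one, and the factor is removed
    afterwards. *)
Lemma cmfun_ramp_hat : cmfun (@ramp_hat R).
Proof.
have [i1 _] := @integral_oneDsqrV R.
pose F (z : R * R) : R[i] := ((1 + z.1 ^+ 2)^-1)%:C * (expi (- (z.1 * z.2)) * (W z.2)%:C).
have mV : measurable_fun setT (fun y : R => (1 + y ^+ 2)^-1).
  by apply: continuous_measurable_fun; exact: continuous_oneDsqrV.
have mW : measurable_fun setT W.
  by apply: continuous_measurable_fun; exact: continuous_ramp_exp.
have m1 := @measurable_fst _ _ (measurableTypeR R) (measurableTypeR R).
have m2 := @measurable_snd _ _ (measurableTypeR R) (measurableTypeR R).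
have mF : cmfun F.
  apply: cmfunM; first by apply: cmfun_real; exact: measurableT_comp mV m1.
  apply: cmfunM; last by apply: cmfun_real; exact: measurableT_comp mW m2.
  by apply: cmfun_expi; apply: measurable_funN; exact: measurable_funM.
have FB x y : normc (F (x, y)) <= (1 + x ^+ 2)^-1 * W y.
  rewrite /F !ComplexField.Normc.normcM normc_expi mul1r !normc_real.
  by rewrite !ger0_norm ?ramp_exp_ge0 ?invr_ge0 ?addr_ge0 ?sqr_ge0.
have := cintegrable_cmfun (cintegrable_cint1 i1 (@integrable_ramp_exp R) mF FB).
have -> : (fun x => cint mu (fun y => F (x, y))) =
    (fun x => ((1 + x ^+ 2)^-1)%:C * ramp_hat x).
  by apply/funext => x; rewrite -cintZl//; exact: cintegrable_ramp_hat.
have mD : cmfun (fun x : R => (1 + x ^+ 2)%:C).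
  by apply: cmfun_real; apply: continuous_measurable_fun; contder; der.
move=> /(cmfunM mD); congr cmfun; apply/funext => x.
by rewrite mulrA -rmorphM mulfV ?mul1r// lt0r_neq0// ltr_pwDl ?sqr_ge0.
Qed.

Lemma cintegrable_ramp_hatM (f : R -> R[i]) : cmfun f -> (forall y, normc (f y) <= 1) ->
  cintegrable mu (fun y => f y * ramp_hat y).
Proof.
move=> mf f1; have [i1 _] := @integral_oneDsqrV R.
have i2 : mu.-integrable setT (EFin \o (fun y => 2 * (1 + y ^+ 2)^-1)).
  by have := integrableZl measurableT 2 i1.
apply: (cintegrable_le _ i2); first by apply: cmfunM => //; exact: cmfun_ramp_hat.
move=> y; rewrite ComplexField.Normc.normcM.
apply: le_trans (normc_ramp_hat y); rewrite ler_piMl ?normc_ge0//.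
Qed.

Lemma gauss_fourier_scale (N z : R) : 0 < N ->
  cint mu (fun q => expi (z * q) * (gauss (q / N))%:C) =
  (N * (Num.sqrt pi * expR (- ((N * z) ^+ 2 / 4))))%:C.
Proof.
move=> N0; have NV : 0 < N^-1 by rewrite invr_gt0.
have N0' := lt0r_neq0 N0.
have A (h : R -> R) : continuous h -> (forall y, `|h y| <= 1) ->
    \int[mu]_q (h (z * q) * gauss (q / N)) =
    N * \int[mu]_y (h (N * z * y - 0 * (y * y)) * gauss y).
  move=> ch h1; pose f y := h (N * z * y) * gauss y.
  have chz : continuous (fun y => h (N * z * y)).
    move=> y; apply: continuous_comp; [by move: y; contder; der|exact: ch].
  have fi : mu.-integrable setT (EFin \o f).
    by apply: integrable_gaussM => //; exact: continuous_measurable_fun.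
  have cf : continuous f.
    by move=> y; apply: cvgM; [exact: chz|exact: continuous_gauss_fun].
  have [i2 E2] := integrable_affine 0 NV cf fi.
  have -> : \int[mu]_y (h (N * z * y - 0 * (y * y)) * gauss y) = \int[mu]_y f y.
    by apply: eq_Rintegral => y _; rewrite mul0r subr0.
  rewrite E2 -RintegralZl//; apply: eq_Rintegral => q _.
  rewrite /f addr0 mulrA mulfV// mul1r; congr (h _ * gauss _); last by rewrite mulrC.
  by field.
have := gauss_fourier (N * z); rewrite gauss_osc0E => -[hc hs].
rewrite /cint rmorphM /=; apply/eqP; rewrite eq_complex /=; apply/andP; split; apply/eqP.
  under eq_Rintegral do rewrite mulr0 subr0.
  by rewrite (A cos)//; [rewrite hc mul0r subr0|exact: continuous_cos|exact: cos_max].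
under eq_Rintegral do rewrite mulr0 add0r.
by rewrite (A sin)//; [rewrite hs mulr0 mul0r addr0|exact: continuous_sin|exact: sin_max].
Qed.

(** Gaussian summability. With the factor e^{- (q / N)^2}, N = k + 1, the integrals can be
    exchanged, and the result is an average of W around v at scale 1 / N. As N grows, this average
    tends to 2 pi W(v) because W is continuous and bounded by 1, where 2 pi = sqrt(pi) \int e^{- z^2
    / 4} dz; the left side converges because [ramp_hat] is integrable. *)
Lemma ramp_inversion (v : R) :
  cint mu (fun q => expi (v * q) * ramp_hat q) = (2 * pi * W v)%:C.
Proof.
pose gN (k : nat) (q : R) := gauss (q / k.+1%:R).
have mgN k : measurable_fun setT (gN k).
  apply: measurableT_comp; first exact: measurable_gauss_fun.
  by apply: continuous_measurable_fun; contder; der.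
have gN01 k q : 0 <= gN k q <= 1 by rewrite gauss_fun_ge0 gauss_fun_le1.
have mW : measurable_fun setT W.
  by apply: continuous_measurable_fun; exact: continuous_ramp_exp.
have aux1 (N z : R) : 0 < N -> N * (v - (N^-1 * z + v)) = - z.
  by move=> ?; field; exact: lt0r_neq0.
have aux2 (N a b : R) : 0 < N -> N^-1 * (a * (N * b)) = a * b.
  by move=> ?; field; exact: lt0r_neq0.
pose L k := cint mu (fun q => (expi (v * q) * (gN k q)%:C) * ramp_hat q).
have LE k : L k = (\int[mu]_z (W (k.+1%:R^-1 * z + v) * (Num.sqrt pi * expR (- (z ^+ 2 / 4)))))%:C.
  have N0 : 0 < k.+1%:R :> R by rewrite ltr0n.
  have NV : 0 < k.+1%:R^-1 :> R by rewrite invr_gt0.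
  have ig : mu.-integrable setT (EFin \o gN k).
    have [i1 _] := integral_gauss_scale NV.
    by apply: eq_integrable i1 => // q _ /=; rewrite /gN /gauss_fun exprMn mulrC.
  pose F (z : R * R) : R[i] := (expi (v * z.1) * (gN k z.1)%:C) *
    (expi (- (z.1 * z.2)) * (W z.2)%:C).
  have m1 := @measurable_fst _ _ (measurableTypeR R) (measurableTypeR R).
  have m2 := @measurable_snd _ _ (measurableTypeR R) (measurableTypeR R).
  have mF : cmfun F.
    apply: cmfunM; apply: cmfunM.
    - by apply: cmfun_expi; exact: measurable_funM.
    - by apply: cmfun_real; exact: measurableT_comp (mgN k) m1.
    - by apply: cmfun_expi; apply: measurable_funN; exact: measurable_funM.
    - by apply: cmfun_real; exact: measurableT_comp mW m2.
  have FB q y : normc (F (q, y)) <= gN k q * W y.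
    rewrite /F !ComplexField.Normc.normcM !normc_expi !mul1r !normc_real.
    by rewrite !ger0_norm ?ramp_exp_ge0//; have /andP[] := gN01 k q.
  transitivity (cint mu (fun q => cint mu (fun y => F (q, y)))).
    by apply: eq_cint => q; rewrite -cintZl//; exact: cintegrable_ramp_hat.
  rewrite (cint_fubini ig (@integrable_ramp_exp R) mF FB).
  have inner y : cint mu (fun q => F (q, y)) =
     (W y * (k.+1%:R * (Num.sqrt pi * expR (- ((k.+1%:R * (v - y)) ^+ 2 / 4)))))%:C.
    rewrite (rmorphM (real_complex R)) /= -(gauss_fourier_scale _ N0) -cintZl; last first.
      apply: (cintegrable_le _ ig).
        apply: cmfunM; last by apply: cmfun_real; exact: (mgN k).
        by apply: cmfun_expi; apply: continuous_measurable_fun; contder; der.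
      move=> q; rewrite ComplexField.Normc.normcM normc_expi mul1r normc_real.
      by rewrite ger0_norm//; have /andP[] := gN01 k q.
    apply: eq_cint => q; rewrite /F /gN /= mulrBl expiD [y * q]mulrC; ring.
  rewrite (eq_cint mu inner).
  pose f y := W y * (k.+1%:R * (Num.sqrt pi * expR (- ((k.+1%:R * (v - y)) ^+ 2 / 4)))).
  have cf : continuous f.
    move=> y; apply: cvgM; first exact: continuous_ramp_exp.
    by move: y; contder; der.
  have fi : mu.-integrable setT (EFin \o f).
    have i2 : mu.-integrable setT (EFin \o (fun y => k.+1%:R * Num.sqrt pi * W y)).
      by have := integrableZl measurableT (k.+1%:R * Num.sqrt pi) (@integrable_ramp_exp R).
    apply: le_integrable i2 => //.
      by apply/measurable_EFinP; exact: continuous_measurable_fun.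
    move=> y _ /=; rewrite lee_fin; apply: le_trans (ler_norm _).
    have W0 := ramp_exp_ge0 y; have s0 : 0 <= Num.sqrt pi :> R by exact: sqrtr_ge0.
    have e1 : expR (- ((k.+1%:R * (v - y)) ^+ 2 / 4)) <= 1.
      by rewrite -[leRHS]expR0 ler_expR oppr_le0 divr_ge0// sqr_ge0.
    have e0 := expR_ge0 (- ((k.+1%:R * (v - y)) ^+ 2 / 4)).
    rewrite /f ger0_norm; last by do 3 rewrite mulr_ge0//.
    rewrite mulrC ler_wpM2r// ler_wpM2l//.
    exact: ler_piMr.
  (* The substitution y = z / N + v moves N from the Gaussian into the argument of W, where
     dominated convergence can act. *)
  have [i3 E3] := integrable_affine v NV cf fi.
  rewrite /cint /= Rintegral_cst// mul0r complexr0 -/(f _); congr (_%:C).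
  rewrite [LHS]E3; apply: eq_Rintegral => z _; rewrite /f.
  rewrite (aux1 _ z N0) sqrrN; exact: aux2.
have p2 : 0 < 1 / 2 :> R by rewrite divr_gt0.
have [ih Eh] := integral_gauss_scale p2.
have eE z : expR (- (z ^+ 2 / 4)) = expR (- ((1 / 2) ^+ 2 * z ^+ 2)) :> R.
  by congr expR; field.
have ih' : mu.-integrable setT (EFin \o (fun z => Num.sqrt pi * expR (- (z ^+ 2 / 4)))).
  have := integrableZl measurableT (Num.sqrt pi) ih; apply: eq_integrable => // z _.
  by rewrite /= eE.
have L1 : (fun k => complex.Re (L k)) @ \oo --> 2 * pi * W v.
  have -> : 2 * pi * W v = \int[mu]_z (W v * (Num.sqrt pi * expR (- (z ^+ 2 / 4)))).
    rewrite RintegralZl//; under eq_Rintegral do rewrite eE.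
    rewrite RintegralZl// Eh -[X in 2 * X](@sqr_sqrtr R pi) ?pi_ge0//; by field.
  rewrite (_ : (fun k => _) = fun k : nat =>
     \int[mu]_z (W (k.+1%:R^-1 * z + v) * (Num.sqrt pi * expR (- (z ^+ 2 / 4))))); last first.
    by apply/funext => k; rewrite LE.
  apply: (Rintegral_dominated_cvg (g := fun z => Num.sqrt pi * expR (- (z ^+ 2 / 4)))) => //.
  - move=> k; apply: continuous_measurable_fun => z.
    have caff : continuous (fun z : R => k.+1%:R^-1 * z + v) by contder; der.
    apply: cvgM; last by move: z; contder; der.
    exact: (@continuous_comp _ _ _ _ W z (caff z) (@continuous_ramp_exp R _)).
  - move=> z; apply: cvgM; last exact: cvg_cst.
    apply: continuous_cvg; first exact: continuous_ramp_exp.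
    rewrite -[X in _ --> X]add0r; apply: cvgD; last exact: cvg_cst.
    rewrite -[X in _ --> X](mul0r z); apply: cvgM; last exact: cvg_cst.
    exact: cvg_harmonic.
  - move=> k z; rewrite normrM (ger0_norm (ramp_exp_ge0 _)).
    rewrite [`|_ * expR _|]ger0_norm ?mulr_ge0 ?sqrtr_ge0 ?expR_ge0//.
    by rewrite ler_piMl ?mulr_ge0 ?sqrtr_ge0 ?expR_ge0// ramp_exp_le1.
have mexpi : cmfun (fun q => expi (v * q)).
  by apply: cmfun_expi; apply: continuous_measurable_fun; contder; der.
have n1 y : normc (expi (v * y)) <= 1 by rewrite normc_expi.
have i0 := cintegrable_ramp_hatM mexpi n1.
have gNlim (q : R) : gN ^~ q @ \oo --> (1 : R).
  rewrite -[X in _ --> X]expR0 /gN /gauss_fun; apply: continuous_cvg.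
    exact: continuous_expR.
  rewrite -[X in _ --> X]oppr0; apply: cvgN.
  rewrite (_ : (fun k : nat => _) = fun k : nat => q ^+ 2 * (k.+1%:R^-1 * k.+1%:R^-1)); last first.
    by apply/funext => k; rewrite exprMn [k.+1%:R^-1 ^+ 2]expr2.
  rewrite -[X in _ --> X](mulr0 (q ^+ 2)); apply: cvgM; first exact: cvg_cst.
  rewrite -[X in _ --> X](mulr0 0); apply: cvgM; exact: cvg_harmonic.
have lim (f : R -> R) : mu.-integrable setT (EFin \o f) ->
    (fun k => \int[mu]_q (f q * gN k q)) @ \oo --> \int[mu]_q f q.
  move=> fi; have /measurable_int/measurable_EFinP mf := fi.
  apply: (Rintegral_dominated_cvg (g := fun q => `|f q|)) => //.
  - by move=> k; apply: measurable_funM => //; exact: mgN.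
  - move=> q; rewrite -[X in _ --> X]mulr1; apply: cvgM; first exact: cvg_cst.
    exact: gNlim.
  - exact: integrable_norm.
  - move=> k q; rewrite normrM ler_piMr//; have /andP[h1 h2] := gN01 k q.
    by rewrite ger0_norm.
have [iR iI] := i0.
apply/eqP; rewrite eq_complex; apply/andP; split; apply/eqP.
  have h := lim _ iR; apply: (cvg_unique _ h) => //.
  rewrite (_ : (fun k => _) = fun k => complex.Re (L k)) //.
  apply/funext => k; rewrite /L /=; apply: eq_Rintegral => q _.
  by case: (ramp_hat q) => a b /=; ring.
have h := lim _ iI; apply: (cvg_unique _ h) => //.
have ImL k : complex.Im (L k) = 0 by rewrite LE.
rewrite (_ : (fun k : nat => _) = fun=> 0); first exact: cvg_cst.
apply/funext => k; rewrite -(ImL k) /L /=; apply: eq_Rintegral => q _.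
by case: (ramp_hat q) => a b /=; ring.
Qed.

End fourier_inversion.

(** * Subordination of the half-wave to Schroedinger phases *)

Section subordination.
Context {R : realType}.
Notation mu := (@lebesgue_measure R).
Notation gauss := (@gauss_fun R).
Notation W := (@ramp_exp R).

Definition wave_transform (k : nat) (t u : R) : R[i] :=
  cint mu (fun sg => expi (u * sg) * (ramp_hat sg * gauss_osc k sg t)).

Lemma integrable_gauss_moment (k : nat) : (k <= 1)%N ->
  mu.-integrable setT (EFin \o (fun y => `|y ^+ k * gauss y|)).
Proof.
have m1 : measurable_fun setT (fun _ : R => 1 : R) by exact: measurable_cst.
have n1 (y : R) : `|1 : R| <= 1 by rewrite normr1.
case: k => [|[|]]// _.
  apply: eq_integrable (integrable_norm (integrable_gaussM m1 n1)) => // y _; rewrite /= expr0.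
apply: eq_integrable (integrable_norm (integrable_gaussXM m1 n1)) => // y _ /=.
by rewrite ?expr1 ?mulr1.
Qed.

(** Once the integrals are exchanged, the sg-integral at fixed y is the inversion formula at v = u -
    y^2. The ramp brings e^{- (u - y^2)}, which times the Gaussian leaves just e^{- u}. *)
Lemma wave_transform_ramp (k : nat) (t u : R) : (k <= 1)%N ->
  wave_transform k t u =
  cint mu (fun y => expi (t * y) * (2 * pi * (expR (- u) *
    (Num.max 0 (u - y ^+ 2) * y ^+ k)))%:C).
Proof.
move=> k1; have ig := integrable_gauss_moment k1.
have [i1 _] := @integral_oneDsqrV R.
have i2 : mu.-integrable setT (EFin \o (fun y => 2 * (1 + y ^+ 2)^-1)).
  by have := integrableZl measurableT 2 i1.
pose F (z : R * R) : R[i] := (expi (u * z.1) * ramp_hat z.1) *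
  (expi (t * z.2 - z.1 * (z.2 * z.2)) * (z.2 ^+ k * gauss z.2)%:C).
have m1 := @measurable_fst _ _ (measurableTypeR R) (measurableTypeR R).
have m2 := @measurable_snd _ _ (measurableTypeR R) (measurableTypeR R).
have mg : measurable_fun setT (fun y : R => y ^+ k * gauss y).
  by apply: measurable_funM; [exact: measurable_funX|exact: measurable_gauss_fun].
have mF : cmfun F.
  apply: cmfunM.
    apply: cmfunM; first by apply: cmfun_expi; exact: measurable_funM.
    have [h1 h2] := @cmfun_ramp_hat R.
    by split; [exact: measurableT_comp h1 m1|exact: measurableT_comp h2 m1].
  apply: cmfunM; last by apply: cmfun_real; exact: measurableT_comp mg m2.
  apply: cmfun_expi; apply: measurable_funB; first exact: measurable_funM.
  by apply: measurable_funM => //; exact: measurable_funM.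
have FB sg y : normc (F (sg, y)) <= 2 * (1 + sg ^+ 2)^-1 * `|y ^+ k * gauss y|.
  rewrite /F !ComplexField.Normc.normcM !normc_expi !mul1r normc_real.
  by rewrite ler_wpM2r//; exact: normc_ramp_hat.
have mexp sg : cmfun (fun y : R => expi (t * y - sg * (y * y))).
  by apply: cmfun_expi; apply: continuous_measurable_fun; contder; der.
have igc sg : cintegrable mu (fun y => expi (t * y - sg * (y * y)) * (y ^+ k * gauss y)%:C).
  apply: (cintegrable_le _ ig).
    by apply: cmfunM; [exact: mexp|exact: cmfun_real].
  by move=> y; rewrite ComplexField.Normc.normcM normc_expi mul1r normc_real.
transitivity (cint mu (fun sg => cint mu (fun y => F (sg, y)))).
  by apply: eq_cint => sg; rewrite mulrA -cintZl.
rewrite (cint_fubini i2 ig mF FB); apply: eq_cint => y.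
have n1 (v q : R) : normc (expi (v * q)) <= 1 by rewrite normc_expi.
have mv (v : R) : cmfun (fun q => expi (v * q)).
  by apply: cmfun_expi; apply: continuous_measurable_fun; contder; der.
transitivity (cint mu (fun q => (expi (t * y) * (y ^+ k * gauss y)%:C) *
    (expi ((u - y ^+ 2) * q) * ramp_hat q))).
  apply: eq_cint => q; rewrite /F /=.
  have -> : expi (t * y - q * (y * y)) = expi (t * y) * expi (- (y ^+ 2 * q)).
    by rewrite -expiD; congr expi; ring.
  by rewrite mulrBl expiD; ring.
rewrite cintZl; last exact: cintegrable_ramp_hatM.
rewrite ramp_inversion -mulrA -rmorphM; congr (_ * _).
have -> // : y ^+ k * gauss y * (2 * pi * W (u - y ^+ 2)) =
  2 * pi * (expR (- u) * (Num.max 0 (u - y ^+ 2) * y ^+ k)).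
rewrite /ramp_exp /gauss_fun.
have -> : expR (- u) = expR (- y ^+ 2) * expR (- (u - y ^+ 2)).
  by rewrite -expRD; congr expR; ring.
by ring.
Qed.

Variables (t r : R).
Hypotheses (t0 : t != 0) (r0 : 0 < r).

Let max_cut (f : R -> R) : \int[mu]_y (f y * Num.max 0 (r ^+ 2 - y ^+ 2)) =
  \int[mu]_(y in `[(- r), r]) (f y * (r ^+ 2 - y ^+ 2)).
Proof.
rewrite -(Rintegral_indicM `[(- r), r]%classic); apply: eq_Rintegral => y _.
rewrite indicE; have [yr|yr] := boolP (y \in _).
  move: yr; rewrite inE/= in_itv/= => /andP[h1 h2].
  by rewrite mul1r max_r//; nra.
rewrite mul0r max_l ?mulr0//.
have : ~ (- r <= y <= r) by move=> h; move/negP: yr; apply; rewrite inE/= in_itv.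
move=> /negP; rewrite -ler_norml -ltNge => h.
by rewrite subr_le0 -[leRHS]real_normK ?num_real// ler_sqr ?nnegrE ?(ltW r0)// ltW.
Qed.

Let rr : - r <= r. Proof. by rewrite ge0_cp// ltW. Qed.

(** On [-r, r] the integrand is a polynomial times a sine or cosine; the primitives [F] come from
    repeated integration by parts. Parity makes one component vanish, the imaginary one here and the
    real one for k = 1. *)
Lemma wave_transform0 : wave_transform 0 t (r ^+ 2) =
  (2 * pi * expR (- r ^+ 2) * (4 / t ^+ 2 * (sin (t * r) / t - r * cos (t * r))))%:C.
Proof.
rewrite wave_transform_ramp// /cint; congr Complex.
  have -> : \int[mu]_y complex.Re (expi (t * y) * (2 * pi * (expR (- r ^+ 2) *
      (Num.max 0 (r ^+ 2 - y ^+ 2) * y ^+ 0)))%:C) =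
     \int[mu]_y ((2 * pi * expR (- r ^+ 2) * cos (t * y)) * Num.max 0 (r ^+ 2 - y ^+ 2)).
    by apply: eq_Rintegral => y _ /=; rewrite expr0; ring.
  rewrite max_cut.
  pose F := (fun y => 2 * pi * expR (- r ^+ 2) *
    ((r ^+ 2 - y ^+ 2) * sin (t * y) / t - 2 * y * cos (t * y) / t ^+ 2 +
      2 * sin (t * y) / t ^+ 3)).
  transitivity (F r - F (- r)); last by rewrite /F sqrrN mulrN sinN cosN; field.
  notypeclasses refine (@Rintegral_FTC2 _ F _ (- r) r rr _ _); last by contder; der.
  by rewrite /F => y; derto; [der|dred; field].
have -> : \int[mu]_y complex.Im (expi (t * y) * (2 * pi * (expR (- r ^+ 2) *
      (Num.max 0 (r ^+ 2 - y ^+ 2) * y ^+ 0)))%:C) =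
     \int[mu]_y ((2 * pi * expR (- r ^+ 2) * sin (t * y)) * Num.max 0 (r ^+ 2 - y ^+ 2)).
  by apply: eq_Rintegral => y _ /=; rewrite expr0; ring.
rewrite max_cut.
pose F := (fun y => 2 * pi * expR (- r ^+ 2) *
    (- (r ^+ 2 - y ^+ 2) * cos (t * y) / t - 2 * y * sin (t * y) / t ^+ 2 -
      2 * cos (t * y) / t ^+ 3)).
transitivity (F r - F (- r)); last by rewrite /F sqrrN mulrN sinN cosN; field.
notypeclasses refine (@Rintegral_FTC2 _ F _ (- r) r rr _ _); last by contder; der.
by rewrite /F => y; derto; [der|dred; field].
Qed.

Lemma wave_transform1 : wave_transform 1 t (r ^+ 2) =
  Complex 0 (2 * pi * expR (- r ^+ 2) * (12 / t ^+ 3 * (sin (t * r) / t - r * cos (t * r))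
    - 4 * r ^+ 2 * sin (t * r) / t ^+ 2)).
Proof.
rewrite wave_transform_ramp// /cint; congr Complex.
  have -> : \int[mu]_y complex.Re (expi (t * y) * (2 * pi * (expR (- r ^+ 2) *
      (Num.max 0 (r ^+ 2 - y ^+ 2) * y ^+ 1)))%:C) =
     \int[mu]_y ((2 * pi * expR (- r ^+ 2) * (y * cos (t * y))) * Num.max 0 (r ^+ 2 - y ^+ 2)).
    by apply: eq_Rintegral => y _ /=; rewrite expr1; ring.
  rewrite max_cut.
  pose F := (fun y => 2 * pi * expR (- r ^+ 2) *
    ((y * r ^+ 2 - y ^+ 3) * sin (t * y) / t + (r ^+ 2 - 3 * y ^+ 2) * cos (t * y) / t ^+ 2
      + 6 * y * sin (t * y) / t ^+ 3 + 6 * cos (t * y) / t ^+ 4)).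
  transitivity (F r - F (- r)); last by rewrite /F mulrN sinN cosN; field.
  notypeclasses refine (@Rintegral_FTC2 _ F _ (- r) r rr _ _); last by contder; der.
  by rewrite /F => y; derto; [der|dred; field].
have -> : \int[mu]_y complex.Im (expi (t * y) * (2 * pi * (expR (- r ^+ 2) *
      (Num.max 0 (r ^+ 2 - y ^+ 2) * y ^+ 1)))%:C) =
     \int[mu]_y ((2 * pi * expR (- r ^+ 2) * (y * sin (t * y))) * Num.max 0 (r ^+ 2 - y ^+ 2)).
  by apply: eq_Rintegral => y _ /=; rewrite expr1; ring.
rewrite max_cut.
pose F := (fun y => 2 * pi * expR (- r ^+ 2) *
    (- (y * r ^+ 2 - y ^+ 3) * cos (t * y) / t + (r ^+ 2 - 3 * y ^+ 2) * sin (t * y) / t ^+ 2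
      - 6 * y * cos (t * y) / t ^+ 3 + 6 * sin (t * y) / t ^+ 4)).
transitivity (F r - F (- r)); last by rewrite /F mulrN sinN cosN; field.
notypeclasses refine (@Rintegral_FTC2 _ F _ (- r) r rr _ _); last by contder; der.
by rewrite /F => y; derto; [der|dred; field].
Qed.

(* [wave_transform0] and [wave_transform1], solved for [sin (t * r)] and
   [cos (t * r)]. *)
Lemma half_wave_subordination : expi (t * r) = (expR (r ^+ 2) / (2 * pi))%:C *
  ((3 / 4 / r ^+ 3)%:C * wave_transform 0 t (r ^+ 2) +
   (Complex 0 (t / 4 / r ^+ 3)) * wave_transform 1 t (r ^+ 2) +
   (Complex 0 (3 * t / 4 / r ^+ 2)) * wave_transform 0 t (r ^+ 2) -
   (t ^+ 2 / 4 / r ^+ 2)%:C * wave_transform 1 t (r ^+ 2) -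
   (t ^+ 2 / 4 / r)%:C * wave_transform 0 t (r ^+ 2)).
Proof.
rewrite wave_transform0 wave_transform1 expRN.
have r0' := lt0r_neq0 r0; have p0 := lt0r_neq0 (pi_gt0 R).
have e0 := lt0r_neq0 (expR_gt0 (r ^+ 2)).
move: p0; move: (pi : R) => P p0.
apply/eqP; rewrite eq_complex /=; apply/andP; split; apply/eqP.
  by field; rewrite t0 e0 r0' p0.
by field; rewrite t0 e0 r0' p0.
Qed.

End subordination.

(** * Decay of the weights of the superposition *)

Section transform_bounds.
Context {R : realType}.
Notation mu := (@lebesgue_measure R).
Implicit Types (sg t : R).

Definition wave_weight (k : nat) t sg : R[i] := ramp_hat sg * gauss_osc k sg t.

Lemma cmfun_gauss_osc (k : nat) t : (k <= 1)%N -> cmfun (fun sg => gauss_osc k sg t).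
Proof.
move=> k1; have ig := integrable_gauss_moment k1 (R := R).
have [i1 _] := @integral_oneDsqrV R.
have mg : measurable_fun setT (fun y : R => y ^+ k * gauss_fun y).
  by apply: measurable_funM; [exact: measurable_funX|exact: measurable_gauss_fun].
pose F (z : R * R) : R[i] := ((1 + z.1 ^+ 2)^-1)%:C *
  (expi (t * z.2 - z.1 * (z.2 * z.2)) * (z.2 ^+ k * gauss_fun z.2)%:C).
have mV : measurable_fun setT (fun y : R => (1 + y ^+ 2)^-1).
  by apply: continuous_measurable_fun; exact: continuous_oneDsqrV.
have m1 := @measurable_fst _ _ (measurableTypeR R) (measurableTypeR R).
have m2 := @measurable_snd _ _ (measurableTypeR R) (measurableTypeR R).
have mF : cmfun F.
  apply: cmfunM; first by apply: cmfun_real; exact: measurableT_comp mV m1.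
  apply: cmfunM; last by apply: cmfun_real; exact: measurableT_comp mg m2.
  apply: cmfun_expi; apply: measurable_funB; first exact: measurable_funM.
  by apply: measurable_funM => //; exact: measurable_funM.
have FB x y : normc (F (x, y)) <= (1 + x ^+ 2)^-1 * `|y ^+ k * gauss_fun y|.
  rewrite /F !ComplexField.Normc.normcM normc_expi mul1r !normc_real.
  by rewrite [`|_^-1|]ger0_norm ?invr_ge0 ?addr_ge0 ?sqr_ge0.
have := cintegrable_cmfun (cintegrable_cint1 i1 ig mF FB).
have -> : (fun x => cint mu (fun y => F (x, y))) =
    (fun x => ((1 + x ^+ 2)^-1)%:C * gauss_osc k x t).
  apply/funext => x; rewrite -cintZl//.
  apply: (cintegrable_le _ ig).
    apply: cmfunM; last exact: cmfun_real.
    by apply: cmfun_expi; apply: continuous_measurable_fun; contder; der.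
  by move=> y; rewrite ComplexField.Normc.normcM normc_expi mul1r normc_real.
have mD : cmfun (fun x : R => (1 + x ^+ 2)%:C).
  by apply: cmfun_real; apply: continuous_measurable_fun; contder; der.
move=> /(cmfunM mD); congr cmfun; apply/funext => x.
by rewrite mulrA -rmorphM mulfV ?mul1r// lt0r_neq0// ltr_pwDl ?sqr_ge0.
Qed.

Lemma cmfun_wave_weight k t : (k <= 1)%N -> cmfun (wave_weight k t).
Proof. by move=> k1; apply: cmfunM; [exact: cmfun_ramp_hat|exact: cmfun_gauss_osc]. Qed.

(** e^y is the N-th power of e^{y / N} >= 1 + y / N, and 1 + 4 y <= 4 N (1 + y / N). *)
Lemma expR_dominates_pow (N : nat) (y : R) : (0 < N)%N -> 0 <= y ->
  (1 + 4 * y) ^+ N <= (4 * N%:R) ^+ N * expR y.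
Proof.
move=> N0 y0; have NR : 1 <= N%:R :> R by rewrite ler1n.
have -> : expR y = expR (y / N%:R) ^+ N.
  by rewrite -expRM_natl mulrCA mulfV ?mulr1// lt0r_neq0// (lt_le_trans _ NR).
rewrite -exprMn; apply: lerXn2r; rewrite ?nnegrE.
- by rewrite addr_ge0// mulr_ge0.
- by rewrite mulr_ge0 ?expR_ge0// mulr_ge0.
apply: (@le_trans _ _ (4 * N%:R * (1 + y / N%:R))); last first.
  by rewrite ler_wpM2l ?mulr_ge0//; exact: expR_ge1Dx.
rewrite mulrDr mulr1 [X in _ <= _ + X](_ : _ = 4 * y); last first.
  by field; rewrite lt0r_neq0// (lt_le_trans _ NR).
by rewrite lerD2r; lra.
Qed.

(** The Gaussian factor upgrades 1 + sg^2 to T^2 + sg^2 in any power of the bracket. With y = T^2 /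
    (4 j^4) one has (w / j)^4 = (T^2 + sg^2) / (1 + sg^2) <= 1 + 4 y, and e^y dominates every power
    of 1 + 4 y. *)
Lemma jap_exp_decay (N : nat) (T sg : R) : (0 < N)%N -> 0 < T ->
  jap sg ^- N * expR (- (T ^+ 2 / (4 * jap sg ^+ 4))) <=
  (4 * N%:R) ^+ N * Num.sqrt (Num.sqrt (T ^+ 2 + sg ^+ 2)) ^- N.
Proof.
move=> N0 T0; set w := Num.sqrt (Num.sqrt _); set j := jap sg.
have j0 : 0 < j := jap_gt0 sg.
have Ts0 : 0 < T ^+ 2 + sg ^+ 2 by rewrite ltr_pwDl ?sqr_ge0// exprn_gt0.
have w0 : 0 < w by rewrite !sqrtr_gt0.
have w4 : w ^+ 4 = T ^+ 2 + sg ^+ 2.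
  by rewrite (exprM _ 2 2) !sqr_sqrtr// ?sqrtr_ge0// ltW.
have j4 : j ^+ 4 = 1 + sg ^+ 2 by exact: jap_exp4.
pose y := T ^+ 2 / (4 * j ^+ 4).
have y0 : 0 <= y by rewrite divr_ge0 ?sqr_ge0// mulr_ge0// exprn_ge0// ltW.
have xy : w / j <= 1 + 4 * y.
  have x4 : (w / j) ^+ 4 <= 1 + 4 * y.
    rewrite expr_div_n w4 ler_pdivrMr ?exprn_gt0//.
    rewrite mulrDl mul1r (_ : 4 * y * j ^+ 4 = T ^+ 2); last first.
      by rewrite /y; field; exact: lt0r_neq0.
    by rewrite addrC lerD2r j4; lra.
  have [x1|x1] := leP (w / j) 1; first by apply: (le_trans x1); lra.
  apply: le_trans x4; rewrite exprS ler_peMr ?(ltW (lt_trans ltr01 x1))//.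
  by rewrite exprn_ege1// ltW.
have x0 : 0 < w / j by rewrite divr_gt0.
have h := expR_dominates_pow N0 y0.
have h2 : (w / j) ^+ N <= (1 + 4 * y) ^+ N.
  by apply: lerXn2r; rewrite ?nnegrE ?(ltW x0)// addr_ge0// mulr_ge0.
have {h h2} := le_trans h2 h.
rewrite expr_div_n expRN -/y => h.
rewrite ler_pdivlMr ?exprn_gt0// mulrAC ler_pdivrMr ?expR_gt0//.
by rewrite mulrC.
Qed.

Lemma wave_weight_le (n k : nat) : (k <= 1)%N -> exists2 C : R, 0 <= C &
  forall t sg, t != 0 ->
  normc (wave_weight k t sg) / jap sg ^+ n <=
  C / Num.sqrt `|t| ^+ n.+1 / (`|t| ^+ 2 + sg ^+ 2).
Proof.
(* N counts the powers of [1 / jap sg]: n from the kernel, 4 from [ramp_hat], 1 + 2 k from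
   [gauss_osc k]; and 64 = 2 * 32. After [jap_exp_decay], four of the N powers of 1 / w make 1 /
   (T^2 + sg^2), 2 k cancel the factor T^k, and the n + 1 left are bounded through w >= sqrt T. *)
move=> k1; pose N := (n + 5 + 2 * k)%N; have N0 : (0 < N)%N by rewrite /N !addn_gt0 orbT.
exists (64 * (4 * N%:R) ^+ N); first by rewrite mulr_ge0// exprn_ge0// mulr_ge0.
move=> t sg t0; set T := `|t|; have T0 : 0 < T by rewrite normr_gt0.
have := jap_exp_decay sg N0 T0.
set w := Num.sqrt (Num.sqrt _); set j := jap sg; set e := expR _ => jd.
have j0 : 0 < j := jap_gt0 sg.
have Ts0 : 0 < T ^+ 2 + sg ^+ 2 by rewrite ltr_pwDl ?sqr_ge0// exprn_gt0.
have w0 : 0 < w by rewrite !sqrtr_gt0.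
have w4 : w ^+ 4 = T ^+ 2 + sg ^+ 2.
  by rewrite (exprM _ 2 2) !sqr_sqrtr// ?sqrtr_ge0// ltW.
set s := Num.sqrt T; have s0 : 0 < s by rewrite sqrtr_gt0.
have s2 : s ^+ 2 = T by rewrite sqr_sqrtr// ltW.
have sw : s <= w.
  rewrite -(@ler_pXn2r _ 4)// ?nnegrE ?(ltW s0) ?(ltW w0)// w4 (exprM _ 2 2) s2.
  by rewrite lerDl sqr_ge0.
have hat : normc (ramp_hat sg) <= 2 / j ^+ 4 by rewrite jap_exp4; exact: normc_ramp_hat.
have e0 : 0 <= e by exact: expR_ge0.
have osc : normc (gauss_osc k sg t) <= 32 / j * e * (T / (2 * j ^+ 2)) ^+ k.
  have o0 : normc (gauss_osc 0 sg t) <= 32 / j * e.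
    rewrite normc_gauss_osc0 /e /T real_normK ?num_real//.
    by rewrite ler_wpM2r//; exact: normc_gauss_osc00_le.
  case: k k1 {N N0 jd} => [|[|]]// _; first by rewrite expr0 mulr1.
  rewrite expr1 normc_gauss_osc1 mulrC ler_wpM2r// divr_ge0 ?normr_ge0//.
  by rewrite mulr_ge0// exprn_ge0// ltW.
have prod : normc (wave_weight k t sg) / j ^+ n <= 64 * T ^+ k * (j ^- N * e).
  rewrite /wave_weight ComplexField.Normc.normcM ler_pdivrMr ?exprn_gt0//.
  apply: (le_trans (ler_pM (normc_ge0 _) (normc_ge0 _) hat osc)).
  have j0' := lt0r_neq0 j0.
  have NE : j ^+ N = j ^+ n * j ^+ 5 * (j ^+ 2) ^+ k by rewrite /N exprD exprD exprM.
  have jk0 : 0 < (j ^+ 2) ^+ k by rewrite !exprn_gt0.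
  have jn0 : 0 < j ^+ n by rewrite exprn_gt0.
  have Tk0 : 0 < T ^+ k by rewrite exprn_gt0.
  have k20 : 1 <= 2 ^+ k :> R by rewrite exprn_ege1// ler1n.
  rewrite expr_div_n exprMn NE; move: jk0 jn0 Tk0 k20.
  move: ((j ^+ 2) ^+ k) (j ^+ n) (T ^+ k) (2 ^+ k) => J jn Tk k2 J0 jn0 Tk0 k21.
  have k20 : 0 < k2 := lt_le_trans ltr01 k21.
  rewrite [leLHS](_ : _ = 64 * Tk * ((jn * j ^+ 5 * J)^-1 * e) * jn * k2^-1); last first.
    by field; rewrite !lt0r_neq0.
  rewrite ler_piMr ?invf_le1//.
  apply: mulr_ge0 (ltW jn0); apply: mulr_ge0; first by rewrite mulr_ge0// ltW.
  by rewrite mulr_ge0// invr_ge0 !mulr_ge0 ?exprn_ge0 ?ltW.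
apply: (le_trans prod).
apply: (@le_trans _ _ (64 * T ^+ k * ((4 * N%:R) ^+ N * w ^- N))).
  by rewrite ler_wpM2l// mulr_ge0// exprn_ge0// ltW.
have w0' := lt0r_neq0 w0; have s0' := lt0r_neq0 s0.
have -> : 64 * T ^+ k * ((4 * N%:R) ^+ N * w ^- N) =
    64 * (4 * N%:R) ^+ N * (w ^- n.+1 / w ^+ 4) * (s ^+ (2 * k) / w ^+ (2 * k)).
  rewrite exprM s2 (_ : w ^+ N = w ^+ n.+1 * w ^+ 4 * w ^+ (2 * k)).
    have h1 : w ^+ n.+1 != 0 by rewrite expf_neq0.
    have h2 : w ^+ (2 * k) != 0 by rewrite expf_neq0.
    move: h1 h2; move: (w ^+ n.+1) (w ^+ (2 * k)) ((4 * N%:R) ^+ N) (T ^+ k) => *.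
    by field; apply/and3P.
  by rewrite -!exprD; congr (_ ^+ _); rewrite /N addSnnS.
rewrite -w4 -[leRHS]mulrA -[leRHS]mulr1; apply: ler_pM.
- by rewrite !mulr_ge0 ?invr_ge0 ?exprn_ge0 ?mulr_ge0 ?(ltW w0).
- by rewrite divr_ge0// exprn_ge0// ltW.
- rewrite ler_wpM2l ?mulr_ge0 ?exprn_ge0 ?mulr_ge0//.
  rewrite ler_wpM2r ?invr_ge0 ?exprn_ge0 ?(ltW w0)//.
  by rewrite lef_pV2 ?posrE ?exprn_gt0// lerXn2r ?nnegrE ?(ltW s0) ?(ltW w0).
by rewrite ler_pdivrMr ?exprn_gt0// mul1r lerXn2r ?nnegrE ?(ltW s0) ?(ltW w0).
Qed.

(** The integral of 1 / (T^2 + sg^2) is pi / T, which adds two powers of sqrt T to the n + 1 of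
    [wave_weight_le]. *)
Lemma integral_wave_weight (n k : nat) : (k <= 1)%N -> exists2 C : R, 0 <= C &
  forall t, t != 0 ->
  mu.-integrable setT (EFin \o (fun sg => normc (wave_weight k t sg) / jap sg ^+ n)) /\
  \int[mu]_sg (normc (wave_weight k t sg) / jap sg ^+ n) <=
    C / Num.sqrt `|t| ^+ n.+3.
Proof.
move=> k1; have [C C0 CB] := wave_weight_le n k1.
exists (C * pi); first by rewrite mulr_ge0// pi_ge0.
move=> t t0; set T := `|t|; have T0 : 0 < T by rewrite normr_gt0.
have [i1 E1] := integral_sqrDsqrV T0.
have i2 : mu.-integrable setT
    (EFin \o (fun sg => C / Num.sqrt T ^+ n.+1 * (T ^+ 2 + sg ^+ 2)^-1)).
  by have := integrableZl measurableT (C / Num.sqrt T ^+ n.+1) i1.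
have mj : measurable_fun setT (fun sg : R => (jap sg ^+ n)^-1).
  rewrite (_ : (fun sg : R => _) = fun sg => (jap sg ^+ n) `^ (-1)); last first.
    by apply/funext => sg; rewrite powR_inv1// exprn_ge0// ltW// jap_gt0.
  apply: measurableT_comp (@measurable_powR R (-1)) _.
  apply: measurable_funX; do 2 (apply: measurableT_comp;
    [by apply: continuous_measurable_fun; exact: sqrt_continuous|]).
  by apply: continuous_measurable_fun; contder; der.
have i3 : mu.-integrable setT (EFin \o (fun sg => normc (wave_weight k t sg) / jap sg ^+ n)).
  apply: le_integrable i2 => //.
    apply/measurable_EFinP; apply: measurable_funM => //.
    by apply: measurable_normc; exact: cmfun_wave_weight.
  move=> sg _ /=; rewrite lee_fin; apply: le_trans (ler_norm _).
  rewrite ger0_norm; first exact: CB.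
  by rewrite divr_ge0 ?normc_ge0// exprn_ge0// ltW// jap_gt0.
split => //; apply: (le_trans (le_Rintegral measurableT i3 i2 (fun sg _ => CB t sg t0))).
rewrite RintegralZl// E1 le_eqVlt; apply/orP; left; apply/eqP.
have s0 : 0 < Num.sqrt T by rewrite sqrtr_gt0.
have s2 : Num.sqrt T ^+ 2 = T by rewrite sqr_sqrtr// ltW.
have -> : Num.sqrt T ^+ n.+3 = Num.sqrt T ^+ n.+1 * T.
  by rewrite -[X in _ = _ * X]s2 -exprD addn2.
by field; rewrite expf_neq0 ?lt0r_neq0.
Qed.

End transform_bounds.

(** * Dispersive estimate for the half-wave *)

Section half_wave_kernel.
Context {R : realType} {n : nat}.
Notation mu := (@lebesgue_measure R).
Notation nu := (lebesgue_cV R n).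
Implicit Types (b : 'cV[R]_n -> R) (x xi : 'cV[R]_n) (t : R).

Lemma good_amp_ge0 d B b : @good_amp R n d B b -> 0 <= B.
Proof.
case=> _ _ _ /(_ 0 0 0); rewrite lerN10 => /(_ isT) h.
have := le_trans (normc_ge0 _) h.
rewrite oppr0 mul0r expR0 mulr1 pmulr_lge0// invr_gt0 exprn_gt0//.
exact: jap_gt0.
Qed.

Definition wave_integrand (k : nat) t x b xi : R[i] :=
  expi (dotv x xi) * (wave_transform k t (dotv xi xi) * (expR (dotv xi xi) * b xi)%:C).

Lemma integrable_wave_weight (k : nat) t : (k <= 1)%N -> t != 0 ->
  mu.-integrable setT (EFin \o (fun sg => normc (wave_weight k t sg))).
Proof.
move=> k1 t0; have [C _ /(_ t t0) [+ _]] := @integral_wave_weight R 0 k k1.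
by apply: eq_integrable => // sg _ /=; rewrite expr0 divr1.
Qed.

(** The factor e^{|xi|^2} is the weight be = -1 of [good_amp]. After the exchange of integrals, the
    kernel at fixed sg is at most [B e^{d^2} / jap sg ^+ n], which is then integrated against the
    weights. *)
Lemma wave_integrand_le (k : nat) : (k <= 1)%N -> exists2 C : R, 0 <= C &
  forall d B b x t, t != 0 -> good_amp d B b ->
  cintegrable nu (wave_integrand k t x b) /\
  normc (cint nu (wave_integrand k t x b)) <=
    B * expR (d ^+ 2) * C / Num.sqrt `|t| ^+ n.+3.
Proof.
move=> k1; have [C C0 CB] := @integral_wave_weight R n k k1.
exists C => // d B b x t t0 gb.
have [iw Bw] := CB t t0; have iw0 := integrable_wave_weight k1 t0.
have mw := cmfun_wave_weight t k1.
have [mb _ _ bB] := gb; have [M M0 bM] := good_amp_box gb.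
have B0 := good_amp_ge0 gb.
pose F (z : R * 'cV[R]_n) : R[i] := wave_weight k t z.1 * osc_amp (-1) x z.1 b z.2.
have m2 := @measurable_snd _ _ (measurableTypeR R) 'cV[R]_n.
have m1 := @measurable_fst _ _ (measurableTypeR R) 'cV[R]_n.
have mD := measurableT_comp measurable_dotvv m2.
have mF : cmfun F.
  apply: cmfunM.
    have [w1 w2] := mw.
    by split; [exact: measurableT_comp w1 m1|exact: measurableT_comp w2 m1].
  apply: cmfunM.
    apply: cmfun_expi; apply: measurable_funD.
      exact: measurableT_comp (measurable_dotv x) m2.
    exact: measurable_funM.
  apply: cmfun_real; apply: measurable_funM; last exact: measurableT_comp mb m2.
  by apply: measurableT_comp => //; exact: measurable_funM.
have oB sg xi : normc (osc_amp (-1) x sg b xi) <= M * box_fun xi.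
  rewrite /osc_amp ComplexField.Normc.normcM normc_expi mul1r normc_real.
  exact: bM.
have FB sg xi : normc (F (sg, xi)) <= normc (wave_weight k t sg) * (M * box_fun xi).
  by rewrite /F ComplexField.Normc.normcM ler_wpM2l ?normc_ge0.
have iM : nu.-integrable setT (EFin \o (fun xi => M * box_fun xi)).
  by have := integrableZl measurableT M integrable_box_fun.
have E : wave_integrand k t x b = fun xi => cint mu (fun sg => F (sg, xi)).
  apply/funext => xi; rewrite /wave_integrand /wave_transform.
  rewrite mulrCA mulrC -cintZl; last first.
    apply: (cintegrable_le _ iw0).
      apply: cmfunM mw; apply: cmfun_expi; exact: measurable_funM.
    by move=> sg; rewrite ComplexField.Normc.normcM normc_expi mul1r.
  apply: eq_cint => sg; rewrite /F /osc_amp /= opprK mul1r expiD (mulrC sg).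
  rewrite -/(wave_weight k t sg); ring.
rewrite E; split; first exact: (cintegrable_cint2 iw0 iM mF FB).
rewrite -(cint_fubini iw0 iM mF FB).
have iB : mu.-integrable setT (EFin \o (fun sg => B * expR (d ^+ 2) *
    (normc (wave_weight k t sg) / jap sg ^+ n))).
  by have := integrableZl measurableT (B * expR (d ^+ 2)) iw.
have Fs sg : normc (cint nu (fun xi => F (sg, xi))) <=
    B * expR (d ^+ 2) * (normc (wave_weight k t sg) / jap sg ^+ n).
  rewrite (_ : (fun xi => F (sg, xi)) =
    fun xi => wave_weight k t sg * osc_amp (-1) x sg b xi)//.
  rewrite cintZl; last exact: (cintegrable_le (cmfun_osc_amp _ _ _ mb) iM (oB sg)).
  rewrite ComplexField.Normc.normcM mulrCA ler_wpM2l ?normc_ge0//.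
  by have := bB (-1) x sg (lexx _); rewrite opprK mul1r.
apply: (le_trans (normc_cint_le (cintegrable_cint1 iw0 iM mF FB) iB Fs)).
by rewrite RintegralZl// -!mulrA !ler_wpM2l ?expR_ge0.
Qed.

(** Integrability travels with the bound because [cint] is additive only on integrable functions. *)
Definition cint_bounded (g : 'cV[R]_n -> R[i]) (D : R) :=
  cintegrable nu g /\ normc (cint nu g) <= D.

Lemma cint_boundedD g1 g2 D1 D2 : cint_bounded g1 D1 -> cint_bounded g2 D2 ->
  cint_bounded (fun xi => g1 xi + g2 xi) (D1 + D2).
Proof.
move=> [i1 b1] [i2 b2]; split; first exact: cintegrableD.
by rewrite cintD// (le_trans (le_normcD _ _))// lerD.
Qed.

Lemma cint_boundedZ (z : R[i]) (q : R) g D : normc z <= q -> cint_bounded g D ->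
  cint_bounded (fun xi => z * g xi) (q * D).
Proof.
move=> zq [ig bg]; split; first exact: cintegrableZl.
by rewrite cintZl// ComplexField.Normc.normcM ler_pM ?normc_ge0.
Qed.

(** [half_wave_subordination] with the powers of 1 / |xi| moved into the amplitudes, so that the
    coefficients depend on t only; the 8 is the 2 of 1 / (2 pi) times the 4 of the coefficients
    there. Points where b vanishes, the origin among them, give 0 on both sides. *)
Lemma half_wave_integrandE t x xi b : t != 0 ->
  (b xi != 0 -> 0 < enorm xi) ->
  expi (dotv x xi) * (expi (t * enorm xi) * (b xi)%:C) =
  (3 / 8 / pi)%:C * wave_integrand 0 t x
     (fun xi => b xi / enorm xi / enorm xi / enorm xi) xi +
  (Complex 0 (t / 8 / pi) * wave_integrand 1 t x
     (fun xi => b xi / enorm xi / enorm xi / enorm xi) xi +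
  (Complex 0 (3 * t / 8 / pi) * wave_integrand 0 t x
     (fun xi => b xi / enorm xi / enorm xi) xi +
  ((- (t ^+ 2 / 8 / pi))%:C * wave_integrand 1 t x
     (fun xi => b xi / enorm xi / enorm xi) xi +
   (- (t ^+ 2 / 8 / pi))%:C * wave_integrand 0 t x
     (fun xi => b xi / enorm xi) xi))).
Proof.
move=> t0 b0; have [bz|/b0 r0] := eqVneq (b xi) 0.
  have W0 k c : c = 0 -> wave_integrand k t x (fun=> c) xi = 0.
    by move=> ->; rewrite /wave_integrand mulr0 (_ : 0%:C = 0) ?mulr0.
  have W (k : nat) b' : b' xi = 0 -> wave_integrand k t x b' xi = 0.
    exact: W0.
  rewrite bz (_ : 0%:C = 0)//; move: (pi : R) => P.
  by rewrite !W ?mulr0 ?addr0// bz !mul0r.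
rewrite (half_wave_subordination t0 r0) /wave_integrand -sqr_enorm.
move: (wave_transform 0 t _) (wave_transform 1 t _) (expi _) (expR _) => w0 w1 e E.
move: (b xi) r0 (pi_gt0 R); move: (enorm xi) (pi : R) => r P c.
move=> /lt0r_neq0 r0 /lt0r_neq0 P0; case: w0 => w0 v0; case: w1 => w1 v1.
case: e => e1 e2.
apply/eqP; rewrite eq_complex /=; apply/andP; split; apply/eqP.
  by field; rewrite r0 P0.
by field; rewrite r0 P0.
Qed.

(** For |t| <= 1 the rate is at least 1 and the L^1 norm of the amplitude suffices. For |t| > 1 all
    five coefficients are at most t^2, and t^2 / |t|^((n + 3) / 2) is the claimed rate. *)
Lemma half_wave_kernel_le d B b : (0 < n)%N -> 0 < d -> good_amp d B b ->
  exists C : R, forall x t, t != 0 -> cint_bounded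
    (fun xi => expi (dotv x xi) * (expi (t * enorm xi) * (b xi)%:C))
    (C * `|t| `^ (- ((n%:R - 1) / 2))).
Proof.
move=> n0 d0 gb; have [mb [M bM] bd _] := gb.
have B0 := good_amp_ge0 gb.
have g1 := good_amp_div_enorm d0 gb; have g2 := good_amp_div_enorm d0 g1.
have g3 := good_amp_div_enorm d0 g2.
have [C0 C00 W0] := wave_integrand_le (leq0n 1).
have [C1 C10 W1] := wave_integrand_le (leqnn 1).
have b0 xi : b xi != 0 -> 0 < enorm xi.
  move=> /bd h; rewrite sqrtr_gt0; apply: lt_le_trans h; exact: exprn_gt0.
set e := expR (d ^+ 2).
pose K := B / d / d / d * e * C0 + (B / d / d / d * e * C1 + (B / d / d * e * C0 +
   (B / d / d * e * C1 + B / d * e * C0))).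
have iM : nu.-integrable setT (EFin \o (fun xi => M * box_fun xi)).
  by have := integrableZl measurableT M integrable_box_fun.
pose L := \int[nu]_xi (M * box_fun xi).
have L0 : 0 <= L.
  apply: Rintegral_ge0 => xi _; exact: le_trans (bM xi).
have K0 : 0 <= K.
  by rewrite /K !addr_ge0// !mulr_ge0 ?invr_ge0 ?expR_ge0 ?(ltW d0).
exists (K + L) => x t t0.
have T0 : 0 < `|t| by rewrite normr_gt0.
have [t1|t1] := leP `|t| 1.
  have ig : cintegrable nu (fun xi => expi (dotv x xi) * (expi (t * enorm xi) * (b xi)%:C)).
    apply: cintegrable_le iM _.
      apply: cmfunM; first by apply: cmfun_expi; exact: measurable_dotv.
      apply: cmfunM; last exact: cmfun_real.
      by apply: cmfun_expi; apply: measurable_funM => //; exact: measurable_enorm.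
    by move=> xi; rewrite !ComplexField.Normc.normcM !normc_expi !mul1r normc_real.
  split => //; apply: (@le_trans _ _ L).
    apply: normc_cint_le => // xi.
    by rewrite !ComplexField.Normc.normcM !normc_expi !mul1r normc_real.
  apply: (@le_trans _ _ ((K + L) * 1)); first by rewrite mulr1 lerDr.
  apply: ler_wpM2l; first exact: addr_ge0.
  rewrite -[leLHS](powRr0 `|t|) ger_powR ?T0//.
  by rewrite oppr_le0 divr_ge0// subr_ge0 ler1n.
set s := Num.sqrt `|t| ^+ n.+3.
have s0 : 0 < s by rewrite exprn_gt0// sqrtr_gt0.
have sE : t ^+ 2 / s = `|t| `^ (- ((n%:R - 1) / 2)).
  rewrite /s -(powR12_sqrt (ltW T0)) -[_ ^+ n.+3]powR_mulrn ?powR_ge0// -powRrM.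
  rewrite -[t ^+ 2]real_normK ?num_real// -[`|t| ^+ 2]powR_mulrn ?ltW//.
  rewrite -powRB; last by rewrite (lt0r_neq0 T0) implybT.
  by congr (_ `^ _); rewrite -[n.+3]addn3 natrD; field.
have t2 : 1 <= t ^+ 2 by rewrite -real_normK ?num_real// exprn_ege1// ltW.
have tt : `|t| <= t ^+ 2 by rewrite -real_normK ?num_real// expr2 ler_peMr// ltW.
have p2 := @pi_ge2 R.
have pV (c : R) : 0 <= c <= 3 * t ^+ 2 -> c / 8 / pi <= t ^+ 2.
  move=> /andP[? ?]; rewrite ler_pdivrMr ?pi_gt0// ler_pdivrMr//; nra.
suff : cint_bounded
  (fun xi => expi (dotv x xi) * (expi (t * enorm xi) * (b xi)%:C)) (t ^+ 2 * (K / s)).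
  move=> [? h]; split => //; apply: (le_trans h).
  by rewrite mulrCA sE; apply: ler_wpM2r; [exact: powR_ge0|rewrite lerDl].
have -> : t ^+ 2 * (K / s) = t ^+ 2 * (B / d / d / d * e * C0 / s) +
    (t ^+ 2 * (B / d / d / d * e * C1 / s) + (t ^+ 2 * (B / d / d * e * C0 / s) +
    (t ^+ 2 * (B / d / d * e * C1 / s) + t ^+ 2 * (B / d * e * C0 / s)))).
  by rewrite /K !mulrDl !mulrDr.
rewrite (funext (fun xi => half_wave_integrandE x t0 (b0 xi))).
have q1 : normc (3 / 8 / pi)%:C <= t ^+ 2.
  rewrite normc_real ger0_norm ?divr_ge0 ?pi_ge0// pV//; nra.
have q2 : normc (Complex 0 (t / 8 / pi)) <= t ^+ 2.
  rewrite /= expr0n add0r sqrtr_sqr !normrM !normfV.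
  by rewrite [`|8|]ger0_norm// [`|pi|]ger0_norm ?pi_ge0// pV//; lra.
have q3 : normc (Complex 0 (3 * t / 8 / pi)) <= t ^+ 2.
  rewrite /= expr0n add0r sqrtr_sqr !normrM !normfV [`|3|]ger0_norm//.
  rewrite [`|8|]ger0_norm// [`|pi|]ger0_norm ?pi_ge0// pV//; lra.
have q4 : normc (- (t ^+ 2 / 8 / pi))%:C <= t ^+ 2.
  rewrite normc_real normrN ger0_norm ?divr_ge0 ?pi_ge0 ?sqr_ge0// pV//; lra.
apply: cint_boundedD; first by apply: cint_boundedZ q1 _; exact: W0 g3.
apply: cint_boundedD; first by apply: cint_boundedZ q2 _; exact: W1 g3.
apply: cint_boundedD; first by apply: cint_boundedZ q3 _; exact: W0 g2.
apply: cint_boundedD; first by apply: cint_boundedZ q4 _; exact: W1 g2.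
by apply: cint_boundedZ q4 _; exact: W0 g1.
Qed.

End half_wave_kernel.

(** * From kernel bounds to estimates from L^1 to L^infinity *)

Section dispersive.
Context {R : realType} {n : nat}.
Notation nu := (lebesgue_cV R n).
Implicit Types (a : 'cV[R]_n -> R[i]) (b : 'cV[R]_n -> R) (x xi : 'cV[R]_n) (t : R).

(** The multiplier acts by convolution: after the exchange of integrals, h(y) meets the kernel at x
    - y, and a uniform bound on the kernel is all that is used. *)
Lemma multiplier_le a (h : 'cV[R]_n -> R[i]) (D M : R) : cmfun a ->
  (forall xi, normc (a xi) <= M * box_fun xi) -> cintegrable nu h ->
  (forall x, normc (cint nu (fun xi => expi (dotv x xi) * a xi)) <= D) ->
  forall x, cint_bounded (fun xi => expi (dotv x xi) *
     (a xi * cint nu (fun y => expi (- dotv y xi) * h y)))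
   (D * \int[nu]_y normc (h y)).
Proof.
move=> ma aM ih aD x; have ihn := cintegrable_normc ih.
have mh := cintegrable_cmfun ih.
have iM : nu.-integrable setT (EFin \o (fun xi => M * box_fun xi)).
  by have := integrableZl measurableT M integrable_box_fun.
pose F (z : 'cV[R]_n * 'cV[R]_n) : R[i] :=
  h z.1 * (expi (dotv x z.2 - dotv z.1 z.2) * a z.2).
have m2 := @measurable_snd _ _ 'cV[R]_n 'cV[R]_n.
have m1 := @measurable_fst _ _ 'cV[R]_n 'cV[R]_n.
have mF : cmfun F.
  apply: cmfunM.
    by have [h1 h2] := mh; split; [exact: measurableT_comp h1 m1|exact: measurableT_comp h2 m1].
  apply: cmfunM; last first.
    by have [h1 h2] := ma; split; [exact: measurableT_comp h1 m2|exact: measurableT_comp h2 m2].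
  apply: cmfun_expi; apply: measurable_funB.
    exact: measurableT_comp (measurable_dotv x) m2.
  apply: measurable_sum => i; apply: measurable_funM.
    exact: measurableT_comp (measurable_coord i) m1.
  exact: measurableT_comp (measurable_coord i) m2.
have FB y xi : normc (F (y, xi)) <= normc (h y) * (M * box_fun xi).
  by rewrite /F !ComplexField.Normc.normcM normc_expi mul1r ler_wpM2l ?normc_ge0.
have iexp xi : cintegrable nu (fun y => expi (- dotv y xi) * h y).
  apply: cintegrable_le ihn _.
    apply: cmfunM mh; apply: cmfun_expi; apply: measurable_funN.
    by apply: measurable_sum => i; apply: measurable_funM => //; exact: measurable_coord.
  by move=> y; rewrite ComplexField.Normc.normcM normc_expi mul1r.
have ia y : cintegrable nu (fun xi => expi (dotv y xi) * a xi).
  apply: cintegrable_le iM _.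
    by apply: cmfunM ma; apply: cmfun_expi; exact: measurable_dotv.
  by move=> xi; rewrite ComplexField.Normc.normcM normc_expi mul1r.
have E xi : expi (dotv x xi) * (a xi * cint nu (fun y => expi (- dotv y xi) * h y)) =
    cint nu (fun y => F (y, xi)).
  rewrite mulrA -cintZl//; apply: eq_cint => y.
  rewrite /F /= expiD; ring.
rewrite (funext E); split; first exact: (cintegrable_cint2 ihn iM mF FB).
rewrite -(cint_fubini ihn iM mF FB) -RintegralZl//.
have iD : nu.-integrable setT (EFin \o (fun y => D * normc (h y))).
  by have := integrableZl measurableT D ihn.
apply: normc_cint_le (cintegrable_cint1 ihn iM mF FB) iD _ => y.
have -> : cint nu (fun xi => F (y, xi)) =
    h y * cint nu (fun xi => expi (dotv (x - y) xi) * a xi).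
  rewrite -cintZl//; apply: eq_cint => xi; rewrite /F; congr (_ * (expi _ * _)).
  by rewrite /dotv -sumrB; apply: eq_bigr => i _; rewrite !mxE mulrBl.
by rewrite ComplexField.Normc.normcM mulrC ler_wpM2r ?normc_ge0.
Qed.

(* The amplitudes [b] for which the kernel of b(D) e^{it|D|} decays at the rate
   of the wave equation. *)
Definition dispersive b := [/\ measurable_fun setT b,
  exists M, forall xi, `|b xi| <= M * box_fun xi &
  exists C : R, forall x t, t != 0 -> cint_bounded
    (fun xi => expi (dotv x xi) * (expi (t * enorm xi) * (b xi)%:C))
    (C * `|t| `^ (- ((n%:R - 1) / 2)))].

Lemma dispersive0 : dispersive (fun=> 0).
Proof.
split; first exact: measurable_cst.
  by exists 0 => xi; rewrite normr0 mul0r.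
exists 0 => x t t0; rewrite mul0r.
rewrite (_ : (fun xi => _) = fun=> 0).
  by split; [exact: cintegrable0|rewrite cint0 ComplexField.Normc.normc0].
by apply/funext => xi; rewrite (_ : 0%:C = 0)// !mulr0.
Qed.

Lemma dispersiveD b1 b2 : dispersive b1 -> dispersive b2 ->
  dispersive (fun xi => b1 xi + b2 xi).
Proof.
move=> [m1 [M1 h1] [C1 k1]] [m2 [M2 h2] [C2 k2]]; split.
- exact: measurable_funD.
- exists (M1 + M2) => xi; rewrite mulrDl; apply: (le_trans (ler_normD _ _)).
  exact: lerD.
exists (C1 + C2) => x t t0.
rewrite mulrDl; have := cint_boundedD (k1 x t t0) (k2 x t t0).
congr cint_bounded; apply/funext => xi.
by rewrite -!mulrDr -rmorphD.
Qed.

Lemma dispersiveZ (c : R) b : dispersive b -> dispersive (fun xi => c * b xi).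
Proof.
move=> [m1 [M1 h1] [C1 k1]]; split.
- exact: measurable_funM.
- by exists (`|c| * M1) => xi; rewrite normrM -mulrA ler_wpM2l.
exists (`|c| * C1) => x t t0; rewrite -mulrA.
have := @cint_boundedZ _ _ c%:C `|c| _ _ _ (k1 x t t0); rewrite normc_real => /(_ (lexx _)).
congr cint_bounded; apply/funext => xi.
by rewrite rmorphM /=; ring.
Qed.

Lemma dispersive_sum (I : Type) (s : seq I) (F : I -> 'cV[R]_n -> R) :
  (forall i, dispersive (F i)) -> dispersive (fun xi => \sum_(i <- s) F i xi).
Proof.
move=> FD; elim: s => [|i s ih].
  by under eq_fun do rewrite big_nil; exact: dispersive0.
by under eq_fun do rewrite big_cons; exact: dispersiveD.
Qed.

Lemma good_amp_dispersive d B b : (0 < n)%N -> 0 < d -> good_amp d B b -> dispersive b.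
Proof.
move=> n0 d0 gb; have [mb Mb _ _] := gb.
by split => //; exact: half_wave_kernel_le gb.
Qed.

(** A wave of speed c at time t is one of unit speed at time t c, so c enters only as a power in the
    constant. *)
Lemma dispersive_estimate b (c : R) : 0 < c -> dispersive b -> exists2 C : R, 0 <= C &
  forall (h : 'cV[R]_n -> R[i]) x t, cintegrable nu h -> t != 0 ->
  cint_bounded (fun xi => expi (dotv x xi) * (expi (t * c * enorm xi) * (b xi)%:C *
     cint nu (fun y => expi (- dotv y xi) * h y)))
   (C * `|t| `^ (- ((n%:R - 1) / 2)) * \int[nu]_y normc (h y)).
Proof.
move=> c0 [mb [M bM] [C kb]]; set p := - _.
exists (`|C| * c `^ p); first by rewrite mulr_ge0 ?powR_ge0.
move=> h x t ih t0.
have tc0 : t * c != 0 by rewrite mulf_neq0// lt0r_neq0.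
have -> : `|C| * c `^ p * `|t| `^ p = `|C| * `|t * c| `^ p.
  by rewrite normrM powRM// [`|c|]gtr0_norm// mulrA mulrAC.
apply: (@multiplier_le (fun xi => expi (t * c * enorm xi) * (b xi)%:C) h _ M) => //.
- apply: cmfunM; last exact: cmfun_real.
  by apply: cmfun_expi; apply: measurable_funM => //; exact: measurable_enorm.
- by move=> xi; rewrite ComplexField.Normc.normcM normc_expi mul1r normc_real.
move=> y; have [_ h1] := kb y _ tc0; apply: (le_trans h1).
by rewrite ler_wpM2r ?powR_ge0// ler_norm.
Qed.

Lemma cell_ampE d j m xi : cell_amp d j m xi =
  cell_amp d j (fun=> 0) xi * \prod_(i < n) xi i 0 ^+ m i.
Proof.
rewrite /cell_amp -big_split /=; apply: eq_bigr => i _.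
by rewrite expr0 mulr1.
Qed.

Lemma sum_cell_amp d xi : 0 < d -> n%:R * d ^+ 2 < 4^-1 -> 2^-1 <= enorm xi <= 2 ->
  \sum_(j < n) cell_amp d j (fun=> 0) xi = 1.
Proof.
move=> d0 nd /andP[e1 e2].
have xi2 i : -2 <= xi i 0 <= 2.
  have : xi i 0 ^+ 2 <= 4.
    apply: (@le_trans _ _ (enorm xi ^+ 2)).
      rewrite sqr_enorm /dotv (bigD1 i)//= -expr2 lerDl.
      by apply: sumr_ge0 => k _; rewrite -expr2 sqr_ge0.
    have : 0 <= enorm xi by apply: sqrtr_ge0.
    nra.
  by move=> h; apply/andP; split; nra.
(* If all coordinates were below d, then |xi|^2 <= n d^2 < 1/4. The least such j is then the one
   cell that contains xi. *)
have [j0 j0P] : exists j, d <= `|xi j 0|.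
  apply: contrapT => /forallNP xd.
  have : enorm xi ^+ 2 <= n%:R * d ^+ 2.
    rewrite sqr_enorm /dotv mulrC mulr_natr -[n in leRHS](card_ord n) -sumr_const.
    apply: ler_sum => i _; have /negP := xd i; rewrite -ltNge.
    by rewrite ltr_norml => /andP[? ?]; nra.
  have : 4^-1 <= enorm xi ^+ 2.
    by nra.
  by lra.
case: (@arg_minnP _ j0 (fun j => d <= `|xi j 0|) (fun j => val j) j0P) => j jP jmin.
have jlt (i : 'I_n) : (i < j)%N -> `|xi i 0| < d.
  by move=> ij; rewrite ltNge; apply/negP => /jmin /=; rewrite leqNgt ij.
rewrite (bigD1 j)//= [X in X + _](_ : _ = 1); last first.
  rewrite /cell_amp big1// => i _; rewrite expr0 mulr1 indicE mem_set//.
  rewrite /cell_side; case: ifPn => [ij|_].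
    by have := jlt i ij; rewrite ltr_norml /= in_itv.
  case: eqVneq => [->|_]; last by rewrite /= in_itv; exact: xi2.
  have /andP[? ?] := xi2 j; rewrite /= !in_itv/=.
  have [x0|x0] := leP 0 (xi j 0).
    by right; apply/andP; split=> //; move: jP; rewrite ger0_norm.
  left; apply/andP; split=> //; move: jP; rewrite ltr0_norm//; lra.
rewrite big1 ?addr0// => k kj; rewrite /cell_amp.
have [lt_kj|le_jk] := ltnP k j.
  rewrite (bigD1 k)//= indicE memNset ?mul0r// /cell_side ltnn eqxx.
  have := jlt k lt_kj; rewrite ltr_norml => /andP[? ?].
  by rewrite /= !in_itv/= => -[/andP[? ?]|/andP[? ?]]; lra.
have jk : (j < k)%N by rewrite ltn_neqAle le_jk andbT eq_sym.
rewrite (bigD1 j)//= indicE memNset ?mul0r// /cell_side jk.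
rewrite /= in_itv/= -ltr_norml; move: jP; rewrite leNgt; exact/negP.
Qed.

(** The choice d = 1 / (2 n) gives n d^2 = 1 / (4 n) < 1/4, as [sum_cell_amp] asks. The sum has to
    equal 1 only on the annulus that carries the Fourier transform. *)
Definition cutoff xi : R := \sum_(j < n) cell_amp (2 * n%:R)^-1 j (fun=> 0) xi.

Lemma cutoff_side : (1 < n)%N -> 0 < ((2 * n%:R)^-1 : R) <= 2.
Proof.
move=> n2; have h : 2 <= n%:R :> R by rewrite ler_nat.
have q1 : 1 <= 2 * n%:R :> R by lra.
have q0 : 0 < 2 * n%:R :> R by lra.
have q2 : (2 * n%:R)^-1 <= 1 :> R by rewrite invf_le1.
by rewrite invr_gt0 q0 /=; lra.
Qed.

Lemma cutoff1 xi : (1 < n)%N -> 2^-1 <= enorm xi <= 2 -> cutoff xi = 1.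
Proof.
move=> n2 xi2; have /andP[d0 _] := cutoff_side n2.
have h : 2 <= n%:R :> R by rewrite ler_nat.
apply: sum_cell_amp => //; rewrite (_ : n%:R * _ = 4^-1 * n%:R^-1); last by field; lra.
by rewrite gtr_pMr// invf_lt1; lra.
Qed.

Lemma dispersive_cutoff : (1 < n)%N -> dispersive cutoff.
Proof.
move=> n2; have dd := cutoff_side n2; have /andP[d0 _] := dd.
apply: dispersive_sum => j.
by apply: (good_amp_dispersive (ltnW n2) d0); apply: good_cell_amp.
Qed.

Lemma dispersive_cutoff_riesz (k l : 'I_n) : (1 < n)%N ->
  dispersive (fun xi => cutoff xi * (xi k 0 * xi l 0) / enorm xi / enorm xi).
Proof.
move=> n2; have dd := cutoff_side n2; have /andP[d0 _] := dd.
(* Exponents of the monomial xi_k xi_l; the value is 2 at i = k = l. *)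
pose m (i : 'I_n) : nat := ((i == k) + (i == l))%N.
have mE xi : \prod_(i < n) xi i 0 ^+ m i = xi k 0 * xi l 0.
  under eq_bigr do rewrite exprD.
  rewrite big_split /= (bigD1 k)//= eqxx expr1 big1 ?mulr1; last first.
    by move=> i /negPf ->; rewrite expr0.
  rewrite (bigD1 l)//= eqxx expr1 big1 ?mulr1//.
  by move=> i /negPf ->; rewrite expr0.
rewrite (_ : (fun xi => _) = fun xi => \sum_(j < n)
    (cell_amp (2 * n%:R)^-1 j m xi / enorm xi / enorm xi)); last first.
  apply/funext => xi; rewrite -!mulr_suml; congr (_ / _ / _).
  by rewrite -mE mulr_suml; apply: eq_bigr => j _; rewrite -cell_ampE.
apply: dispersive_sum => j; apply: (good_amp_dispersive (ltnW n2) d0).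
do 2 apply: good_amp_div_enorm => //.
apply: good_cell_amp => // i; rewrite /m.
by case: (i == k); case: (i == l).
Qed.

End dispersive.

(** * Square root and exponential of the symbol *)

Section square_root.
Context {R : realType}.

Lemma sqr_mx n (x : 'cV[R]_n) : x^T *m x = (dotv x x)%:M.
Proof.
apply/matrixP => i j; rewrite !ord1 !mxE eqxx mulr1n.
by apply: eq_bigr => k _; rewrite mxE.
Qed.

Lemma dotvv_eq0 n (x : 'cV[R]_n) : dotv x x = 0 -> x = 0.
Proof.
move=> /eqP; rewrite psumr_eq0; last by move=> i _; rewrite -expr2 sqr_ge0.
move=> /allP h; apply/colP => i; rewrite mxE.
by have := h i (mem_index_enum _); rewrite mulf_eq0 orbb => /eqP.
Qed.

Variable n : nat.
Implicit Types (S D Q : 'M[R]_n) (x : 'cV[R]_n).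

Definition qform S x : R := (x^T *m S *m x) 0 0.

Lemma qform_proj Q x : Q^T = Q -> Q *m Q = Q -> qform Q x = dotv (Q *m x) (Q *m x).
Proof.
move=> QT QQ; rewrite /qform -{1}QQ -{1}QT mulmxA -trmx_mul -mulmxA sqr_mx.
by rewrite mxE eqxx mulr1n.
Qed.

Lemma qformD S1 S2 x : qform (S1 + S2) x = qform S1 x + qform S2 x.
Proof. by rewrite /qform mulmxDr mulmxDl mxE. Qed.

Lemma qformZ a S x : qform (a *: S) x = a * qform S x.
Proof. by rewrite /qform -scalemxAr -scalemxAl mxE. Qed.

Section projection.
Variables (Q : 'M[R]_n) (QT : Q^T = Q) (QQ : Q *m Q = Q).

Lemma compl_proj_tr : (1%:M - Q)^T = 1%:M - Q.
Proof. by rewrite linearB /= tr_scalar_mx QT. Qed.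

Lemma compl_proj_mul : (1%:M - Q) *m Q = 0.
Proof. by rewrite mulmxBl mul1mx QQ subrr. Qed.

Lemma mul_compl_proj : Q *m (1%:M - Q) = 0.
Proof. by rewrite mulmxBr mulmx1 QQ subrr. Qed.

Lemma compl_proj_idem : (1%:M - Q) *m (1%:M - Q) = 1%:M - Q.
Proof. by rewrite mulmxBr mulmx1 compl_proj_mul subr0. Qed.

Lemma spectral_tr a b : (a *: (1%:M - Q) + b *: Q)^T = a *: (1%:M - Q) + b *: Q.
Proof.
by apply/matrixP => i j; rewrite !mxE eq_sym -{1}QT mxE -[in _ * Q _ _]QT mxE.
Qed.

Lemma qform_spectral a b x : qform (a *: (1%:M - Q) + b *: Q) x =
  a * dotv ((1%:M - Q) *m x) ((1%:M - Q) *m x) + b * dotv (Q *m x) (Q *m x).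
Proof.
rewrite qformD !qformZ (qform_proj _ QT QQ).
by rewrite (qform_proj _ compl_proj_tr compl_proj_idem).
Qed.

Lemma qform_spectral_ge0 a b x : 0 <= a -> 0 <= b ->
  0 <= qform (a *: (1%:M - Q) + b *: Q) x.
Proof. by move=> a0 b0; rewrite qform_spectral addr_ge0// mulr_ge0// dotv_ge0. Qed.

Lemma qform_spectral_eq0 a b x : 0 < a -> 0 < b ->
  qform (a *: (1%:M - Q) + b *: Q) x = 0 -> x = 0.
Proof.
move=> a0 b0; rewrite qform_spectral => /eqP; rewrite paddr_eq0 ?mulr_ge0 ?dotv_ge0 ?ltW//.
rewrite !mulf_eq0 (gt_eqF a0) (gt_eqF b0) /= => /andP[/eqP /dotvv_eq0 h1 /eqP /dotvv_eq0 h2].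
by rewrite -[x]mul1mx -[1%:M](subrK Q) mulmxDl h1 h2 addr0.
Qed.

Lemma sqr_spectral a b : (a *: (1%:M - Q) + b *: Q) *m (a *: (1%:M - Q) + b *: Q) =
  a ^+ 2 *: (1%:M - Q) + b ^+ 2 *: Q.
Proof.
rewrite mulmxDl !mulmxDr -!scalemxAl -!scalemxAr compl_proj_idem QQ.
by rewrite compl_proj_mul mul_compl_proj !scaler0 addr0 add0r !scalerA.
Qed.

End projection.

Lemma qform_col D S j : qform S (col j D) = (D^T *m S *m D) j j.
Proof. by rewrite /qform tr_col -row_mul !mxE; apply: eq_bigr => k _; rewrite !mxE. Qed.

(* If [D] is the difference of two square roots [S], [S0], then
   [D S + S0 D = S^2 - S0^2 = 0], and [tr (D S D) + tr (D S0 D) = 0] has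
   nonnegative summands. *)
Lemma psd_sqrt_unique S S0 : psdmx S -> psdmx S0 ->
  (forall x, qform S0 x = 0 -> x = 0) -> S *m S = S0 *m S0 -> S = S0.
Proof.
move=> [ST Sge0] [S0T S0ge0] S0pd SS.
pose D := S - S0; have DT : D^T = D by rewrite /D linearB /= ST S0T.
have D0 : D *m S + S0 *m D = 0.
  by rewrite /D mulmxBl mulmxBr SS addrA subrK subrr.
have trE T : \tr (D *m T *m D) = \sum_j qform T (col j D).
  by apply: eq_bigr => j _; rewrite qform_col DT.
have : \tr (D *m S *m D) + \tr (D *m S0 *m D) = 0.
  rewrite mxtrace_mulC -mxtraceD -[D *m S0 *m D]mulmxA -mulmxDr D0 mulmx0.
  by rewrite linear0.
rewrite !trE => /eqP; rewrite paddr_eq0; last 2 first.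
- by apply: sumr_ge0 => j _; exact: Sge0.
- by apply: sumr_ge0 => j _; exact: S0ge0.
move=> /andP[_]; rewrite psumr_eq0; last by move=> j _; exact: S0ge0.
move=> /allP h; apply/eqP; rewrite -subr_eq0; apply/eqP/matrixP => i j.
have /= /eqP /S0pd /colP /(_ i) := h j (mem_index_enum _).
by rewrite !mxE.
Qed.

Lemma sqrtmxE A S0 : psdmx S0 -> (forall x, qform S0 x = 0 -> x = 0) ->
  S0 *m S0 = A -> sqrtmx A = S0.
Proof.
move=> pS0 pd E; apply: xget_unique => // S [pS ES].
by apply: psd_sqrt_unique => //; rewrite ES.
Qed.

Definition dir_proj x : 'M[R]_n := (dotv x x)^-1 *: (x *m x^T).

Lemma dir_proj_tr x : (dir_proj x)^T = dir_proj x.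
Proof. by rewrite /dir_proj linearZ /= trmx_mul trmxK. Qed.

Lemma dir_proj_idem x : x != 0 -> dir_proj x *m dir_proj x = dir_proj x.
Proof.
move=> x0; have d0 : dotv x x != 0 by apply: contra_neq x0; exact: dotvv_eq0.
rewrite /dir_proj -scalemxAl -scalemxAr mulmxA -[x *m x^T *m x]mulmxA sqr_mx.
by rewrite mul_mx_scalar -scalemxAl !scalerA -?mulrA mulVf// mulr1.
Qed.

(** As x x^T = |x|^2 P, the symbol is mu |x|^2 (1 - P) + (lambda + 2 mu) |x|^2 P. Both speeds are
    positive, so the candidate root is definite, as the uniqueness argument requires. *)
Lemma sqrtmx_lame lambda mu x : 0 < mu -> 0 < lambda + 2 * mu -> x != 0 ->
  sqrtmx (lame_symbol lambda mu x) =
  (Num.sqrt mu * enorm x) *: (1%:M - dir_proj x) +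
  (Num.sqrt (lambda + 2 * mu) * enorm x) *: dir_proj x.
Proof.
move=> mu0 la0 x0; have d0 : dotv x x != 0 by apply: contra_neq x0; exact: dotvv_eq0.
have e0 : 0 < enorm x by rewrite sqrtr_gt0 lt_neqAle eq_sym d0 dotv_ge0.
have PT := dir_proj_tr x; have PP := dir_proj_idem x0.
have a0 : 0 < Num.sqrt mu * enorm x by apply: mulr_gt0 e0; rewrite sqrtr_gt0.
have b0 : 0 < Num.sqrt (lambda + 2 * mu) * enorm x.
  by apply: mulr_gt0 e0; rewrite sqrtr_gt0.
apply: sqrtmxE.
- split; first by apply: spectral_tr.
  by move=> y; exact: (qform_spectral_ge0 PT PP y (ltW a0) (ltW b0)).
- by move=> y; exact: (qform_spectral_eq0 PT PP).
rewrite (sqr_spectral PP) !exprMn (sqr_sqrtr (ltW mu0)) (sqr_sqrtr (ltW la0)).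
rewrite /lame_symbol /enorm (sqr_sqrtr (dotv_ge0 x)) /dir_proj.
apply/matrixP => i j; rewrite !mxE -[mu * _ *+ _]mulr_natr.
by field.
Qed.

End square_root.

Section exponential.
Context {R : realType}.
Implicit Types (th : R).

Lemma expCi_coeff th k :
  (k`!%:R)^-1 * (th *i) ^+ k = Complex (cos_coeff th k) (sin_coeff th k).
Proof.
have pw : (th *i) ^+ k = Complex ((~~ odd k)%:R * (-1) ^+ k./2 * th ^+ k)
    ((odd k)%:R * (-1) ^+ k.-1./2 * th ^+ k).
  elim: k => [|k ih]; first by rewrite /= !expr0 !mul1r !mul0r.
  rewrite exprS ih; have k1 : (k.+1)./2 = (odd k + k./2)%N by rewrite /= uphalf_half.
  rewrite k1 /= [in RHS]exprS; have [ok|ek] := boolP (odd k); last first.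
    by apply/eqP; rewrite eq_complex /=; apply/andP; split; apply/eqP; ring.
  have kE : k.-1./2 = k./2 by case: k ok {ih k1} => //= k /negPf ok; rewrite uphalf_half ok.
  rewrite kE add1n (exprS _ k./2).
  by apply/eqP; rewrite eq_complex /=; apply/andP; split; apply/eqP; ring.
rewrite pw -(rmorph_nat (real_complex R)) -fmorphV.
apply/eqP; rewrite eq_complex /= /cos_coeff /sin_coeff /=.
by apply/andP; split; apply/eqP; rewrite mul0r ?subr0 ?addr0 [RHS]mulrC.
Qed.

Lemma normc_le_ReIm (z : R[i]) : normc z <= `|complex.Re z| + `|complex.Im z|.
Proof.
rewrite -ler_sqr ?nnegrE ?normc_ge0 ?addr_ge0// sqr_normc_ReIm.
rewrite -[complex.Re z ^+ 2]real_normK ?num_real//.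
rewrite -[complex.Im z ^+ 2]real_normK ?num_real//.
have := normr_ge0 (complex.Re z); have := normr_ge0 (complex.Im z); nra.
Qed.

Lemma ReIm_sum (I : Type) (s : seq I) (P : pred I) (f g : I -> R) :
  \sum_(i <- s | P i) Complex (f i) (g i) =
  Complex (\sum_(i <- s | P i) f i) (\sum_(i <- s | P i) g i).
Proof. by elim/big_rec3: _ => // i a b c _ ->. Qed.

Lemma cvg_expi_series th :
  (fun N => \sum_(0 <= k < N) (k`!%:R)^-1 * (th *i) ^+ k : R[i]^o) @ \oo --> (expi th : R[i]^o).
Proof.
under eq_fun do (under eq_bigr do rewrite expCi_coeff); under eq_fun do rewrite ReIm_sum.
have cc : series (cos_coeff th) @ \oo --> cos th.
  by rewrite unlock; exact: is_cvg_series_cos_coeff.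
have cs : series (sin_coeff th) @ \oo --> sin th.
  by rewrite unlock; exact: is_cvg_series_sin_coeff.
apply/cvgrPdist_lt => eps eps0.
(* In the order of [R[i]], a positive element is real. *)
have [e e0 ->] : exists2 e : R, 0 < e & eps = e%:C.
  case: eps eps0 => a b; rewrite ltcE /= => /andP[/eqP -> a0].
  by exists a.
have e2 : 0 < e / 2 by rewrite divr_gt0.
have /cvgrPdist_lt/(_ _ e2) c1 := cc; have /cvgrPdist_lt/(_ _ e2) s1 := cs.
near=> N.
have a1 : `|cos th - series (cos_coeff th) N| < e / 2 by near: N.
have a2 : `|sin th - series (sin_coeff th) N| < e / 2 by near: N.
rewrite -[X in X < _]/((normc _)%:C) ltcR.
apply: (@le_lt_trans _ _ (`|cos th - series (cos_coeff th) N| +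
   `|sin th - series (sin_coeff th) N|)).
  exact: normc_le_ReIm (expi th - Complex (series (cos_coeff th) N) (series (sin_coeff th) N)).
by rewrite [e]splitr ltrD.
Unshelve. all: end_near. Qed.

(** Q and 1 - Q are complementary idempotents, so powers act on the two scalars separately and the
    matrix series splits into two scalar ones. *)
Lemma expmx_spectral n (Q : 'M[R[i]]_n) th1 th2 : Q *m Q = Q ->
  expmx ((th1 *i) *: (1%:M - Q) + (th2 *i) *: Q) =
  expi th1 *: (1%:M - Q) + expi th2 *: Q.
Proof.
move=> QQ; set A := (_ + _).
have Ak k : A ^+ k = (th1 *i) ^+ k *: (1%:M - Q) + (th2 *i) ^+ k *: Q.
  elim: k => [|k ih]; first by rewrite !expr0 !scale1r subrK.
  rewrite exprS ih -mulmxE /A mulmxDl !mulmxDr -!scalemxAl -!scalemxAr.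
  rewrite !mulmxBl !mulmxBr !mulmx1 !mul1mx QQ !subrr !subr0 !scaler0.
  by rewrite addr0 add0r !scalerA -!exprS.
have cv : series (fun k => (k`!%:R)^-1 *: A ^+ k : 'M[R[i]^o]_n) @ \oo -->
   (expi th1 *: (1%:M - Q) + expi th2 *: Q : 'M[R[i]^o]_n).
  rewrite (_ : series _ = fun N =>
    (\sum_(0 <= k < N) (k`!%:R)^-1 * (th1 *i) ^+ k : R[i]^o) *: (1%:M - Q : 'M[R[i]^o]_n) +
    (\sum_(0 <= k < N) (k`!%:R)^-1 * (th2 *i) ^+ k : R[i]^o) *: (Q : 'M[R[i]^o]_n)).
    by apply: cvgD; apply: cvgZr_tmp; exact: cvg_expi_series.
  apply/funext => N; rewrite /series /= !scaler_suml -big_split /=.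
  by apply: eq_bigr => k _; rewrite Ak scalerDr !scalerA.
exact: (cvg_lim (@norm_hausdorff _ _) cv).
Qed.

End exponential.

(** * The Lame propagator *)

Section norms.
Context {R : realType} {n : nat}.
Notation nu := (lebesgue_cV R n).
Implicit Types (f : 'cV[R]_n -> 'cV[R[i]]_n).

Lemma vLnormy_le f (B : R) : 0 <= B -> (forall x j, normc (f x j 0) <= B) ->
  (vLnorm +oo f <= B%:E)%E.
Proof.
move=> B0 fB; rewrite /vLnorm; elim/big_ind: _ => [|a b ha hb|j _].
- by rewrite lee_fin.
- by rewrite ge_max ha.
(* The norm is an essential supremum if the space has positive measure and 0 otherwise; the bound
   holds in both cases. *)
rewrite Lnorm.unlock; case: ifPn => _; last by rewrite lee_fin.
apply/ess_supP; apply: nearW => x /=.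
by rewrite lee_fin ger0_norm ?normc_ge0.
Qed.

Lemma vLnorm1E f : vLnorm 1 f =
  (\sum_(j < n) \int[nu]_x (normc (f x j 0))%:E)%E.
Proof.
have E (j : 'I_n) : Lnorm nu 1 (fun x => (normc (f x j 0))%:E) =
    (\int[nu]_x (normc (f x j 0))%:E)%E.
  by rewrite Lnorm1; apply: eq_integral => x _ /=; rewrite ger0_norm ?normc_ge0.
have I0 (j : 'I_n) : (0 <= \int[nu]_x (normc (f x j 0))%:E)%E.
  by apply: integral_ge0 => x _; rewrite lee_fin normc_ge0.
rewrite /vLnorm invr1 poweRe1.
  by apply: eq_bigr => j _; rewrite E poweRe1.
by apply: sume_ge0 => j _; exact: poweR_ge0.
Qed.

Lemma inL1_cintegrable f j : inL1 f -> cintegrable nu (fun x => f x j 0).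
Proof.
move=> [mf]; rewrite vLnorm1E => fin; have mfj : cmfun (fun x => f x j 0) := mf j.
have I0 (i : 'I_n) : (0 <= \int[nu]_x (normc (f x i 0))%:E)%E.
  by apply: integral_ge0 => x _; rewrite lee_fin normc_ge0.
apply: (@cintegrable_le _ _ _ _ _ (fun x => normc (f x j 0))) => //.
apply/integrableP; split; first exact/measurable_EFinP/measurable_normc.
apply: le_lt_trans fin; rewrite (bigD1 j)//=.
rewrite -[leLHS]adde0; apply: leeD; last exact: sume_ge0.
rewrite le_eqVlt; apply/orP; left; apply/eqP; apply: eq_integral => x _ /=.
by rewrite ger0_norm ?normc_ge0.
Qed.

Lemma vLnorm1_Rintegral f : inL1 f ->
  vLnorm 1 f = (\sum_(j < n) \int[nu]_x normc (f x j 0))%:E.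
Proof.
move=> fL1; rewrite vLnorm1E -sumEFin; apply: eq_bigr => j _.
have /cintegrable_normc/integrable_fin_num := inL1_cintegrable j fL1.
by move=> /(_ measurableT) fin; rewrite /Rintegral fineK.
Qed.

End norms.

Section assembly.
Context {R : realType} {n : nat}.
Notation nu := (lebesgue_cV R n).
Implicit Types (x xi : 'cV[R]_n).

Lemma cint_bounded_sum (I : Type) (s : seq I) (g : I -> 'cV[R]_n -> R[i]) (D : I -> R) :
  (forall i, cint_bounded (g i) (D i)) ->
  cint_bounded (fun xi => \sum_(i <- s) g i xi) (\sum_(i <- s) D i).
Proof.
move=> gD; elim: s => [|i s ih].
  rewrite big_nil; under eq_fun do rewrite big_nil.
  by split; [exact: cintegrable0|rewrite cint0 ComplexField.Normc.normc0].
by rewrite big_cons; under eq_fun do rewrite big_cons; exact: cint_boundedD.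
Qed.

Lemma map_spectral (Q : 'M[R]_n) (a b : R) :
  map_mx (real_complex R) (a *: (1%:M - Q) + b *: Q) =
  a%:C *: (1%:M - map_mx (real_complex R) Q) + b%:C *: map_mx (real_complex R) Q.
Proof.
apply/matrixP => i j; rewrite !mxE; move: (Q i j) => q.
by apply/eqP; rewrite eq_complex; case: (i == j); rewrite /=;
  apply/andP; split; apply/eqP; ring.
Qed.

Lemma expmx_lame lambda mu (t : R) xi : 0 < mu -> 0 < lambda + 2 * mu -> xi != 0 ->
  expmx ((t *i) *: map_mx (real_complex R) (sqrtmx (lame_symbol lambda mu xi))) =
  expi (t * Num.sqrt mu * enorm xi) *: (1%:M - map_mx (real_complex R) (dir_proj xi)) +
  expi (t * Num.sqrt (lambda + 2 * mu) * enorm xi) *: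
    map_mx (real_complex R) (dir_proj xi).
Proof.
move=> mu0 la0 xi0; set P := map_mx _ (dir_proj xi).
have PP : P *m P = P by rewrite /P -map_mxM dir_proj_idem.
rewrite (sqrtmx_lame mu0 la0 xi0).
rewrite -(expmx_spectral (t * Num.sqrt mu * enorm xi)
  (t * Num.sqrt (lambda + 2 * mu) * enorm xi) PP).
congr expmx.
have tE (c : R) : (t *i) * (c * enorm xi)%:C = (t * c * enorm xi) *i :> R[i].
  by apply/eqP; rewrite eq_complex /=; apply/andP; split; apply/eqP; ring.
by rewrite map_spectral -/P scalerDr !scalerA !tE.
Qed.

(** Entries of 1 - P, with P the projection onto the line of xi, times [cutoff]; [amp_pressure] does
    the same for P. The form is a linear combination to which [dispersiveD] and [dispersiveZ]
    apply. *)
Definition amp_shear (j k : 'I_n) xi : R :=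
  (j == k)%:R * cutoff xi + -1 * (cutoff xi * (xi j 0 * xi k 0) / enorm xi / enorm xi).

Definition amp_pressure (j k : 'I_n) xi : R :=
  cutoff xi * (xi j 0 * xi k 0) / enorm xi / enorm xi.

Lemma dispersive_shear j k : (1 < n)%N -> dispersive (amp_shear j k).
Proof.
by move=> n2; apply: dispersiveD; apply: dispersiveZ;
  [exact: dispersive_cutoff|exact: dispersive_cutoff_riesz].
Qed.

Lemma expmx_lame_entry lambda mu (t : R) xi j k : 0 < mu -> 0 < lambda + 2 * mu ->
  (1 < n)%N -> 2^-1 <= enorm xi <= 2 ->
  expmx ((t *i) *: map_mx (real_complex R) (sqrtmx (lame_symbol lambda mu xi))) j k =
  expi (t * Num.sqrt mu * enorm xi) * (amp_shear j k xi)%:C +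
  expi (t * Num.sqrt (lambda + 2 * mu) * enorm xi) * (amp_pressure j k xi)%:C.
Proof.
move=> mu0 la0 n2 xi2; have /andP[e1 _] := xi2.
have e0 : 0 < enorm xi by apply: lt_le_trans e1; rewrite invr_gt0.
have xi0 : xi != 0.
  apply: contraTneq e0 => ->; rewrite /enorm /dotv big1 ?sqrtr0 ?ltxx// => i _.
  by rewrite mxE mul0r.
have PE : dir_proj xi j k = xi j 0 * xi k 0 / enorm xi / enorm xi.
  rewrite !mxE big_ord1 !mxE -sqr_enorm; field; exact: lt0r_neq0.
rewrite expmx_lame//; move: (dir_proj xi) PE => P PE.
rewrite !mxE /amp_shear /amp_pressure (cutoff1 n2 xi2) mulr1 mul1r -PE mulN1r.
move: (P j k) => p; congr (_ * _ + _).
by rewrite (rmorphB (real_complex R)); congr (_ - _); case: (j == k).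
Qed.

Lemma supp_annulus (g : 'cV[R]_n -> 'cV[R[i]]_n) xi :
  supp g `<=` [set xi | 2^-1 <= enorm xi <= 2] -> g xi != 0 -> 2^-1 <= enorm xi <= 2.
Proof. by move=> h gxi; apply: h; exact: subset_closure. Qed.

End assembly.

Theorem theorem1p1 (R : realType) (n : nat) (lambda mu : R)
  (n_ge2 : (2 <= n)%N) (mu_gt0 : 0 < mu) (lambda2mu_gt0 : 0 < lambda + 2 * mu) :
  exists C : R,
    forall (f : 'cV[R]_n -> 'cV[R[i]]_n) (t : R),
      inL1 f ->
      supp (fourier f) `<=` [set xi | 2^-1 <= enorm xi <= 2] ->
      t != 0 ->
      (vLnorm +oo (lame_wave lambda mu t f) <=
       (C * `|t| `^ (- ((n%:R - 1) / 2)))%:E * vLnorm 1 f)%E.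
Proof.
set c1 := Num.sqrt mu; set c2 := Num.sqrt (lambda + 2 * mu).
have c10 : 0 < c1 by rewrite sqrtr_gt0.
have c20 : 0 < c2 by rewrite sqrtr_gt0.
have est (jk : 'I_n * 'I_n) : exists C : R, 0 <= C /\
    forall (h : 'cV[R]_n -> R[i]) x t, cintegrable (lebesgue_cV R n) h -> t != 0 ->
    cint_bounded (fun xi => expi (dotv x xi) *
      (expi (t * c1 * enorm xi) * (amp_shear jk.1 jk.2 xi)%:C *
         cint (lebesgue_cV R n) (fun y => expi (- dotv y xi) * h y)) +
      expi (dotv x xi) *
      (expi (t * c2 * enorm xi) * (amp_pressure jk.1 jk.2 xi)%:C *
         cint (lebesgue_cV R n) (fun y => expi (- dotv y xi) * h y)))
     (C * `|t| `^ (- ((n%:R - 1) / 2)) * \int[lebesgue_cV R n]_y normc (h y)).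
  have [C1 C10 e1] := dispersive_estimate c10 (dispersive_shear jk.1 jk.2 n_ge2).
  have [C2 C20 e2] := dispersive_estimate c20 (dispersive_cutoff_riesz jk.1 jk.2 n_ge2).
  exists (C1 + C2); split; first exact: addr_ge0.
  move=> h x t ih t0; have := cint_boundedD (e1 h x t ih t0) (e2 h x t ih t0).
  by rewrite -[_ * \int[_]__ _ + _]mulrDl -[_ * _ `^ _ + _]mulrDl.
have [C CP] := choice est.
(* One constant must serve every component j of the sup norm, so the entrywise constants are summed
   over j as well as over k; the prefactor is that of the inverse transform. *)
pose K := (2 * pi) ^- n * \sum_j \sum_k C (j, k).
have C0 jk : 0 <= C jk by have [] := CP jk.
have pi0 : 0 <= (2 * pi) ^- n :> R by rewrite invr_ge0 exprn_ge0// mulr_ge0// pi_ge0.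
exists K => f t fL1 fs t0; set T := `|t| `^ _.
have T0 : 0 <= T by exact: powR_ge0.
rewrite (vLnorm1_Rintegral fL1) -EFinM.
have I0 k : 0 <= \int[lebesgue_cV R n]_x normc (f x k 0).
  by apply: Rintegral_ge0 => x _; exact: normc_ge0.
have K0 : 0 <= K by rewrite mulr_ge0// sumr_ge0// => j _; rewrite sumr_ge0.
apply: vLnormy_le => [|x j].
  by apply: mulr_ge0; [exact: mulr_ge0|apply: sumr_ge0 => k _; exact: I0].
rewrite mxE ComplexField.Normc.normcM normc_real ger0_norm//.
have E : (fun xi => expi (dotv x xi) * (expmx ((t *i) *: map_mx (real_complex R)
      (sqrtmx (lame_symbol lambda mu xi))) *m fourier f xi) j 0) =
   fun xi => \sum_k (expi (dotv x xi) *
      (expi (t * c1 * enorm xi) * (amp_shear j k xi)%:C * fourier f xi k 0) +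
      expi (dotv x xi) *
      (expi (t * c2 * enorm xi) * (amp_pressure j k xi)%:C * fourier f xi k 0)).
  (* Where the transform vanishes both sides are 0; elsewhere xi lies in the annulus, where the
     cutoff is 1 and can be inserted freely. *)
  apply/funext => xi; have [f0|f0] := eqVneq (fourier f xi) 0.
    rewrite f0 mulmx0 mxE mulr0 big1// => k _.
    by rewrite mxE !mulr0 addr0.
  rewrite mxE mulr_sumr; apply: eq_bigr => k _.
  rewrite expmx_lame_entry//; last exact: supp_annulus f0.
  by rewrite -mulrDr -mulrDl.
rewrite cintegralE E.
have [_ bd] : cint_bounded (fun xi => \sum_k (expi (dotv x xi) *
      (expi (t * c1 * enorm xi) * (amp_shear j k xi)%:C * fourier f xi k 0) +
      expi (dotv x xi) *
      (expi (t * c2 * enorm xi) * (amp_pressure j k xi)%:C * fourier f xi k 0)))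
   (\sum_k C (j, k) * T * \int[lebesgue_cV R n]_y normc (f y k 0)).
  apply: cint_bounded_sum => k.
  have [_ /(_ _ x t (inL1_cintegrable k fL1) t0)] := CP (j, k).
  by congr cint_bounded; apply/funext => xi; rewrite mxE.
rewrite /K -!mulrA ler_wpM2l//; apply: (le_trans bd).
rewrite mulr_suml; apply: (@le_trans _ _ (\sum_k C (j, k) * (T *
    \sum_i \int[lebesgue_cV R n]_y normc (f y i 0)))).
  apply: ler_sum => k _; rewrite -mulrA ler_wpM2l// ler_wpM2l//.
  by rewrite (bigD1 k)//= lerDl sumr_ge0.
rewrite -mulr_suml [leRHS](bigD1 j)//= lerDl sumr_ge0// => i _.
by apply: mulr_ge0; [exact: sumr_ge0|apply: mulr_ge0 => //; exact: sumr_ge0].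
Qed.
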